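(* Let $\ell$ be a Sturm--Liouville expression on $(a,b)$ whose minimal operator $\mathbf L_{\min}$ is semi-bounded and for which both endpoints $a$ and $b$ are in the limit-circle case and non-oscillatory. For a self-adjoint linear relation $\Theta$ in $\mathbb C^2$ define $\boldsymbol A_\Theta$ as the singular rank-two perturbation $$\boldsymbol A_\Theta:=\boldsymbol A_0+\mathbf B\Theta\mathbf B^*,$$ understood in the sense of semi-bounded forms as in the context. Then every self-adjoint extension of the minimal operator $\mathbf L_{\min}$ can be written as $\boldsymbol A_\Theta$ for some self-adjoint linear relation $\Theta$ in $\mathbb C^2$.
   Context: **Operators.** Let $-\infty\le a<b\le\infty$, let $p,w>0$ a.e. on $(a,b)$, let $q$ be real-valued, and let $1/p,q,w\in L^1_{loc}(a,b)$. Put $\ell[f]=-\frac1w\big((pf')'+qf\big)$ on $\mathcal H=L^2[(a,b),w]$. The maximal domain is $\mathcal D_{\max}=\{f: f,pf'\in AC_{loc}(a,b),\ f,\ell[f]\in\mathcal H\}$, and $\mathbf L_{\max}$ acts by $\ell$ on $\mathcal D_{\max}$. For $f,g\in\mathcal D_{\max}$ put $[f,g](x)=p(x)\big(f(x)\overline{g'(x)}-f'(x)\overline{g(x)}\big)$; the limits $[f,g](a),[f,g](b)$ exist. $\mathbf L_{\min}$ acts by $\ell$ on $\mathcal D_{\min}=\{f\in\mathcal D_{\max}:[f,g](b)-[f,g](a)=0\ \forall g\in\mathcal D_{\max}\}$; it is closed and symmetric with adjoint $\mathbf L_{\max}$. **Solutions.** Fix $\lambda_0\in\mathbb R$. A real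 solution $u$ (respectively $v$) of $\ell[f]=\lambda_0f$ is principal (respectively non-principal) at an endpoint if $1/(pu^2)$ is not integrable (respectively $1/(pv^2)$ is integrable) near it. Let $v_a,v_b$ be real solutions of $\ell[f]=\lambda_0 f$ that are non-principal at $a$ and $b$, respectively, normalized so that $[u_a,v_a](a)=1$ and $[u_b,v_b](b)=1$ for some principal solutions $u_a$ at $a$, $u_b$ at $b$. **Boundary maps.** For $f\in\mathcal D_{\max}$ put $$\Gamma_0f=\begin{pmatrix}\lim_{x\to a^+}f(x)/v_a(x)\\ \lim_{x\to b^-}f(x)/v_b(x)\end{pmatrix},\qquad \Gamma_1f=\begin{pmatrix}-[f,v_a](a)\\ [f,v_b](b)\end{pmatrix}.$$ $\boldsymbol A_0$ and $\boldsymbol A_\infty$ are the self-adjoint extensions of $\mathbf L_{\min}$ acting by $\ell$ on $\ker\Gamma_1$ and on $\ker\Gamma_0$, respectively. **Form domain.** Choose $a<c<d<b$ with $v_a$ zero-free on $(a,c]$ and $v_b$ zero-free on $[d,b)$; put $N_\varphi f=\sqrt p\,\varphi\,(f/\varphi)'$ and $$\mathfrak D=\{f\in\mathcal H: f\in AC_{loc}(a,b),\ \sqrt pf'\in L^2(c,d),\ N_{v_a}f\in L^2(a,c),\ N_{v_b}f\in L^2(d,b)\}.$$ $\mathfrak D$ is the domain of the closed semi-bounded form $\mathfrak t$ associated with $\boldsymbol A_0$, and $\mathcal D_{\max}\subset\mathfrak D$. For $f\in\mathfrak D$ put $\Lambda f=\big(\lim_{x\to a^+}f/v_a,\ \lim_{x\to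 b^-}f/v_b\big)^{\top}=\big(\langle f,\widetilde\delta_a\rangle_1,\langle f,\widetilde\delta_b\rangle_1\big)^{\top}$, which defines $\widetilde\delta_a,\widetilde\delta_b\in\mathcal H_{-1}(\boldsymbol A_0)$ (the dual of the form domain $\mathcal H_1(\boldsymbol A_0)=\mathfrak D$). $\mathbf B:\mathbb C^2\to\mathcal H_{-1}(\boldsymbol A_0)$ is multiplication by the row $(\widetilde\delta_a,\widetilde\delta_b)$, and $\mathbf B^*=\Lambda$ on $\mathcal H_1(\boldsymbol A_0)$. **Meaning of the perturbation.** A self-adjoint linear relation $\Theta$ in $\mathbb C^2$ is a linear subspace of $\mathbb C^2\times\mathbb C^2$ equal to its adjoint; $\operatorname{mul}\Theta=\{h':\{0,h'\}\in\Theta\}$, and $\Theta=\Theta_{op}\,\widehat\oplus\,(\{0\}\times\operatorname{mul}\Theta)$ with $\Theta_{op}$ a self-adjoint operator on $\operatorname{dom}\Theta=(\operatorname{mul}\Theta)^\perp$. $\boldsymbol A_\Theta=\boldsymbol A_0+\mathbf B\Theta\mathbf B^*$ is the self-adjoint operator associated with the closed semi-bounded form $\mathfrak t_\Theta$ defined as follows. (i) If $\Theta$ is a Hermitian $2\times2$ matrix: $\mathfrak t_\Theta[f,g]=\mathfrak t[f,g]+\langle\Theta\Lambda f,\Lambda g\rangle$ on $\mathfrak D$. (ii) If $\dim\operatorname{dom}(\Theta_{op})=1$: $\mathfrak t_\Theta[f,g]=\mathfrak t[f,g]+\langle\Theta_{op}\Lambda f,\Lambda g\rangle$ on $\{h\in\mathfrak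 D:\Lambda h\in\operatorname{dom}(\Theta_{op})\}$. (iii) If $\Theta=\{0\}\times\mathbb C^2$: $\mathfrak t_\Theta=\mathfrak t$ on $\{h\in\mathfrak D:\Lambda h=0\}$, so $\boldsymbol A_\Theta=\boldsymbol A_\infty$, the Friedrichs extension. *)

(* Defs.v *)
From mathcomp Require Import all_boot all_order all_algebra.
From mathcomp Require Import all_classical all_reals all_analysis.
From mathcomp Require Import complex.

Set Implicit Arguments.
Unset Strict Implicit.
Unset Printing Implicit Defensive.

Import Order.TTheory GRing.Theory Num.Theory.
Import numFieldNormedType.Exports.

Local Open Scope classical_set_scope.
Local Open Scope ring_scope.
Local Open Scope complex_scope.

Local Notation Re := complex.Re.
Local Notation Im := complex.Im.

Record sturm_liouville (R : realType) := SturmLiouville {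
  sl_a : \bar R;
  sl_b : \bar R;
  sl_p : R -> R;
  sl_q : R -> R;
  sl_w : R -> R;
  sl_ab : (sl_a < sl_b)%E;
  sl_p_gt0 : {ae lebesgue_measure, forall x : R,
    (sl_a < x%:E)%E -> (x%:E < sl_b)%E -> 0 < sl_p x};
  sl_w_gt0 : {ae lebesgue_measure, forall x : R,
    (sl_a < x%:E)%E -> (x%:E < sl_b)%E -> 0 < sl_w x};
  sl_loc_integrable : forall c d : R, (sl_a < c%:E)%E -> (d%:E < sl_b)%E ->
    [/\ lebesgue_measure.-integrable `[c, d] (fun x => ((sl_p x)^-1)%:E),
        lebesgue_measure.-integrable `[c, d] (fun x => (sl_q x)%:E) &
        lebesgue_measure.-integrable `[c, d] (fun x => (sl_w x)%:E)]
}.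

Inductive endpoint := Left | Right.

Section SturmLiouville.
Context {R : realType}.
Implicit Types (l : sturm_liouville R) (f g h : R -> R[i]) (u v phi : R -> R).

Definition interval_of l : set R :=
  [set x | (sl_a l < x%:E)%E /\ (x%:E < sl_b l)%E].

(* the one-sided pieces (a, c] and [c, b) *)
Definition piece l (e : endpoint) (c : R) : set R :=
  match e with
  | Left => [set x | (sl_a l < x%:E)%E /\ x <= c]
  | Right => [set x | c <= x /\ (x%:E < sl_b l)%E]
  end.

(* the filters x -> a^+ and x -> b^-; the endpoints may be infinite *)
Definition end_filter l (e : endpoint) : set_system R :=
  filter_from (interval_of l) (piece l e).

Definition toC u : R -> R[i] := fun x => (u x)%:C.

Definition lim_at l (e : endpoint) h : R[i] :=
  lim (((fun x => Re (h x)) : R -> R) @ end_filter l e)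
  +i* lim (((fun x => Im (h x)) : R -> R) @ end_filter l e).

Definition cderive h : R -> R[i] :=
  fun x => derive1 (fun y => Re (h y)) x +i* derive1 (fun y => Im (h y)) x.

Definition cintegral (D : set R) h : R[i] :=
  Rintegral lebesgue_measure D (fun x => Re (h x))
  +i* Rintegral lebesgue_measure D (fun x => Im (h x)).

Definition eq_ae (D : set R) f g : Prop :=
  {ae lebesgue_measure, forall x, D x -> f x = g x}.

Definition abs_continuous (c d : R) (phi : R -> R) : Prop :=
  forall eps : R, 0 < eps -> exists2 delta : R, 0 < delta &
    forall (n : nat) (s r : 'I_n -> R),
      (forall i, [/\ c <= s i, s i <= r i & r i <= d]) ->
      (forall i j, i != j -> r i <= s j \/ r j <= s i) ->
      \sum_(i < n) (r i - s i) < delta ->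
      \sum_(i < n) `|phi (r i) - phi (s i)| < eps.

Definition AC_loc l f : Prop := forall c d : R,
  interval_of l c -> interval_of l d ->
  abs_continuous c d (fun x => Re (f x)) /\ abs_continuous c d (fun x => Im (f x)).

(* Square-integrable functions with weight rho.  Elements of an L^2 space are
   Borel functions, and identities between them are stated modulo [eq_ae]. *)
Definition sqr_int (D : set R) (rho : R -> R) f : Prop :=
  [/\ measurable_fun D (fun x => Re (f x)),
      measurable_fun D (fun x => Im (f x)) &
      lebesgue_measure.-integrable D
        (fun x => ((Re (f x) ^+ 2 + Im (f x) ^+ 2) * rho x)%:E)].

(* membership of a function only determined a.e., such as a derivative *)
Definition sqr_int_ae (D : set R) (rho : R -> R) f : Prop :=
  exists2 g, sqr_int D rho g & eq_ae D g f.

(** * The Hilbert space L^2((a,b), w) and operators in it *)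

Definition hilb l : set (R -> R[i]) := sqr_int (interval_of l) (sl_w l).

Definition hdot l f g : R[i] :=
  cintegral (interval_of l) (fun x => f x * conjc (g x) * (sl_w l x)%:C).

Definition hnorm2 l f : R := Re (hdot l f f).

(* Operators are given by their graphs, as sets of pairs of functions that are
   saturated for a.e. equality. *)
Definition op_graph := set ((R -> R[i]) * (R -> R[i])).

Definition dense_in l (D : set (R -> R[i])) : Prop :=
  forall h, hilb l h -> forall eps : R, 0 < eps ->
    exists2 f, D f & hnorm2 l (fun x => h x - f x) < eps.

Definition subspace (D : set (R -> R[i])) : Prop :=
  D (fun=> 0) /\
  forall (k : R[i]) f g, D f -> D g -> D (fun x => k * f x + g x).

Definition is_operator l (T : op_graph) : Prop :=
  [/\ forall f h, T (f, h) -> hilb l f /\ hilb l h,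
      forall f h f' h', hilb l f' -> hilb l h' ->
        eq_ae (interval_of l) f f' -> eq_ae (interval_of l) h h' ->
        T (f, h) -> T (f', h'),
      T (fun=> 0, fun=> 0),
      forall (k : R[i]) f h f' h', T (f, h) -> T (f', h') ->
        T (fun x => k * f x + f' x, fun x => k * h x + h' x) &
      forall f h h', T (f, h) -> T (f, h') -> eq_ae (interval_of l) h h'].

Definition adjoint l (T : op_graph) : op_graph :=
  [set gk | [/\ hilb l gk.1, hilb l gk.2 &
     forall f h, T (f, h) -> hdot l h gk.1 = hdot l f gk.2]].

Definition self_adjoint l (T : op_graph) : Prop :=
  [/\ is_operator l T,
      dense_in l [set f | exists h, T (f, h)] &
      adjoint l T = T].

Definition bounded_below l (T : op_graph) : Prop :=
  exists m : R, forall f h, T (f, h) -> m * hnorm2 l f <= Re (hdot l h f).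

(** * The Sturm-Liouville expression *)

(* [F] is a locally absolutely continuous version of p f' *)
Definition is_quasi_derivative l f (F : R -> R[i]) : Prop :=
  AC_loc l F /\
  eq_ae (interval_of l) F (fun x => (sl_p l x)%:C * cderive f x).

(* the version of p f' that is locally absolutely continuous, when there is
   one; it is then unique on (a, b) *)
Definition quasi_derivative l f : R -> R[i] :=
  xget (fun=> 0) [set F | is_quasi_derivative l f F].

Definition ell l f : R -> R[i] := fun x =>
  - ((sl_w l x)^-1)%:C *
    (cderive (quasi_derivative l f) x + (sl_q l x)%:C * f x).

(* f and p f' are locally absolutely continuous *)
Definition regular l f : Prop :=
  AC_loc l f /\ exists F, is_quasi_derivative l f F.

Definition D_max l : set (R -> R[i]) :=
  [set f | [/\ regular l f, hilb l f &
               sqr_int_ae (interval_of l) (sl_w l) (ell l f)]].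

Definition bracket l f g : R -> R[i] := fun x =>
  f x * conjc (quasi_derivative l g x) - quasi_derivative l f x * conjc (g x).

Definition D_min l : set (R -> R[i]) :=
  [set f | D_max l f /\ forall g, D_max l g ->
     lim_at l Right (bracket l f g) - lim_at l Left (bracket l f g) = 0].

(* the operator acting by ell on D *)
Definition acting_on l (D : set (R -> R[i])) : op_graph :=
  [set fh | [/\ hilb l fh.1, hilb l fh.2 &
     exists f, [/\ D f, eq_ae (interval_of l) fh.1 f &
                   eq_ae (interval_of l) fh.2 (ell l f)]]].

Definition L_min l : op_graph := acting_on l (D_min l).

Definition self_adjoint_extension l (T : op_graph) : Prop :=
  self_adjoint l T /\ L_min l `<=` T.

(** * Solutions and endpoint classification *)

Definition solution l (lam : R[i]) f : Prop :=
  regular l f /\ eq_ae (interval_of l) (ell l f) (fun x => lam * f x).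

Definition limit_circle l (e : endpoint) : Prop :=
  forall (lam : R[i]) f, solution l lam f ->
    exists2 c : R, interval_of l c & sqr_int (piece l e c) (sl_w l) f.

Definition zero_free (D : set R) u : Prop := forall x, D x -> u x != 0.

(* no nontrivial real solution has zeros accumulating at the endpoint *)
Definition non_oscillatory l (e : endpoint) (lam0 : R) : Prop :=
  forall u, solution l lam0%:C (toC u) ->
    (exists2 x, interval_of l x & u x != 0) ->
    exists2 c : R, interval_of l c & zero_free (piece l e c) u.

(* [zero_free] discards the spurious values of 1/(p u^2) due to 1/0 = 0.  Once
   u is zero-free on the piece, its integrability does not depend on c. *)
Definition principal l (e : endpoint) (lam0 : R) u : Prop :=
  solution l lam0%:C (toC u) /\
  exists c : R, [/\ interval_of l c, zero_free (piece l e c) u &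
    ~ lebesgue_measure.-integrable (piece l e c)
        (fun x => ((sl_p l x * u x ^+ 2)^-1)%:E)].

Definition non_principal l (e : endpoint) (lam0 : R) v : Prop :=
  solution l lam0%:C (toC v) /\
  exists c : R, [/\ interval_of l c, zero_free (piece l e c) v &
    lebesgue_measure.-integrable (piece l e c)
        (fun x => ((sl_p l x * v x ^+ 2)^-1)%:E)].

Definition normalized_non_principal l (e : endpoint) (lam0 : R) v : Prop :=
  non_principal l e lam0 v /\
  exists2 u, principal l e lam0 u &
    lim_at l e (bracket l (toC u) (toC v)) = 1.

(** * Boundary maps, the operator A_0 and the form domain *)

Definition vec2 (x y : R[i]) : 'cV[R[i]]_2 :=
  \col_(i < 2) (if i == 0 then x else y).

(* Lambda and Gamma_0 are given by the same formula, on the form domain and on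
   D_max respectively. *)
Definition Lambda l (va vb : R -> R) f : 'cV[R[i]]_2 :=
  vec2 (lim_at l Left (fun x => f x / (va x)%:C))
       (lim_at l Right (fun x => f x / (vb x)%:C)).

Definition Gamma1 l (va vb : R -> R) f : 'cV[R[i]]_2 :=
  vec2 (- lim_at l Left (bracket l f (toC va)))
       (lim_at l Right (bracket l f (toC vb))).

Definition A_0 l (va vb : R -> R) : op_graph :=
  acting_on l [set f | D_max l f /\ Gamma1 l va vb f = 0].

Definition N_op l phi f : R -> R[i] := fun x =>
  (Num.sqrt (sl_p l x) * phi x)%:C * cderive (fun y => f y / (phi y)%:C) x.

Definition form_domain l (va vb : R -> R) (c d : R) : set (R -> R[i]) :=
  [set f | [/\ hilb l f, AC_loc l f,
    sqr_int_ae `[c, d] (fun=> 1)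
      (fun x => (Num.sqrt (sl_p l x))%:C * cderive f x),
    sqr_int_ae (piece l Left c) (fun=> 1) (N_op l va f) &
    sqr_int_ae (piece l Right d) (fun=> 1) (N_op l vb f)]].

(** * Sesquilinear forms and the operators associated with them *)

Record sesq_form := Form {
  fdom : set (R -> R[i]);
  fval : (R -> R[i]) -> (R -> R[i]) -> R[i]
}.

(* A densely defined Hermitian form in L^2((a,b), w), linear in its first
   argument.  [fdom t] consists of chosen representatives, hence the
   compatibility of [fval t] with a.e. equality. *)
Definition hermitian_form l (t : sesq_form) : Prop :=
  [/\ fdom t `<=` hilb l /\ subspace (fdom t),
      dense_in l (fdom t),
      forall f f' g, fdom t f -> fdom t f' -> fdom t g ->
        eq_ae (interval_of l) f f' -> fval t f g = fval t f' g,
      forall (k : R[i]) f f' g, fdom t f -> fdom t f' -> fdom t g ->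
        fval t (fun x => k * f x + f' x) g = k * fval t f g + fval t f' g &
      forall f g, fdom t f -> fdom t g -> fval t g f = conjc (fval t f g)].

Definition semibounded_form l (t : sesq_form) : Prop :=
  exists m : R, forall f, fdom t f -> m * hnorm2 l f <= Re (fval t f f).

Definition form_dist (t : sesq_form) f g : R :=
  `| Re (fval t (fun x => f x - g x) (fun x => f x - g x)) |.

(* Kato's definition: if f_n -> f in L^2 and t[f_n - f_m] -> 0, then f belongs
   to the domain (up to a null set) and t[f_n - f] -> 0. *)
Definition closed_form l (t : sesq_form) : Prop :=
  forall (f_ : nat -> R -> R[i]) f, (forall n, fdom t (f_ n)) -> hilb l f ->
    (forall eps : R, 0 < eps -> exists N : nat, forall n, (N <= n)%N ->
       hnorm2 l (fun x => f_ n x - f x) < eps) ->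
    (forall eps : R, 0 < eps -> exists N : nat, forall n m,
       (N <= n)%N -> (N <= m)%N -> form_dist t (f_ n) (f_ m) < eps) ->
    exists f0, [/\ fdom t f0, eq_ae (interval_of l) f f0 &
      forall eps : R, 0 < eps -> exists N : nat, forall n, (N <= n)%N ->
        form_dist t (f_ n) f0 < eps].

Definition closed_semibounded_form l (t : sesq_form) : Prop :=
  [/\ hermitian_form l t, semibounded_form l t & closed_form l t].

(* the operator associated with t by the first representation theorem *)
Definition form_operator l (t : sesq_form) : op_graph :=
  [set fh | [/\ hilb l fh.1, hilb l fh.2 &
     exists f, [/\ fdom t f, eq_ae (interval_of l) fh.1 f &
       forall g, fdom t g -> fval t f g = hdot l fh.2 g]]].

(** * Linear relations in C^2 *)

Definition relation2 := set ('cV[R[i]]_2 * 'cV[R[i]]_2).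

Definition dot2 (x y : 'cV[R[i]]_2) : R[i] :=
  \sum_(i < 2) x i 0 * conjc (y i 0).

Definition linear_relation (Theta : relation2) : Prop :=
  Theta (0, 0) /\
  forall (k : R[i]) x y, Theta x -> Theta y ->
    Theta (k *: x.1 + y.1, k *: x.2 + y.2).

Definition adjoint_relation (Theta : relation2) : relation2 :=
  [set y | forall x, Theta x -> dot2 x.2 y.1 = dot2 x.1 y.2].

Definition self_adjoint_relation (Theta : relation2) : Prop :=
  linear_relation Theta /\ adjoint_relation Theta = Theta.

Definition mul_rel (Theta : relation2) : set 'cV[R[i]]_2 :=
  [set x' | Theta (0, x')].

(* Theta_op, the part of Theta orthogonal to {0} x mul Theta *)
Definition op_part (Theta : relation2) : relation2 :=
  [set x | Theta x /\ forall y, mul_rel Theta y -> dot2 x.2 y = 0].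

Definition dom_rel (Theta : relation2) : set 'cV[R[i]]_2 :=
  [set x | exists x', Theta (x, x')].

(* the value at x of Theta_op, for x in dom Theta_op *)
Definition op_val (Theta : relation2) (x : 'cV[R[i]]_2) : 'cV[R[i]]_2 :=
  xget 0 [set x' | op_part Theta (x, x')].

(** * The perturbation A_0 + B Theta B^* *)

(* For t on the form domain, the form t[f,g] + <Theta_op Lambda f, Lambda g> on
   {f in dom t : Lambda f in dom Theta_op}.  When Theta is a Hermitian matrix
   the constraint is void, and when Theta = {0} x C^2 it reads Lambda f = 0 and
   the added term vanishes. *)
Definition perturbed_form l (va vb : R -> R) (t : sesq_form) (Theta : relation2)
    : sesq_form :=
  Form [set f | fdom t f /\ dom_rel (op_part Theta) (Lambda l va vb f)]
       (fun f g => fval t f g +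
          dot2 (op_val Theta (Lambda l va vb f)) (Lambda l va vb g)).

Definition A_pert l (va vb : R -> R) (t : sesq_form) (Theta : relation2) : op_graph :=
  form_operator l (perturbed_form l va vb t Theta).

End SturmLiouville.

Arguments op_graph R : clear implicits.
Arguments sesq_form R : clear implicits.
Arguments relation2 R : clear implicits.

(* Main.v *)
(* Green's identity <ell f, g> - <f, ell g> = <Gamma_1 f, Gamma_0 g> - <Gamma_0 f, Gamma_1 g>
   on D_max, the surjectivity of (Gamma_0, Gamma_1) and L_min^* = L_max show that, for a
   self-adjoint extension L, the relation Theta = {(Gamma_0 f, Gamma_1 f) : f in dom L} is
   self-adjoint.  The identity t[f, g] = <ell f, g> - <Gamma_1 f, Lambda g>, for f in D_max
   and g in the form domain, shows that A_Theta extends L, and testing with dom L shows that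
   A_Theta is contained in L^* = L.

   As t is only known to be the closed form of A_0, this identity is at first available for
   Gamma_1 f = 0, and it remains to prove it for one f with Gamma_1 f = e_i, for i = 1, 2.
   Near the endpoint put k_n = v / (int v^2 w), cut off to a shrinking neighbourhood, and let
   r_n solve (ell - lam0) r_n = k_n with zero data at the other endpoint.  Then
   Gamma_1 r_n = e_i, while |r_n| <= |v| int 1/(p v^2) with the integral over the
   neighbourhood, so that r_n -> 0 in L^2 and r_0 - r_n, which is in dom A_0, is Cauchy for t.
   Since <k_n, g> tends to the conjugate of lim g/v, closedness of t yields the identity for
   r_0 in the limit. *)
Require Import Defs.
From HB Require Import structures.
From mathcomp Require Import all_boot all_order all_algebra.
From mathcomp Require Import all_classical all_reals all_analysis.
From mathcomp Require Import measurable_realfun complex ring lra.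

Set Implicit Arguments.
Unset Strict Implicit.
Unset Printing Implicit Defensive.

Import Order.TTheory GRing.Theory Num.Theory.
Import numFieldNormedType.Exports.

(** * Absolutely continuous functions *)

Section AbsoluteContinuity.
Local Open Scope classical_set_scope.
Local Open Scope ring_scope.
Context {R : realType}.
Implicit Types (c d x y : R) (f g h phi : R -> R).

(** Why [r_n] is small: if a_n is the coefficient of the principal solution in r_n, then (r_n / v)'
    = - a_n / (p v^2), and a_n is a partial integral of k_n v w, which is non-negative with total
    integral 1. So |a_n| <= 1, and only the integrability of 1/(p v^2) near the endpoint enters. The
    scaling of k_n makes <k_n, g> a mean of the conjugate of g / v; this controls the form although
    the L^2 norms of k_n are unbounded. Two obstacles shape the rest. Operators identify functions
    that agree almost everywhere, while traces need the locally absolutely continuous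
    representative; each passage between the two rests on the fact that such representatives, once
    equal almost everywhere, are equal on the whole interval. And absolute continuity is the
    epsilon-delta notion, so the density of such a function has to be constructed, from its
    variation function and a Stieltjes measure, before Green's identity can be integrated. *)

Lemma abs_continuous_unif c d phi : abs_continuous c d phi ->
  forall eps, 0 < eps -> exists2 delta, 0 < delta &
    forall x y, c <= x -> x <= d -> c <= y -> y <= d ->
      `|x - y| < delta -> `|phi x - phi y| < eps.
Proof.
move=> H eps /H[delta d0 {}H]; exists delta => // x y cx xd cy yd.
wlog xy : x y cx xd cy yd / x <= y.
  move=> W; have [xy|/ltW yx] := leP x y; first exact: W.
  by rewrite distrC => xyd; rewrite distrC; exact: W.
rewrite distrC ger0_norm ?subr_ge0// => xyd.
have /= := H 1 (fun=> x) (fun=> y).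
rewrite !big_ord1 distrC; apply => //.
by move=> i j; rewrite !ord1 eqxx.
Qed.

Lemma abs_continuous_within c d phi : abs_continuous c d phi ->
  {within `[c, d], continuous phi}.
Proof.
move=> H; apply/subspace_continuousP => x /=; rewrite in_itv/= => /andP[cx xd].
apply/cvgrPdist_lt => eps /(abs_continuous_unif H)[delta d0 {}H].
near=> y; have : `[c, d]%classic y by near: y; exact: withinT.
rewrite /= in_itv/= => /andP[cy yd]; apply: H => //.
by near: y; apply: cvg_within; exact: nbhsx_ballx.
Unshelve. all: by end_near. Qed.

Lemma abs_continuous_continuous c d phi x : abs_continuous c d phi ->
  c < x < d -> {for x, continuous phi}.
Proof.
move=> H /andP[cx xd]; apply/cvgrPdist_lt => eps /(abs_continuous_unif H).
move=> [delta d0 {}H].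
have N : nbhs x (ball x delta) by exact: nbhsx_ballx.
have : nbhs x `]c, d[%classic by apply: near_in_itvoo; rewrite in_itv/= cx.
apply: filterS2 N => y xy /=; rewrite in_itv/= => /andP[cy yd].
by apply: H => //; apply: ltW.
Qed.

Lemma abs_continuous_bounded c d phi : abs_continuous c d phi ->
  exists2 M, 0 < M & forall x, c <= x -> x <= d -> `|phi x| <= M.
Proof.
move=> H; have [cd|dc] := leP c d; last first.
  by exists 1 => // x cx xd; have := lt_le_trans dc (le_trans cx xd); rewrite ltxx.
have ctn := abs_continuous_within H.
have [m _ mM] := EVT_max cd ctn; have [n _ nm] := EVT_min cd ctn.
exists (1 + (`|phi m| + `|phi n|)); first by rewrite ltr_pwDl// addr_ge0.
move=> x cx xd; have xi : x \in `[c, d] by rewrite in_itv/= cx.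
have := mM _ xi; have := nm _ xi; have := ler_norm (phi m).
have := ler_norm (- phi n); rewrite normrN ler_norml.
have := normr_ge0 (phi m); have := normr_ge0 (phi n).
by move=> *; apply/andP; split; lra.
Qed.

(** A single comparison of increments from which the closure under sums, products and inverses
    follows. *)
Lemma abs_continuous_dominated c d M f g h :
  (forall x y, c <= x -> x <= y -> y <= d ->
     `|h y - h x| <= M * (`|f y - f x| + `|g y - g x|)) ->
  abs_continuous c d f -> abs_continuous c d g -> abs_continuous c d h.
Proof.
move=> H acf acg eps e0.
(* [M] may have any sign; [N] is a positive bound for it, so that eps / (2 N) can be allotted to [f]
   and to [g]. *)
pose N := 1 + `|M|; have N0 : 0 < N by rewrite ltr_pwDl.
have e2 : 0 < eps / (2 * N) by rewrite divr_gt0// mulr_gt0.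
have [d1 d10 H1] := acf _ e2; have [d2 d20 H2] := acg _ e2.
exists (Num.min d1 d2); first by rewrite lt_min d10.
move=> n s r srP dis; rewrite lt_min => /andP[L1 L2].
have {}H1 := H1 n s r srP dis L1; have {}H2 := H2 n s r srP dis L2.
have : \sum_(i < n) `|h (r i) - h (s i)| <=
  N * (\sum_(i < n) `|f (r i) - f (s i)| + \sum_(i < n) `|g (r i) - g (s i)|).
  rewrite -big_split/= mulr_sumr; apply: ler_sum => i _.
  have [cs sr rd] := srP i; apply: le_trans (H _ _ cs sr rd) _.
  apply: ler_wpM2r; first exact: addr_ge0.
  by rewrite /N; have := ler_norm M; lra.
move=> /le_lt_trans; apply; rewrite -ltr_pdivlMl//.
apply: (lt_le_trans (ltrD H1 H2)); idtac.
by rewrite le_eqVlt; apply/orP; left; apply/eqP; field; rewrite gt_eqF.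
Qed.

Lemma abs_continuous_cst c d (k : R) : abs_continuous c d (cst k).
Proof.
move=> eps e0; exists 1 => // n s r _ _ _.
by rewrite big1// => i _; rewrite subrr normr0.
Qed.

Lemma abs_continuousD c d f g : abs_continuous c d f -> abs_continuous c d g ->
  abs_continuous c d (fun x => f x + g x).
Proof.
move=> acf acg; apply: (@abs_continuous_dominated _ _ 1 f g) => // x y _ _ _.
by rewrite mul1r opprD addrACA ler_normD.
Qed.

Lemma abs_continuousM c d f g : abs_continuous c d f -> abs_continuous c d g ->
  abs_continuous c d (fun x => f x * g x).
Proof.
move=> acf acg; have [M M0 fM] := abs_continuous_bounded acf.
have [N N0 gN] := abs_continuous_bounded acg.
apply: (@abs_continuous_dominated _ _ (M + N) f g) => // x y cx xy yd.
have -> : f y * g y - f x * g x = f y * (g y - g x) + (f y - f x) * g x by ring.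
apply: le_trans (ler_normD _ _) _; rewrite !normrM.
have := fM y (le_trans cx xy) yd; have := gN x cx (le_trans xy yd).
have := normr_ge0 (f y - f x); have := normr_ge0 (g y - g x).
by move=> *; nra.
Qed.

Lemma abs_continuousZ c d k f : abs_continuous c d f ->
  abs_continuous c d (fun x => k * f x).
Proof. by move=> ?; apply: abs_continuousM => //; exact: abs_continuous_cst. Qed.

Lemma abs_continuousN c d f : abs_continuous c d f ->
  abs_continuous c d (fun x => - f x).
Proof.
move=> /(abs_continuousZ (-1)); congr abs_continuous.
by apply/funext => x; rewrite mulN1r.
Qed.

Lemma abs_continuousB c d f g : abs_continuous c d f -> abs_continuous c d g ->
  abs_continuous c d (fun x => f x - g x).
Proof. by move=> ? ?; apply: abs_continuousD => //; exact: abs_continuousN. Qed.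

(** The minimum of |f| on [c, d] is attained, hence non-zero, and its inverse square is the constant
    of the comparison. For d < c only the empty family of intervals has to be considered. *)
Lemma abs_continuousV c d f : abs_continuous c d f ->
  (forall x, c <= x -> x <= d -> f x != 0) ->
  abs_continuous c d (fun x => (f x)^-1).
Proof.
move=> acf f0; have [cd|dc] := leP c d; last first.
  move=> eps e0; exists 1 => // -[|n] s r srP; first by rewrite !big_ord0.
  have [cs sr rd] := srP ord0.
  by have := lt_le_trans dc (le_trans cs (le_trans sr rd)); rewrite ltxx.
have [//||m] := @EVT_min _ (fun x => `|f x|) c d.
  have := abs_continuous_within acf => ctn x.
  by apply: cvg_norm; exact: ctn.
rewrite in_itv/= => /andP[cm md] mP.
have fm0 : 0 < `|f m| by rewrite normr_gt0 f0.
apply: (@abs_continuous_dominated _ _ (`|f m| ^- 2) f f) => // x y cx xy yd.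
have fx0 := f0 _ cx (le_trans xy yd); have fy0 := f0 _ (le_trans cx xy) yd.
have -> : (f y)^-1 - (f x)^-1 = - ((f y - f x) * (f y * f x)^-1).
  by field; rewrite fx0 fy0.
rewrite normrN normrM normfV normrM mulrC.
apply: ler_pM => //; rewrite ?invr_ge0 ?mulr_ge0 ?lerDl//.
have fm0' : f m != 0 by rewrite -normr_gt0.
rewrite lef_pV2 ?posrE ?mulr_gt0 ?exprn_gt0 ?normr_gt0// expr2.
by apply: ler_pM => //; apply: mP; rewrite in_itv/= ?cx ?yd ?(le_trans cx)//
  (le_trans xy).
Qed.

End AbsoluteContinuity.

(** * The fundamental theorem of calculus for absolutely continuous functions *)

Section AbsoluteContinuityPrimitive.
Local Open Scope classical_set_scope.
Local Open Scope ring_scope.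
Context {R : realType}.
Implicit Types (c d x y : R) (f g h phi V : R -> R).

Notation mu := (@lebesgue_measure R).

(** Composition with [clamp] extends a function on [c, d] to the line by constants, so that a
    monotone one becomes a cumulative function. *)
Definition clamp c d x : R := Num.max c (Num.min x d).

Lemma clamp_ge c d x : c <= clamp c d x.
Proof. by rewrite /clamp le_max lexx. Qed.

Lemma clamp_le c d x : c <= d -> clamp c d x <= d.
Proof. by move=> cd; rewrite /clamp ge_max cd ge_min lexx orbT. Qed.

Lemma clamp_id c d x : c <= x -> x <= d -> clamp c d x = x.
Proof.
by move=> cx xd; rewrite /clamp; move/min_idPl: xd => ->; exact/max_idPr.
Qed.

Lemma clamp_homo c d x y : x <= y -> clamp c d x <= clamp c d y.
Proof.
move=> xy; rewrite /clamp ge_max le_max lexx/= le_max; apply/orP; right.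
by rewrite le_min !ge_min xy lexx orbT.
Qed.

Lemma clamp_dist c d x y : x <= y -> clamp c d y - clamp c d x <= y - x.
Proof.
move=> xy; rewrite /clamp.
have [] := leP x d; have [] := leP y d; have [] := leP c x; have [] := leP c y;
have [] := leP c d => *; lra.
Qed.

(* Degenerate intervals may lie inside the other ones; they can be moved to
   the left end point [c]. *)
Lemma abs_continuous_clamp c d phi eps : c <= d -> abs_continuous c d phi ->
  0 < eps -> exists2 delta, 0 < delta &
    forall (n : nat) (s r : 'I_n -> R), (forall i, s i <= r i) ->
      (forall i j, i != j -> s i < r i -> s j < r j -> r i <= s j \/ r j <= s i) ->
      \sum_(i < n) (r i - s i) < delta ->
      \sum_(i < n) `|phi (clamp c d (r i)) - phi (clamp c d (s i))| < eps.
Proof.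
move=> cd H /H[delta d0 {}H]; exists delta => // n s r sr dis L.
pose s' i := if s i < r i then clamp c d (s i) else c.
pose r' i := if s i < r i then clamp c d (r i) else c.
have -> : \sum_(i < n) `|phi (clamp c d (r i)) - phi (clamp c d (s i))| =
    \sum_(i < n) `|phi (r' i) - phi (s' i)|.
  apply: eq_bigr => i _; rewrite /r' /s'; case: ifPn => //.
  rewrite -leNgt => ?; have -> : s i = r i by apply/eqP; rewrite eq_le sr.
  by rewrite !subrr.
apply: H => [i|i j ij|].
- rewrite /s' /r'; case: ifPn => _; split; rewrite ?lexx ?clamp_ge ?clamp_le//.
  exact: clamp_homo.
- rewrite /s' /r'; case: ifPn => si; case: ifPn => sj.
  + by have [] := dis _ _ ij si sj => ?; [left|right]; exact: clamp_homo.
  + by right; exact: clamp_ge.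
  + by left; exact: clamp_ge.
  + by left.
- apply: le_lt_trans L; apply: ler_sum => i _; rewrite /s' /r'.
  by case: ifPn => _; rewrite ?clamp_dist// subrr subr_ge0.
Qed.

(** Supplies the end points of the components of an open set of finite measure; finiteness rules out
    unbounded components, and an empty one is written as ]0, 0[. *)
Lemma open_interval_bounded (I : set R) : open I -> is_interval I ->
  (mu I < +oo)%E ->
  exists sr : R * R, sr.1 <= sr.2 /\ I = `]sr.1, sr.2[%classic.
Proof.
move=> + /is_intervalP IE.
have {}IE : I = [set` Rhull I] by [].
move: (Rhull I) IE => J -> /interior_id <-.
have empty : `]0 : R, 0[%classic = set0 by rewrite set_itvoo0// ltxx.
have emptyP : exists sr : R * R, sr.1 <= sr.2 /\ set0 = `]sr.1, sr.2[%classic.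
  by exists (0, 0); split => //=; rewrite empty.
case: J => -[a x|[]] [b y|[]].
- rewrite interior_itv_bnd => _.
  have [xy|yx] := leP x y; first by exists (x, y).
  by rewrite set_itv_ge// -leNgt bnd_simp ltW.
- by rewrite set_itv_ge ?interior0//.
- by rewrite interior_itv_bndy lebesgue_measure_itv/= ltry.
- by rewrite interior_itv_Nybnd lebesgue_measure_itv/= ltNyr.
- by rewrite set_itv_ge ?interior0//.
- by rewrite interior_itv_Nyy lebesgue_measure_itv/=.
- by rewrite set_itv_ge ?interior0//.
- by rewrite set_itv_ge ?interior0//.
- by rewrite set_itv_ge ?interior0//.
Qed.

Lemma stieltjes_itv (C : cumulative R R) x y : x <= y ->
  lebesgue_stieltjes_measure C `]x, y]%classic = (C y - C x)%:E.
Proof.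
move=> xy; rewrite /lebesgue_stieltjes_measure /measure_extension.
by rewrite measurable_mu_extE/= ?wlength_itv_bnd//; exact: is_ocitv.
Qed.

(* An open set of small Lebesgue measure is a disjoint union of intervals, on
   finitely many of which [C] increases little. *)
Lemma stieltjes_null (C : cumulative R R) (A : set R) :
  (forall eps : R, 0 < eps -> exists2 delta, 0 < delta &
    forall (n : nat) (s r : 'I_n -> R), (forall i, s i <= r i) ->
      (forall i j, i != j -> s i < r i -> s j < r j -> r i <= s j \/ r j <= s i) ->
      \sum_(i < n) (r i - s i) < delta ->
      \sum_(i < n) `|C (r i) - C (s i)| < eps) ->
  measurable A -> mu A = 0%E -> lebesgue_stieltjes_measure C A = 0%E.
Proof.
move=> acC mA A0; apply/eqP; rewrite -measure_le0.
apply/lee_addgt0Pr => eps /acC[delta d0 H]; rewrite add0e.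
have Afin : (mu A < +oo)%E by rewrite A0 ltry.
have [U [oU AU UA]] := lebesgue_regularity_outer mA Afin d0.
have mU : measurable (U : set (measurableTypeR R)) by exact: open_measurable.
have Ud : (mu U < delta%:E)%E.
  apply: le_lt_trans UA; rewrite (measureDI mu mU mA).
  have : (mu (U `&` A) <= mu A)%E.
    by rewrite le_measure ?inE//; exact: measurableI.
  by rewrite A0 measure_le0 => /eqP ->; rewrite adde0.
apply: (@le_trans _ _ (lebesgue_stieltjes_measure C U)).
  by rewrite le_measure ?inE.
pose I := open_disjoint_itv oU.
have mI k : measurable (I k : set (measurableTypeR R)).
  by apply: open_measurable; exact: open_disjoint_itv_open.
have tI : trivIset setT I by exact: open_disjoint_itv_trivIset.
have UE : U = \bigcup_k I k by exact: open_disjoint_itv_bigcup.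
have sumI n : (\sum_(0 <= k < n) mu (I k) <= mu U)%E.
  rewrite UE measure_semi_bigcup -?UE//.
  exact: (@nneseries_lim_ge _ (fun k => mu (I k)) xpredT).
have /choice[sr srP] k : exists sr : R * R,
    sr.1 <= sr.2 /\ I k = `]sr.1, sr.2[%classic.
  apply: open_interval_bounded; first exact: open_disjoint_itv_open.
    exact: open_disjoint_itv_is_interval.
  apply: le_lt_trans (lt_trans Ud (ltry _)).
  by rewrite le_measure ?inE// UE; exact: bigcup_sup.
rewrite [X in lebesgue_stieltjes_measure _ X]UE measure_semi_bigcup//; last first.
  by rewrite -UE.
apply: lime_le; first exact: is_cvg_nneseries.
apply: nearW => n.
apply: (@le_trans _ _ (\sum_(0 <= k < n) (C (sr k).2 - C (sr k).1)%:E)%E).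
  apply: lee_sum => k _; have [sle IE] := srP k; rewrite -(stieltjes_itv C sle).
  rewrite le_measure ?inE// IE; apply: subset_itvl => /=.
  by rewrite bnd_simp.
rewrite sumEFin lee_fin big_mkord; apply: le_trans (ltW (H n (fun i => (sr i).1)
  (fun i => (sr i).2) _ _ _)).
- by apply: ler_sum => i _; exact: ler_norm.
- by move=> i; have [] := srP i.
- move=> i j ij si sj.
  have := tI i j Logic.I Logic.I; have [_ ->] := srP i; have [_ ->] := srP j.
  move=> dis; have [ij1|ij1] := leP (sr i).2 (sr j).1; first by left.
  have [ji1|ji1] := leP (sr j).2 (sr i).1; first by right.
  (* If the two intervals overlapped, this midpoint of the overlap would be a common point. *)
  pose z := (Num.max (sr i).1 (sr j).1 + Num.min (sr i).2 (sr j).2) / 2.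
  have zlt : Num.max (sr i).1 (sr j).1 < Num.min (sr i).2 (sr j).2.
    by rewrite gt_max !lt_min si sj ij1 ji1.
  have : (i : nat) = j.
    apply: dis; exists z; split; rewrite /= in_itv/=.
      have := le_max (sr i).1 (sr i).1 (sr j).1.
      have := ge_min (sr i).2 (sr i).2 (sr j).2.
      by rewrite !lexx/= /z => *; apply/andP; split; lra.
    have := le_max (sr j).1 (sr i).1 (sr j).1.
    have := ge_min (sr j).2 (sr i).2 (sr j).2.
    by rewrite !lexx/= !orbT /z => *; apply/andP; split; lra.
  by move/val_inj/eqP; rewrite (negbTE ij).
rewrite -lte_fin -sumEFin; apply: le_lt_trans Ud.
apply: le_trans (sumI n); rewrite big_mkord; apply: lee_sum => i _.
have [sle ->] := srP i; rewrite lebesgue_measure_itv/= lte_fin.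
have [//|] := ltP (sr i).1 (sr i).2.
by rewrite lee_fin subr_le0.
Qed.


(** Extended by constants, [V] is the cumulative function of a Stieltjes measure. Restricted to ]c,
    d] this measure is finite, absolute continuity of [V] makes it vanish on Lebesgue null sets, and
    [g] is its Radon-Nikodym density. *)
Lemma monotone_primitive c d V : c <= d ->
  {in `[c, d] &, {homo V : x y / x <= y}} -> abs_continuous c d V ->
  exists2 g : R -> R, mu.-integrable setT (EFin \o g) &
    forall x, c <= x -> x <= d ->
      V x - V c = (\int[mu]_(t in `[c, x]) g t)%R.
Proof.
move=> cd ndV acV; pose W := V \o clamp c d.
have ndW : nondecreasing W.
  move=> x y xy; apply: ndV; last exact: clamp_homo.
    by rewrite in_itv/= clamp_ge clamp_le.
  by rewrite in_itv/= clamp_ge clamp_le.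
have cW : continuous W.
  move=> x; apply/cvgrPdist_lt => eps /(abs_continuous_unif acV)[delta d0 H].
  have N : nbhs x (ball x delta) by exact: nbhsx_ballx.
  apply: filterS N => y xy /=; apply: H; rewrite ?clamp_ge ?clamp_le//.
  apply: le_lt_trans (xy : `|x - y| < delta) => {xy}.
  wlog : x y / x <= y => [W1|xy].
    have [/W1//|/ltW/W1] := leP x y.
    by rewrite distrC => /le_trans; apply; rewrite distrC.
  rewrite distrC ger0_norm ?subr_ge0 ?clamp_homo//.
  by rewrite distrC ger0_norm ?subr_ge0// clamp_dist.
pose C : cumulative R R := HB.pack W
  (isCumulative.Build R _ R W ndW (right_continuousW cW)).
have acC eps : 0 < eps -> exists2 delta, 0 < delta &
    forall (n : nat) (s r : 'I_n -> R), (forall i, s i <= r i) ->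
      (forall i j, i != j -> s i < r i -> s j < r j -> r i <= s j \/ r j <= s i) ->
      \sum_(i < n) (r i - s i) < delta ->
      \sum_(i < n) `|C (r i) - C (s i)| < eps.
  exact: abs_continuous_clamp.
pose D : set (measurableTypeR R) := `]c, d]%classic.
have mD : measurable D by exact: measurable_itv.
have Dfin : (lebesgue_stieltjes_measure C D < +oo)%E.
  by rewrite stieltjes_itv// ltry.
pose nu : {finite_measure set (measurableTypeR R) -> \bar R} := mfrestr mD Dfin.
have dom : nu `<< mu.
  move=> A A0 B mB BA.
  have B0 : mu B = 0%E by exact: A0.
  apply/eqP; rewrite -measure_le0 /nu/= /mfrestr/= /mrestr.
  rewrite -(stieltjes_null acC mB B0) le_measure ?inE//.
  exact: measurableI.
have [f [f0 ffin intf fE]] := radon_nikodym_sigma_finite dom.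
have fEE : EFin \o (fine \o f) = f.
  by apply/funext => x /=; rewrite fineK.
exists (fine \o f); first by rewrite fEE.
move=> x cx xd; rewrite -Rintegral_itv_obnd_cbnd; last first.
  rewrite fEE; apply: integrableS intf => //.
have := fE `]c, x]%classic (measurable_itv _).
rewrite /nu/= /mfrestr/= /mrestr (_ : _ `&` _ = `]c, x]%classic); last first.
  by apply/setIidPl; apply: subset_itvl; rewrite bnd_simp.
rewrite stieltjes_itv// /Rintegral => /(congr1 fine)/=.
rewrite /W/= !clamp_id// => ->; congr fine; apply: eq_integral => t _ /=.
by rewrite fineK.
Qed.


(** Families of intervals are lists from here on, rather than functions on ['I_n], so that one
    interval can be exchanged for the intervals of a partition of it. *)
Definition pairs (a : R) (s : seq R) : seq (R * R) := zip (a :: s) s.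

Definition apart (p q : R * R) := (p.2 <= q.1) || (q.2 <= p.1).

Lemma pairs_bounds a s : path <%R a s ->
  all (fun p => [&& a <= p.1, p.1 <= p.2 & p.2 <= last a s]) (pairs a s).
Proof.
elim: s a => //= x s ih a /andP[ax xs]; rewrite lexx (ltW ax)/=.
have xl : x <= last x s.
  by have := ih _ xs; case: s xs {ih} => //= y s /andP[xy ys] /andP[/and3P[_ ? ?] _];
     exact: le_trans (ltW xy) _.
rewrite xl/=; apply: sub_all (ih _ xs) => p /and3P[xp -> ->].
by rewrite (le_trans (ltW ax)).
Qed.

Lemma pairs_apart a s : path <%R a s -> pairwise apart (pairs a s).
Proof.
elim: s a => //= x s ih a /andP[ax xs]; rewrite ih// andbT.
by apply: sub_all (pairs_bounds xs) => p /and3P[xp _ _]; rewrite /apart/= xp.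
Qed.

Lemma pairs_length a s : \sum_(p <- pairs a s) (p.2 - p.1) = last a s - a.
Proof.
elim: s a => [|x s ih] a /=; first by rewrite big_nil subrr.
by rewrite big_cons/= ih; ring.
Qed.

Lemma variation_pairs a b phi s : itv_partition a b s ->
  variation a b phi s = \sum_(p <- pairs a s) `|phi p.2 - phi p.1|.
Proof.
move=> abs; rewrite variation_zip// /pairs; elim: s a abs => [|x s ih] a abs /=.
  by rewrite !big_nil.
by rewrite !big_cons/= ih//; exact: itv_partition_cons abs.
Qed.

Lemma abs_continuous_seq c d phi eps : abs_continuous c d phi -> 0 < eps ->
  exists2 delta : R, 0 < delta & forall L : seq (R * R),
    all (fun p => [&& c <= p.1, p.1 <= p.2 & p.2 <= d]) L -> pairwise apart L ->
    \sum_(p <- L) (p.2 - p.1) < delta ->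
    \sum_(p <- L) `|phi p.2 - phi p.1| < eps.
Proof.
move=> H /H[delta d0 {}H]; exists delta => // L /allP Lb Lp.
have x0 : R * R := (0, 0).
move/(pairwiseP x0): Lp => Lp; rewrite !(big_nth x0) !big_mkord => Ll.
apply: (H (size L) (fun i => (nth x0 L i).1) (fun i => (nth x0 L i).2)) => //.
  by move=> i; have /and3P[] := Lb _ (mem_nth x0 (ltn_ord i)).
move=> i j ij; have [lt|gt|/val_inj eqij] := ltngtP i j.
- by have := Lp _ _ (ltn_ord i) (ltn_ord j) lt => /orP.
- by have := Lp _ _ (ltn_ord j) (ltn_ord i) gt; rewrite /apart orbC => /orP.
- by rewrite eqij eqxx in ij.
Qed.

Local Notation TV := total_variation.

(* Replacing the intervals of a family by partitions, one at a time. *)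
Lemma abs_continuous_tv c d phi eps : abs_continuous c d phi -> 0 < eps ->
  exists2 delta : R, 0 < delta & forall L : seq (R * R),
    all (fun p => [&& c <= p.1, p.1 <= p.2 & p.2 <= d]) L -> pairwise apart L ->
    \sum_(p <- L) (p.2 - p.1) < delta ->
    (\sum_(p <- L) TV p.1 p.2 phi <= eps%:E)%E.
Proof.
move=> acphi /(abs_continuous_seq acphi)[delta d0 H]; exists delta => // L Lb Lp Ll.
(* [L'] holds the intervals already produced by partitions, which enter through their increments;
   those left in [L] still enter through their total variation. *)
suff : forall L', all (fun p => [&& c <= p.1, p.1 <= p.2 & p.2 <= d]) (L ++ L') ->
    pairwise apart (L ++ L') -> \sum_(p <- L ++ L') (p.2 - p.1) < delta ->
    (\sum_(p <- L) TV p.1 p.2 phi +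
      (\sum_(p <- L') `|phi p.2 - phi p.1|)%:E <= eps%:E)%E.
  by move=> /(_ [::]); rewrite big_nil adde0 cats0; exact.
elim: L {Lb Lp Ll} => [|a L ih] L' Lb Lp Ll.
  by rewrite big_nil add0e lee_fin ltW// H.
rewrite big_cons -addeA.
move: Lb; rewrite /= => /andP[/and3P[ca aa ad] Lb].
move: Lp; rewrite /= => /andP[aL Lp].
have key s : itv_partition a.1 a.2 s ->
    ((variation a.1 a.2 phi s)%:E + (\sum_(j <- L) TV j.1 j.2 phi +
      (\sum_(p <- L') `|phi p.2 - phi p.1|)%:E) <= eps%:E)%E.
  move=> as_; have [pa /eqP la] := as_.
  rewrite addeCA -EFinD variation_pairs// -big_cat/=; apply: ih.
  - rewrite !all_cat; move: Lb; rewrite all_cat => /andP[-> ->]; rewrite /= andbT.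
    apply: sub_all (pairs_bounds pa) => p; rewrite la => /and3P[ap -> pa2].
    by rewrite (le_trans ca)// (le_trans pa2).
  - move: Lp; rewrite !pairwise_cat => /and3P[LL' -> ->].
    rewrite pairs_apart//= !andbT allrel_catr LL' andbT.
    move: aL; rewrite all_cat => /andP[/allP aL /allP aL'].
    have sub p q : p \in pairs a.1 s -> apart a q -> apart p q.
      move=> /(allP (pairs_bounds pa)); rewrite la => /and3P[ap _ pa2].
      by rewrite /apart => /orP[h|h]; rewrite ?(le_trans pa2 h)// (le_trans h ap) orbT.
    apply/andP; split; apply/allrelP => p q pL qL.
      by rewrite /apart orbC; apply: sub (aL _ _).
    by apply: sub (aL' _ _).
  - move: Ll; rewrite big_cons big_cat/= !big_cat/= pairs_length la.
    by rewrite addrCA.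
set X := (\sum_(j <- L) TV j.1 j.2 phi + _)%E in key *.
have X0 : (0 <= X)%E.
  apply: adde_ge0; last by rewrite lee_fin sumr_ge0.
  rewrite big_seq; apply: sume_ge0 => p pL; apply: total_variation_ge0.
  by move/allP: Lb => /(_ p); rewrite mem_cat pL => /(_ isT) /and3P[].
(* An infinite [X] contradicts [key] for any single partition; a finite one can be moved to the
   other side before the supremum over partitions is taken. *)
have [Xoo|Xoo] := eqVneq X +oo%E.
  have [s sP] : exists s, itv_partition a.1 a.2 s.
    move: aa; rewrite le_eqVlt => /predU1P[<-|aa]; last first.
      by exists [:: a.2]; exact: itv_partition1.
    by exists [::]; split => //=.
  by have := key s sP; rewrite Xoo addey.
have Xfin : X \is a fin_num by rewrite ge0_fin_numE// ltey.
rewrite -leeBrDr//; apply: ge_ereal_sup => _ [_ [s sP <-] <-].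
by rewrite leeBrDr//; exact: key.
Qed.


Lemma aeS (P Q : R -> Prop) : (forall x, P x -> Q x) ->
  {ae mu, forall x, P x} -> {ae mu, forall x, Q x}.
Proof. by move=> PQ; apply: (@filterS _ _ (ae_filter_ringOfSetsType mu)). Qed.

Lemma aeS2 (P Q S : R -> Prop) : (forall x, P x -> Q x -> S x) ->
  {ae mu, forall x, P x} -> {ae mu, forall x, Q x} -> {ae mu, forall x, S x}.
Proof. by move=> PQ; apply: (@filterS2 _ _ (ae_filter_ringOfSetsType mu)). Qed.

Lemma aeS3 (P Q S T : R -> Prop) : (forall x, P x -> Q x -> S x -> T x) ->
  {ae mu, forall x, P x} -> {ae mu, forall x, Q x} -> {ae mu, forall x, S x} ->
  {ae mu, forall x, T x}.
Proof. by move=> PQ; apply: (@filterS3 _ _ (ae_filter_ringOfSetsType mu)). Qed.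

(** An interval shorter than the delta that belongs to eps = 1 has variation at most 1, and finitely
    many steps of length delta / 2 reach any point of [c, d]. *)
Lemma abs_continuous_tv_fin c d phi : abs_continuous c d phi ->
  forall x, c <= x -> x <= d -> TV c x phi \is a fin_num.
Proof.
move=> acphi; have [delta d0 H] := abs_continuous_tv acphi ltr01.
have small x y : c <= x -> x <= y -> y <= d -> y - x < delta ->
    TV x y phi \is a fin_num.
  move=> cx xy yd L; rewrite ge0_fin_numE ?total_variation_ge0//.
  have := H [:: (x, y)]; rewrite !big_seq1/= cx xy yd => /(_ isT isT L).
  by move/le_lt_trans; apply; rewrite ltry.
suff main n x : c <= x -> x <= d -> x <= c + (delta / 2) *+ n ->
    TV c x phi \is a fin_num.
  move=> x cx xd; apply: (main (Num.bound ((x - c) / (delta / 2)))) => //.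
  rewrite addrC -lerBlDr -mulr_natr -ler_pdivrMl ?divr_gt0// mulrC.
  apply: ltW; apply: archi_boundP.
  by rewrite divr_ge0 ?subr_ge0 ?divr_ge0// ltW.
elim: n x => [|n ih] x cx xd; first rewrite mulr0n addr0 => xc.
  by have -> : x = c by [apply/eqP; rewrite eq_le xc]; rewrite total_variationxx.
rewrite mulrS => xn.
have [h|h] := leP x (c + (delta / 2) *+ n); first exact: ih.
have n0 : 0 <= (delta / 2) *+ n by rewrite mulrn_wge0// ltW// divr_gt0.
rewrite (total_variationD _ _ (ltW h)) ?lerDl// fin_numD.
rewrite ih ?lerDl ?(le_trans (ltW h) xd)//=.
by apply: small => //; rewrite ?lerDl ?(ltW h)//; lra.
Qed.

(** By additivity an increment of the variation function is the total variation over that interval,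
    to which the family estimate applies; eps / 2 turns its weak inequality into a strict one. *)
Lemma abs_continuous_variation c d phi : abs_continuous c d phi ->
  abs_continuous c d (fine \o TV c ^~ phi).
Proof.
move=> acphi eps e0; have e20 : 0 < eps / 2 by rewrite divr_gt0.
have [delta d0 H] := abs_continuous_tv acphi e20.
exists delta => // n s r srP dis L.
have fin := abs_continuous_tv_fin acphi.
have tvD i : TV c (r i) phi = (TV c (s i) phi + TV (s i) (r i) phi)%E.
  by have [cs sr rd] := srP i; exact: total_variationD.
have tvfin i : TV (s i) (r i) phi \is a fin_num.
  have [cs sr rd] := srP i; have := fin _ (le_trans cs sr) rd.
  by rewrite tvD fin_numD => /andP[].
apply: (@le_lt_trans _ _ (eps / 2)); last by lra.
rewrite -lee_fin -sumEFin.
have := H [seq (s i, r i) | i <- index_enum 'I_n].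
rewrite !big_map/= => {}H.
have -> : (\sum_(i < n) `|fine (TV c (r i) phi) - fine (TV c (s i) phi)|%:E =
    \sum_(i < n) TV (s i) (r i) phi)%E.
  apply: eq_bigr => i _; have [cs sr rd] := srP i.
  rewrite tvD fineD ?fin// ?(le_trans sr)//.
  by rewrite addrAC subrr add0r ger0_norm ?fineK// fine_ge0// total_variation_ge0.
apply: H => //.
- by apply/allP => _ /mapP[i _ ->]/=; have [-> -> ->] := srP i.
- have := index_enum_uniq 'I_n; rewrite uniq_pairwise pairwise_map.
  by apply: sub_pairwise => i j /dis /orP.
Qed.

(** Jordan decomposition: with [V] the variation function, both [V] and V - phi are monotone and
    absolutely continuous, and the difference of their densities is a density of [phi]. *)
Lemma abs_continuous_primitive c d phi : c <= d -> abs_continuous c d phi ->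
  exists2 g : R -> R, mu.-integrable setT (EFin \o g) &
    forall x, c <= x -> x <= d ->
      phi x - phi c = (\int[mu]_(t in `[c, x]) g t)%R.
Proof.
move=> cd acphi; have acV := abs_continuous_variation acphi.
set V := fine \o TV c ^~ phi in acV.
have fin := abs_continuous_tv_fin acphi.
have incr x y : c <= x -> x <= y -> y <= d ->
    [/\ 0 <= V y - V x & phi y - phi x <= V y - V x].
  move=> cx xy yd; rewrite /V/=.
  have xd := le_trans xy yd; have cy := le_trans cx xy.
  have := fin _ cy yd; rewrite (total_variationD _ cx xy) fin_numD => /andP[_ fxy].
  rewrite fineD ?fin// addrAC subrr add0r fine_ge0 ?total_variation_ge0//.
  split => //; rewrite -lee_fin fineK//.
  apply: le_trans (total_variation_ge _ xy); rewrite lee_fin; exact: ler_norm.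
have [|//|g1 i1 g1E] := @monotone_primitive c d V cd.
  move=> x y; rewrite !in_itv/= => /andP[cx xd] /andP[cy yd] xy.
  by have [+ _] := incr _ _ cx xy yd; rewrite subr_ge0.
have [||g2 i2 g2E] := @monotone_primitive c d (fun x => V x - phi x) cd.
- move=> x y; rewrite !in_itv/= => /andP[cx xd] /andP[cy yd] xy.
  by have [_] := incr _ _ cx xy yd; lra.
- exact: abs_continuousB.
exists (fun t => g1 t - g2 t); first exact: (integrableB measurableT i1 i2).
move=> x cx xd; rewrite RintegralB//; [|exact: integrableS i1|exact: integrableS i2].
by rewrite -g1E// -g2E//; ring.
Qed.

(** [derive1] has a value even where [f] is not differentiable, so differentiability is recorded
    along with the value. *)
Definition has_derive (f : R -> R) (x z : R) : Prop :=
  derivable (f : R^o -> R^o) x 1 /\ derive1 f x = z.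

Lemma has_deriveP f x z :
  has_derive f x z <-> is_derive (x : R^o) (1 : R^o) (f : R^o -> R^o) z.
Proof.
split=> -[df <-]; split; [exact: df|exact/esym/derive1E|exact: df|exact: derive1E].
Qed.

Lemma has_derive_near f g x z : (\forall y \near x, f y = g y) ->
  has_derive f x z -> has_derive g x z.
Proof.
by move=> fg /has_deriveP H; apply/has_deriveP; apply: near_eq_is_derive H.
Qed.

Lemma primitive_ae_derive c d phi g : mu.-integrable setT (EFin \o g) ->
  (forall x, c <= x -> x <= d ->
    phi x - phi c = (\int[mu]_(t in `[c, x]) g t)%R) ->
  {ae mu, forall x, c < x < d -> has_derive phi x (g x)}.
Proof.
move=> ig gE; have := @FTC1 _ g (BLeft c).
have ig' y : mu.-integrable [set` Interval (BLeft c) (BRight y)] (EFin \o g).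
  exact: integrableS ig.
move=> /(_ ig' (open_integrable_locally openT ig)).
apply: aeS => x H /andP[cx xd].
have [|dF FE] := H; first by rewrite lte_fin.
have {H} : has_derive (fun x => phi c + \int[mu]_(t in `[c, x]) g t) x (g x).
  apply/has_deriveP; rewrite -[g x]add0r; apply: is_deriveD.
  by apply/has_deriveP.
apply: has_derive_near.
have : nbhs x `]c, d[%classic by apply: near_in_itvoo; rewrite in_itv/= cx.
apply: filterS => y /=; rewrite in_itv/= => /andP[cy yd].
by rewrite -gE ?ltW//; ring.
Qed.

Lemma abs_continuous_ae_derive c d phi : c <= d -> abs_continuous c d phi ->
  exists g : R -> R, [/\ mu.-integrable setT (EFin \o g),
    forall x, c <= x -> x <= d ->
      phi x - phi c = (\int[mu]_(t in `[c, x]) g t)%R &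
    {ae mu, forall x, c < x < d -> has_derive phi x (g x)}].
Proof.
move=> cd /(abs_continuous_primitive cd)[g ig gE]; exists g; split => //.
exact: primitive_ae_derive.
Qed.

Lemma ae_integrable (D : set R) f g : measurable D ->
  mu.-integrable D (EFin \o f) -> measurable_fun D g ->
  {ae mu, forall x, D x -> f x = g x} -> mu.-integrable D (EFin \o g).
Proof.
move=> mD /integrableP[mf foo] mg fg.
have mg' : measurable_fun D (EFin \o g) by exact/measurable_EFinP.
apply/integrableP; split => //.
rewrite -(@ge0_ae_eq_integral _ _ _ mu D (fun x => `|(f x)%:E|%E))//.
- by apply: measurableT_comp.
- by apply: measurableT_comp.
- by apply: aeS fg => x /[apply] ->.
Qed.

Lemma ae_Rintegral (D : set R) f g : measurable D ->
  measurable_fun D f -> measurable_fun D g ->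
  {ae mu, forall x, D x -> f x = g x} ->
  (\int[mu]_(x in D) f x = \int[mu]_(x in D) g x)%R.
Proof.
move=> mD mf mg fg; rewrite /Rintegral; congr fine.
apply: ae_eq_integral => //; try exact/measurable_EFinP.
by apply: aeS fg => x /[apply] ->.
Qed.

Lemma ae_neq (z : R) : {ae mu, forall x, x != z}.
Proof.
exists [set z]; split; [exact: measurable_set1|exact: lebesgue_measure_set1|].
by move=> x /= /negP; rewrite negbK => /eqP.
Qed.

(** Integrability of [h] is a conclusion: [h] agrees almost everywhere with the density of [phi].
    The end points, where nothing is assumed of the derivative, form a null set. *)
Lemma abs_continuous_FTC c d phi h : c <= d -> abs_continuous c d phi ->
  measurable_fun `[c, d] h ->
  {ae mu, forall x, c < x < d -> derive1 phi x = h x} ->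
  mu.-integrable `[c, d] (EFin \o h) /\
  phi d - phi c = (\int[mu]_(t in `[c, d]) h t)%R.
Proof.
move=> cd acphi mh dh; have [g [ig gE dg]] := abs_continuous_ae_derive cd acphi.
have gh : {ae mu, forall x, `[c, d]%classic x -> g x = h x}.
  have cd' := aeS2 (fun x => @conj _ _) (ae_neq c) (ae_neq d).
  apply: aeS3 dh dg cd' => x H1 H2 [xc xd]; rewrite /= in_itv/= => /andP[cx dx].
  have cxd : c < x < d by rewrite !lt_neqAle cx dx eq_sym xc xd.
  by have [_ <-] := H2 cxd; rewrite -H1.
have igc : mu.-integrable `[c, d] (EFin \o g) by exact: integrableS ig.
split; first exact: ae_integrable igc mh gh.
rewrite gE//; apply: ae_Rintegral => //.
by case/integrableP: igc => /measurable_EFinP.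
Qed.

End AbsoluteContinuityPrimitive.

(** * Real-valued integrals and the absolute continuity of indefinite integrals *)

Section Primitives.
Local Open Scope classical_set_scope.
Local Open Scope ring_scope.
Context {R : realType}.
Implicit Types (c d x y : R) (f g h phi : R -> R).
Notation mu := (@lebesgue_measure R).

Lemma integrable_norm (D : set (measurableTypeR R)) f : mu.-integrable D (EFin \o f) ->
  mu.-integrable D (EFin \o (fun x => `|f x|)).
Proof. exact: integrable_abse. Qed.

Lemma integrableRD (D : set (measurableTypeR R)) f g : measurable D ->
  mu.-integrable D (EFin \o f) -> mu.-integrable D (EFin \o g) ->
  mu.-integrable D (EFin \o (fun x => f x + g x)).
Proof. by move=> mD i1 i2; exact: (integrableD mD i1 i2). Qed.

Lemma integrableRB (D : set (measurableTypeR R)) f g : measurable D ->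
  mu.-integrable D (EFin \o f) -> mu.-integrable D (EFin \o g) ->
  mu.-integrable D (EFin \o (fun x => f x - g x)).
Proof. by move=> mD i1 i2; exact: (integrableB mD i1 i2). Qed.

Lemma integrableRZ (D : set (measurableTypeR R)) k f : measurable D ->
  mu.-integrable D (EFin \o f) -> mu.-integrable D (EFin \o (fun x => k * f x)).
Proof. by move=> mD i1; exact: (integrableZl mD k i1). Qed.

Lemma integrable_measurable (D : set (measurableTypeR R)) f : mu.-integrable D (EFin \o f) ->
  measurable_fun D f.
Proof. by move=> /integrableP[/measurable_EFinP]. Qed.

Lemma integrable_dominated (D : set (measurableTypeR R)) f g : measurable D -> measurable_fun D f ->
  (forall x, D x -> `|f x| <= g x) -> mu.-integrable D (EFin \o g) ->
  mu.-integrable D (EFin \o f).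
Proof.
move=> mD mf fg ig; apply: le_integrable ig => //; first exact/measurable_EFinP.
by move=> x Dx /=; rewrite lee_fin (le_trans (fg x Dx))// ler_norm.
Qed.

Lemma ge0_Rintegral_subset (A B : set (measurableTypeR R)) f : measurable A -> measurable B ->
  A `<=` B -> (forall x, 0 <= f x) -> mu.-integrable B (EFin \o f) ->
  (\int[mu]_(x in A) f x <= \int[mu]_(x in B) f x)%R.
Proof.
move=> mA mB AB f0 fB; have fA := integrableS mB mA AB fB.
rewrite /Rintegral fine_le ?integrable_fin_num//.
apply: ge0_subset_integral => //=.
  by case/integrableP: fB.
by move=> x _; rewrite lee_fin.
Qed.

Lemma abs_continuous_of_primitive c d phi g : mu.-integrable setT (EFin \o g) ->
  (forall x y, c <= x -> x <= y -> y <= d ->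
    phi y - phi x = (\int[mu]_(t in `[x, y]) g t)%R) ->
  abs_continuous c d phi.
Proof.
move=> ig gE eps e0; have [delta [d0 H]] := integral_normr_continuous ig e0.
exists delta => // n s r srP dis L.
(* Half-open intervals stay disjoint when they share an end point. *)
pose F (i : 'I_n) : set (measurableTypeR R) := `]s i, r i]%classic.
have mF i : measurable (F i) by exact: measurable_itv.
pose D := \big[setU/set0]_(i <- index_enum 'I_n) F i.
have mD : measurable D by exact: bigsetU_measurable.
have tF : trivIset [set` index_enum 'I_n] F.
  move=> i j _ _ [x []]; rewrite /F/= !in_itv/= => /andP[six xri] /andP[sjx xrj].
  apply/eqP; apply: contraT => /dis[h|h].
    by have := lt_le_trans sjx (le_trans xri h); rewrite ltxx.
  by have := lt_le_trans six (le_trans xrj h); rewrite ltxx.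
have /H : (mu D < delta%:E)%E.
  apply: (@le_lt_trans _ _ (\sum_(i < n) mu (F i))%E).
    rewrite /D; elim: (index_enum 'I_n) => [|i L' ih].
      by rewrite !big_nil measure0.
    rewrite !big_cons.
    apply: (@le_trans _ _ (mu (F i) + mu (\big[setU/set0]_(j <- L') F j))%E).
      by apply: measureU2 => //; exact: bigsetU_measurable.
    exact: leeD2l.
  apply: (@le_lt_trans _ _ (\sum_(i < n) (r i - s i)%:E)%E).
    apply: lee_sum => i _; have [_ sr _] := srP i.
    rewrite /F lebesgue_measure_itv/= lte_fin.
    by case: ifP => // _; rewrite lee_fin subr_ge0.
  by rewrite sumEFin lte_fin.
move=> /(_ mD); apply: le_lt_trans.
have igN : mu.-integrable setT (EFin \o (fun x => `|g x|)) by exact: integrable_norm.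
rewrite /Rintegral integral_bigsetU_EFin ?index_enum_uniq//; last first.
  by apply: measurable_funTS; case/integrableP: igN.
have fin (i : 'I_n) : (\int[mu]_(x in F i) `|g x|%:E)%E \is a fin_num.
  by apply: integrable_fin_num => //; exact: integrableS igN.
rewrite (eq_bigr (fun i => (\int[mu]_(x in F i) `|g x|)%R%:E)); last first.
  by move=> i _; rewrite /Rintegral fineK.
rewrite sumEFin/=; apply: ler_sum => i _; have [cs sr rd] := srP i.
rewrite gE// -Rintegral_itv_obnd_cbnd; last exact: integrableS ig.
by apply: le_normr_Rintegral => //; exact: integrableS ig.
Qed.

End Primitives.

(** * Neighbourhoods of the endpoints *)

Section Endpoints.
Local Open Scope classical_set_scope.
Local Open Scope ring_scope.
Context {R : realType}.
Variable l : sturm_liouville R.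
Implicit Types (e : endpoint) (c d x y : R) (f g h phi : R -> R).
Notation mu := (@lebesgue_measure R).
Notation I := (interval_of l).

Definition opp_end e := if e is Left then Right else Left.

(** Rational end points make the interval a countable union of open intervals with end points inside
    it, which reduces measurability and almost everywhere statements to such subintervals. *)
Lemma interval_rat x : I x -> exists p q : rat,
  [/\ I (ratr p), I (ratr q), ratr p < x & x < ratr q].
Proof.
move=> [ax xb].
have [p0 [ap p0x]] : exists p0, (sl_a l < p0%:E)%E /\ p0 < x.
  case: (sl_a l) ax => [a|//|_].
    by rewrite lte_fin => ax; exists ((a + x) / 2); rewrite lte_fin; split; lra.
  by exists (x - 1); rewrite ltNyr; split => //; lra.
have [q0 [qb q0x]] : exists q0, (q0%:E < sl_b l)%E /\ x < q0.
  case: (sl_b l) xb => [b|_|//].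
    by rewrite lte_fin => xb; exists ((x + b) / 2); rewrite lte_fin; split; lra.
  by exists (x + 1); rewrite ltry; split => //; lra.
have [p] := rat_in_itvoo p0x; rewrite in_itv/= => /andP[p0p px].
have [q] := rat_in_itvoo q0x; rewrite in_itv/= => /andP[xq qq0].
have I' z : p0 <= z -> z <= q0 -> I z.
  by move=> pz zq; split; [exact: lt_le_trans ap _|exact: le_lt_trans _ qb].
exists p, q; split => //; apply: I'; apply: ltW => //.
  exact: lt_trans px (lt_trans xq qq0).
exact: lt_trans p0p (lt_trans px xq).
Qed.

Lemma interval_between c d x : I c -> I d -> c <= x -> x <= d -> I x.
Proof.
move=> [ac _] [_ db] cx xd; split; [apply: lt_le_trans ac _|apply: le_lt_trans db];
  by rewrite lee_fin.
Qed.

Lemma interval_nbhs x : I x -> exists c d, [/\ I c, I d & c < x < d].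
Proof.
by move=> /interval_rat[p [q [Ip Iq px xq]]]; exists (ratr p), (ratr q);
  rewrite px xq.
Qed.

Lemma interval_nonempty : exists x, I x.
Proof.
have := sl_ab l; rewrite /interval_of.
case: (sl_a l) => [a||]; case: (sl_b l) => [b||]// ab.
- by exists ((a + b) / 2); rewrite /= !lte_fin; rewrite lte_fin in ab; split; lra.
- by exists (a + 1); rewrite /= lte_fin ltry; split => //; lra.
- by exists (b - 1); rewrite /= lte_fin ltNyr; split => //; lra.
- by exists 0; rewrite /= ltry ltNyr.
Qed.

(** The pairs of rationals are enumerated through [unpickle]; an index that codes no admissible pair
    contributes the empty set. *)
Let rat_part (n : nat) : set R :=
  if unpickle n is Some (p, q) then
    if `[< I (ratr p) /\ I (ratr q) >] then `]ratr p, ratr q[%classic else set0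
  else set0.

Lemma interval_bigcup : I = \bigcup_n rat_part n.
Proof.
apply/seteqP; split=> [x /interval_rat[p [q [Ip Iq px xq]]]|x [n _]];
    rewrite /rat_part.
  exists (pickle (p, q)); first exact: Logic.I.
  rewrite pickleK; case: asboolP => [_|[]//].
  by rewrite /= in_itv/= px.
case: (unpickle n) => // -[p q]; case: asboolP => // -[Ip Iq] /=.
by rewrite in_itv/= => /andP[/ltW px /ltW xq]; exact: interval_between px xq.
Qed.

Lemma ae_interval (P : R -> Prop) :
  (forall c d, I c -> I d -> {ae mu, forall x, c < x < d -> P x}) ->
  {ae mu, forall x, I x -> P x}.
Proof.
move=> H.
have : mu.-negligible (\bigcup_(n : nat) [set x | ~ (rat_part n x -> P x)]).
  apply: negligible_bigcup => n; rewrite /rat_part.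
  case: (unpickle n) => [[p q]|]; last first.
    by apply: (negligibleS _ (negligible_set0 _)) => x /=; apply.
  case: asboolP => [[Ip Iq]|_]; last first.
    by apply: (negligibleS _ (negligible_set0 _)) => x /=; apply.
  by have := H _ _ Ip Iq; apply: negligibleS => x /= ?; rewrite ?in_itv/=.
apply: negligibleS => x /= /not_implyP[Ix Px].
by move: (Ix); rewrite {1}interval_bigcup => -[n _ nx]; exists n => //= /(_ nx).
Qed.

Lemma measurable_fun_interval f :
  (forall c d, I c -> I d -> measurable_fun `]c, d[ f) -> measurable_fun I f.
Proof.
move=> H; rewrite interval_bigcup; apply/measurable_fun_bigcup => n; rewrite /rat_part.
  case: (unpickle n) => [[p q]|]//; case: asboolP => // _.
case: (unpickle n) => [[p q]|]; last exact: measurable_fun_set0.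
by case: asboolP => [[Ip Iq]|_]; [exact: H|exact: measurable_fun_set0].
Qed.

Lemma measurable_interval : measurable I.
Proof.
rewrite interval_bigcup; apply: bigcup_measurable => n _; rewrite /rat_part.
by case: (unpickle n) => [[p q]|]//; case: asboolP.
Qed.

Lemma measurable_piece e c : I c -> measurable (piece l e c).
Proof.
move=> [ac cb]; case: e.
  rewrite (_ : piece _ _ _ = I `&` `]-oo, c]%classic); last first.
    apply/seteqP; split=> [x [ax xc]|x [[ax _] /=]]; last by rewrite in_itv.
    by split; rewrite /= ?in_itv//; split => //; apply: le_lt_trans cb; rewrite lee_fin.
  by apply: measurableI => //; exact: measurable_interval.
rewrite (_ : piece _ _ _ = I `&` `[c, +oo[%classic); last first.
  apply/seteqP; split=> [x [cx xb]|x [[_ xb] /=]]; last by rewrite in_itv/= andbT.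
  by split; rewrite /= ?in_itv/= ?andbT//; split => //; apply: lt_le_trans ac _; rewrite lee_fin.
by apply: measurableI => //; exact: measurable_interval.
Qed.

Lemma piece_sub e c : I c -> piece l e c `<=` I.
Proof.
move=> [ac cb]; case: e => x [] h1 h2; split => //.
  by apply: le_lt_trans cb; rewrite lee_fin.
by apply: lt_le_trans ac _; rewrite lee_fin.
Qed.

(** Read as a relation between [c] and [x], [piece l e c x] says that [x] is at least as close to
    the endpoint [e] as [c]. On the interval this is a total order, and arguing with it alone treats
    both ends at once. *)
Lemma piece_refl e c : I c -> piece l e c c.
Proof. by case: e => -[ac cb]; split. Qed.

Lemma piece_trans e c x : piece l e c x -> piece l e x `<=` piece l e c.
Proof.
case: e => -[h1 h2] y [h3 h4]; split=> //; first exact: le_trans h2.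
exact: le_trans h3.
Qed.

Lemma piece_total e c x : I c -> I x -> piece l e c x \/ piece l e x c.
Proof.
by move=> [ac cb] [ax xb]; have [h|/ltW h] := leP x c; case: e;
  do ?[by left; split]; right; split.
Qed.

Lemma piece_between e c x y z : piece l e c x -> piece l e c y ->
  x <= z -> z <= y -> piece l e c z.
Proof.
case: e => -[h1 h2] [h3 h4] xz zy; split.
- by apply: lt_le_trans h1 _; rewrite lee_fin.
- exact: le_trans zy h4.
- exact: le_trans h1 xz.
- by apply: le_lt_trans h4; rewrite lee_fin.
Qed.

Lemma piece_cap e c d : I c -> I d -> exists2 x, I x &
  piece l e x `<=` piece l e c `&` piece l e d.
Proof.
move=> Ic Id; have [h|h] := piece_total e Ic Id.
  by exists d => // x dx; split => //; exact: piece_trans h _ dx.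
by exists c => // x dx; split => //; exact: piece_trans h _ dx.
Qed.

Lemma piece_beyond e x : I x -> exists2 c, I c & piece l e x c /\ ~ piece l e c x.
Proof.
move=> /interval_nbhs[c [d [Ic Id /andP[cx xd]]]]; case: e.
  by exists c => //; split; [case: Ic; split; rewrite ?ltW|move=> [_]; rewrite leNgt cx].
by exists d => //; split; [case: Id; split; rewrite ?ltW|move=> [+ _]; rewrite leNgt xd].
Qed.

#[global] Instance end_filter_proper e : ProperFilter (end_filter l e).
Proof.
apply: filter_from_proper.
  apply: filter_from_filter; first exact: interval_nonempty.
  by move=> c d Ic Id; exact: piece_cap.
by move=> c Ic; exists c; exact: piece_refl.
Qed.

Lemma end_filterP e (P : set R) :
  (\forall x \near end_filter l e, P x) <->
  exists2 c, I c & forall x, piece l e c x -> P x.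
Proof. by []. Qed.

End Endpoints.

(** * Limits at the endpoints and primitives vanishing there *)

Section EndpointLimits.
Local Open Scope classical_set_scope.
Local Open Scope ring_scope.
Context {R : realType}.
Variable l : sturm_liouville R.
Implicit Types (e : endpoint) (c d x y : R) (f g h phi : R -> R).
Notation mu := (@lebesgue_measure R).
Notation I := (interval_of l).
Notation near_end e P := (\forall x \near end_filter l e, P x).

Lemma piece_rat e c : I c -> exists2 q : rat, I (ratr q) & piece l e c (ratr q).
Proof.
move=> Ic; have [p [q [Ip Iq pc cq]]] := interval_rat Ic; case: e.
  by exists p => //; case: Ip; split => //; exact: ltW.
by exists q => //; case: Iq; split => //; exact: ltW.
Qed.

(** The rationals of the interval are examined in turn, and the current point is replaced only by
    one closer to [e]. Every [c] is passed eventually, whether the endpoint is finite or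
    infinite. *)
Lemma cofinal_seq e : exists x_ : nat -> R, (forall n, I (x_ n)) /\
  forall c, I c -> exists N, forall n, (N <= n)%N -> piece l e c (x_ n).
Proof.
have [c0 Ic0] := interval_nonempty l.
pose far x y := if `[< I y /\ piece l e x y >] then y else x.
pose q n : R := if unpickle n is Some r then ratr (r : rat) else c0.
pose x_ := fix x_ n := if n is m.+1 then far (x_ m) (q m) else c0.
have Ix n : I (x_ n).
  by elim: n => //= n ih; rewrite /far; case: asboolP => // -[].
have xS n : piece l e (x_ n) (x_ n.+1).
  by rewrite /= /far; case: asboolP => [[]//|_]; exact: piece_refl.
have xm n m : (n <= m)%N -> piece l e (x_ n) (x_ m).
  move=> /subnK <-; elim: (m - n)%N => [|k ih]; first exact: piece_refl.
  by rewrite addSn; apply: piece_trans ih _ (xS _).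
exists x_; split => // c /(piece_rat e)[r Ir cr].
(* The rational [r] is examined in the step from index [pickle r] to its successor. *)
exists (pickle r).+1 => n /xm; apply: piece_trans => {n}.
have qE : q (pickle r) = ratr r by rewrite /q pickleK.
rewrite [x_ _.+1]/(far (x_ (pickle r)) (q (pickle r))) qE /far.
case: asboolP => // /not_andP[//|nr]; have [//|h] := piece_total e (Ix (pickle r)) Ir.
exact: piece_trans cr _ h.
Qed.

(** Dominated convergence along a cofinal sequence: every point eventually drops out of the
    shrinking pieces. *)
Lemma piece_tail e c g : I c -> mu.-integrable (piece l e c) (EFin \o g) ->
  forall eps : R, 0 < eps ->
    near_end e (fun x => piece l e c x /\
      (\int[mu]_(t in piece l e x) `|g t|)%R < eps).
Proof.
move=> Ic ig eps e0; have [x_ [Ix xP]] := cofinal_seq e.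
have mp x : I x -> measurable (piece l e x : set (measurableTypeR R)).
  exact: measurable_piece.
have iN := integrable_norm ig.
pose f_ n t := ((fun t => `|g t|) \_ (piece l e (x_ n)) t)%:E.
have [|||||_ _] := @dominated_convergence _ _ _ mu _ (mp _ Ic) f_ (cst 0%E)
    (EFin \o (fun x => `|g x|)).
- move=> n; apply/measurable_EFinP; apply/measurable_restrict => //.
  + exact: mp.
  + exact: mp.
  by apply: measurable_funS (integrable_measurable iN) => //; exact: mp.
- exact: measurable_cst.
- apply/aeW => t Dt; apply: cvg_near_cst.
  have [c' Ic' [_ c't]] := piece_beyond e (piece_sub Ic Dt).
  have [N NP] := xP _ Ic'; exists N => // n /= /NP xc'.
  rewrite /f_ patchE; case: ifPn => // /set_mem xt.
  by exfalso; apply: c't; exact: piece_trans xc' _ xt.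
- exact: iN.
- apply/aeW => t n _; rewrite /f_ patchE /=; case: ifPn => _.
    by rewrite normr_id.
  by rewrite lee_fin (_ : `|point| = 0)//; exact: normr0.
rewrite integral_cst ?mul0e; last exact: mp.
move=> /fine_cvgP[_] /cvgrPdist_lt/(_ _ e0)[N1 _ N1P].
have [N2 N2P] := xP _ Ic.
pose n := maxn N1 N2.
have cn : piece l e c (x_ n) by apply: N2P; exact: leq_maxr.
have := N1P n (leq_maxl _ _); rewrite /= sub0r normrN => {}N1P.
exists (x_ n) => // x nx; have Ixx := piece_sub (Ix n) nx.
split; first exact: piece_trans cn _ nx.
apply: le_lt_trans N1P; apply: le_trans (ler_norm _).
apply: (@le_trans _ _ (\int[mu]_(t in piece l e (x_ n)) `|g t|)%R).
  apply: ge0_Rintegral_subset => //; [exact: mp|exact: mp|exact: piece_trans|].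
  by apply: integrableS iN; [exact: mp|exact: mp|exact: piece_trans].
have <- : piece l e c `&` piece l e (x_ n) = piece l e (x_ n).
  by apply/setIidPr; exact: piece_trans.
by rewrite Rintegral_mkcondr.
Qed.

Lemma piece_variation e c phi g : I c ->
  (forall x y, piece l e c x -> piece l e c y -> abs_continuous x y phi) ->
  mu.-integrable (piece l e c) (EFin \o g) ->
  {ae mu, forall x, piece l e c x -> x != c -> derive1 phi x = g x} ->
  forall x y, piece l e c x -> piece l e c y ->
    `|phi x - phi y| <= (\int[mu]_(t in piece l e c) `|g t|)%R.
Proof.
move=> Ic acphi ig dphi x y cx cy.
wlog xy : x y cx cy / x <= y.
  by move=> W; have [xy|/ltW yx] := leP x y; [|rewrite distrC]; exact: W.
have sub : `[x, y]%classic `<=` piece l e c.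
  by move=> z /=; rewrite in_itv/= => /andP[xz zy]; exact: piece_between cx cy xz zy.
have mp : measurable (piece l e c : set (measurableTypeR R)) by exact: measurable_piece.
have ig' : mu.-integrable `[x, y] (EFin \o g) by exact: integrableS ig.
have [_ H] := abs_continuous_FTC xy (acphi _ _ cx cy) (integrable_measurable ig')
  (aeS2 (fun z H1 H2 (H3 : x < z < y) => H1 (sub z (subset_itv_oo_cc H3)) H2)
    dphi (ae_neq c)).
rewrite distrC H; apply: le_trans (le_normr_Rintegral _ ig') _ => //.
by apply: ge0_Rintegral_subset => //; exact: integrable_norm.
Qed.

(** Cauchy's criterion: the oscillation of [phi] beyond a point is at most the tail integral of
    |g|. *)
Lemma piece_cvg e c phi g : I c ->
  (forall x y, piece l e c x -> piece l e c y -> abs_continuous x y phi) ->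
  mu.-integrable (piece l e c) (EFin \o g) ->
  {ae mu, forall x, piece l e c x -> x != c -> derive1 phi x = g x} ->
  cvg (phi @ end_filter l e).
Proof.
move=> Ic acphi ig dphi; apply: cauchy_cvg; apply: cauchy_exP => eps e0.
have [c' Ic' c'P] := piece_tail Ic ig e0.
have [cc' lt] := c'P _ (piece_refl e Ic').
exists (phi c'); exists c' => // x c'x; apply: le_lt_trans lt.
have sub := piece_trans cc'.
apply: piece_variation => //.
- by move=> y z /sub cy /sub cz; exact: acphi.
- by apply: integrableS ig => //; exact: measurable_piece.
- apply: aeS2 dphi (ae_neq c) => z H1 H2 /sub cz _; exact: H1.
- exact: piece_refl.
Qed.

(** An integral from [x] to the right end has derivative - g at [x]; this sign makes [primitive]
    below an antiderivative of [g] for either end. *)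
Definition sgn_end e : R := if e is Left then 1 else -1.

Definition primitive e g : R -> R := fun x =>
  sgn_end e * (\int[mu]_(t in piece l e x) g t)%R.

Variable g : R -> R.
Hypothesis ig : mu.-integrable I (EFin \o g).

Let mI : measurable (I : set (measurableTypeR R)).
Proof. exact: measurable_interval. Qed.

Let mp e x : I x -> measurable (piece l e x : set (measurableTypeR R)).
Proof. exact: measurable_piece. Qed.

Let igp e x : I x -> mu.-integrable (piece l e x) (EFin \o g).
Proof. by move=> Ix; apply: integrableS ig => //; [exact: mp|exact: piece_sub]. Qed.

Lemma integral_pieces x : I x ->
  (\int[mu]_(t in piece l Left x) g t + \int[mu]_(t in piece l Right x) g t =
   \int[mu]_(t in I) g t)%R.
Proof.
move=> Ix.
(* Both pieces contain [x], so it is removed from the second to make the union disjoint. *)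
have -> : I = piece l Left x `|` (piece l Right x `\ x).
  apply/seteqP; split=> [t It|t [/(piece_sub Ix)//|[/(piece_sub Ix)//]]].
  case: It => at_ tb; have [tx|xt] := leP t x; first by left.
  by right; split; [split => //; exact: ltW|move=> /= tx; rewrite tx ltxx in xt].
have mR : measurable (piece l Right x `\ x : set (measurableTypeR R)).
  by apply: measurableD => //; exact: mp.
have sub : piece l Right x `\ x `<=` I by move=> t [/(piece_sub Ix)].
rewrite Rintegral_setU//; last 2 first.
- apply: integrableS ig => //; first by apply: measurableU => //; exact: mp.
  by move=> t [/(piece_sub Ix)//|/sub].
- apply/disj_setPS => t [[_ tx] [[xt _] /= /eqP]].
  by rewrite eq_le tx xt.
- congr (_ + _).
  rewrite -[RHS](subrK (\int[mu]_(t in [set x]) g t)%R) Rintegral_set1 subr0 addr0.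
  rewrite -[in LHS](@setDUK _ [set x] (piece l Right x)); last first.
    by move=> t ->; exact: piece_refl.
  rewrite Rintegral_setU ?Rintegral_set1 ?add0r//.
    apply: igp || idtac.
    by rewrite setDUK; [exact: igp|move=> t ->; exact: piece_refl].
  by apply/disj_setPS => t [-> [_ /(_ erefl)]].
- exact: mp.
Qed.

Lemma primitiveB e x y : I x -> I y -> x <= y ->
  primitive e g y - primitive e g x = (\int[mu]_(t in `[x, y]) g t)%R.
Proof.
move=> Ix Iy xy.
suff H : (\int[mu]_(t in piece l Left y) g t =
    \int[mu]_(t in piece l Left x) g t + \int[mu]_(t in `[x, y]) g t)%R.
  case: e; rewrite /primitive /sgn_end ?mul1r ?mulN1r ?H; first by ring.
  have := integral_pieces Ix; have := integral_pieces Iy; rewrite H.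
  by move=> <-; lra.
have sub : `]x, y]%classic `<=` I.
  move=> t /=; rewrite in_itv/= => /andP[/ltW xt ty].
  exact: interval_between Ix Iy xt ty.
have -> : piece l Left y = piece l Left x `|` `]x, y]%classic.
  apply/seteqP; split=> [t [at_ ty]|t].
    have [tx|xt] := leP t x; first by left.
    by right; rewrite /= in_itv/= xt.
  case=> [[at_ tx]|/[dup] /sub[at_ _]]; first by split => //; exact: le_trans xy.
  by rewrite /= in_itv/= => /andP[].
rewrite Rintegral_setU//.
- by rewrite Rintegral_itv_obnd_cbnd//; exact: integrableS ig.
- exact: mp.
- apply: integrableS ig => //; first by apply: measurableU => //; exact: mp.
  by move=> t [/(piece_sub Ix)//|/sub].
- apply/disj_setPS => t [[_ tx]] /=; rewrite in_itv/= => /andP[xt _].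
  by have := lt_le_trans xt tx; rewrite ltxx.
Qed.

Lemma primitive_cvg0 e : primitive e g @ end_filter l e --> (0 : R).
Proof.
apply/cvgrPdist_lt => eps e0; have [c Ic] := interval_nonempty l.
have [c' Ic' c'P] := piece_tail Ic (igp e Ic) e0.
exists c' => // x c'x; have [cx lt] := c'P _ c'x; have Ix := piece_sub Ic cx.
rewrite /= sub0r normrN /primitive normrM.
have -> : `|sgn_end e| = 1 by case: e {c'P c'x lt cx}; rewrite /= ?normrN normr1.
rewrite mul1r; apply: le_lt_trans lt; apply: le_normr_Rintegral; [exact: mp|exact: igp].
Qed.

Lemma primitive_opp e x : I x -> primitive (opp_end e) g x =
  primitive e g x - sgn_end e * (\int[mu]_(t in I) g t)%R.
Proof.
move=> Ix; rewrite -(integral_pieces Ix) /primitive.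
by case: e => /=; ring.
Qed.

Lemma primitive_cvg e :
  primitive e g @ end_filter l (opp_end e) --> sgn_end e * (\int[mu]_(t in I) g t)%R.
Proof.
have := primitive_cvg0 (opp_end e).
move=> /(@cvgD _ _ _ _ _ _ _ _ _) /(_ (cvg_cst (sgn_end e * (\int[mu]_(t in I) g t)%R))).
rewrite add0r; apply: cvg_trans; apply: near_eq_cvg.
have [c Ic] := interval_nonempty l; exists c => // x /(piece_sub Ic) Ix /=.
by rewrite -[LHS]/(primitive (opp_end e) g x + _) primitive_opp// subrK.
Qed.

Lemma primitive_abs_continuous e c d : I c -> I d ->
  abs_continuous c d (primitive e g).
Proof.
move=> Ic Id; apply: (@abs_continuous_of_primitive _ _ _ _ (g \_ I)).
  by rewrite -restrict_EFin; apply/(integrable_mkcond _ mI).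
move=> x y cx xy yd.
rewrite primitiveB//; last 2 first.
- exact: interval_between Ic Id cx (le_trans xy yd).
- exact: interval_between Ic Id (le_trans cx xy) yd.
apply: eq_Rintegral => t; rewrite inE/= in_itv/= => /andP[xt ty].
rewrite patchE mem_set//.
exact: interval_between Ic Id (le_trans cx xt) (le_trans ty yd).
Qed.

Lemma primitive_derive e : {ae mu, forall x, I x -> has_derive (primitive e g) x (g x)}.
Proof.
apply: ae_interval => c d Ic Id.
have [cd|dc] := leP c d; last first.
  by apply: aeW => x /andP[cx xd]; have := lt_trans dc (lt_trans cx xd); rewrite ltxx.
have := @primitive_ae_derive _ c d (primitive e g) (g \_ I).
have iR : mu.-integrable setT (EFin \o (g \_ I)).
  by rewrite -restrict_EFin; apply/(integrable_mkcond _ mI).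
move=> /(_ iR) H; apply: aeS (H _) => [x /[swap] cxd /(_ cxd)|x cx xd].
  case/andP: cxd => /ltW cx /ltW xd.
  by rewrite patchE mem_set//; exact: interval_between Ic Id cx xd.
rewrite primitiveB//; last exact: interval_between Ic Id cx xd.
apply: eq_Rintegral => t; rewrite inE/= in_itv/= => /andP[xt ty].
rewrite patchE mem_set//; exact: interval_between Ic Id xt (le_trans ty xd).
Qed.

End EndpointLimits.

(** * Complex-valued functions *)

Section ComplexCalculus.
Local Open Scope classical_set_scope.
Local Open Scope ring_scope.
Local Open Scope complex_scope.
Context {R : realType}.
Notation mu := (@lebesgue_measure R).
Notation Re := complex.Re.
Notation Im := complex.Im.
Implicit Types (f g h : R -> R[i]) (c d x y : R) (k z : R[i]).

Lemma complexP z z' : Re z = Re z' -> Im z = Im z' -> z = z'.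
Proof. by case: z z' => [a b] [a' b'] /= -> ->. Qed.

Lemma ReD z z' : Re (z + z') = Re z + Re z'. Proof. by case: z z' => [? ?] [? ?]. Qed.
Lemma ImD z z' : Im (z + z') = Im z + Im z'. Proof. by case: z z' => [? ?] [? ?]. Qed.
Lemma ReN z : Re (- z) = - Re z. Proof. by case: z. Qed.
Lemma ImN z : Im (- z) = - Im z. Proof. by case: z. Qed.
Lemma ReM z z' : Re (z * z') = Re z * Re z' - Im z * Im z'.
Proof. by case: z z' => [? ?] [? ?]. Qed.
Lemma ImM z z' : Im (z * z') = Re z * Im z' + Im z * Re z'.
Proof. by case: z z' => [? ?] [? ?]. Qed.
Lemma Re_conj z : Re (conjc z) = Re z. Proof. by case: z. Qed.
Lemma Im_conj z : Im (conjc z) = - Im z. Proof. by case: z. Qed.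
Lemma Re_real (r : R) : Re r%:C = r. Proof. by []. Qed.
Lemma Im_real (r : R) : Im r%:C = 0. Proof. by []. Qed.
Lemma conj_real (r : R) : conjc (r%:C) = r%:C.
Proof. by apply: complexP; rewrite /= ?oppr0. Qed.

Lemma conjD z z' : conjc (z + z') = conjc z + conjc z'.
Proof. by case: z z' => [? ?] [? ?]; apply: complexP; rewrite //= opprD. Qed.
Lemma conjN z : conjc (- z) = - conjc z. Proof. by case: z. Qed.
Lemma conjM z z' : conjc (z * z') = conjc z * conjc z'.
Proof. by case: z z' => [? ?] [? ?]; apply: complexP => /=; ring. Qed.
Lemma conjK z : conjc (conjc z) = z.
Proof. by case: z => ? ?; rewrite /= opprK. Qed.
Lemma conj0 : conjc 0 = 0 :> R[i]. Proof. exact: conj_real. Qed.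
Lemma conj1 : conjc 1 = 1 :> R[i]. Proof. exact: conj_real. Qed.

Definition conjE := (conjD, conjN, conjM, conjK, conj_real, conj0, conj1).

Definition reimE := (ReD, ImD, ReN, ImN, ReM, ImM, Re_conj, Im_conj, Re_real, Im_real).

Definition nsq z : R := Re z ^+ 2 + Im z ^+ 2.

Lemma nsq_ge0 z : 0 <= nsq z. Proof. by rewrite addr_ge0 ?sqr_ge0. Qed.

Lemma nsq_eq0 z : nsq z = 0 -> z = 0.
Proof.
move/eqP; rewrite paddr_eq0 ?sqr_ge0// !sqrf_eq0 => /andP[/eqP ? /eqP ?].
exact: complexP.
Qed.

Lemma mul_conj z : z * conjc z = (nsq z)%:C.
Proof. by apply: complexP; rewrite !reimE /nsq /=; ring. Qed.

Lemma nsqM z z' : nsq (z * z') = nsq z * nsq z'.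
Proof. by rewrite /nsq !reimE; ring. Qed.

Lemma nsq_real (r : R) : nsq (r%:C) = r ^+ 2.
Proof. by rewrite /nsq !reimE expr0n addr0. Qed.

Lemma nsqD z z' : nsq (z + z') <= 2 * (nsq z + nsq z').
Proof.
rewrite /nsq !reimE; have := sqr_ge0 (Re z - Re z'); have := sqr_ge0 (Im z - Im z').
by move=> *; lra.
Qed.

Definition has_cderive f x z : Prop :=
  has_derive (fun y => Re (f y)) x (Re z) /\ has_derive (fun y => Im (f y)) x (Im z).

Lemma has_cderiveE f x z : has_cderive f x z -> cderive f x = z.
Proof. by move=> [[_ h1] [_ h2]]; apply: complexP. Qed.

Lemma has_deriveD (u v : R -> R) x a b : has_derive u x a -> has_derive v x b ->
  has_derive (fun y => u y + v y) x (a + b).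
Proof. by move=> /has_deriveP hu /has_deriveP hv; apply/has_deriveP; apply: is_deriveD. Qed.

Lemma has_deriveN (u : R -> R) x a : has_derive u x a ->
  has_derive (fun y => - u y) x (- a).
Proof. by move=> /has_deriveP hu; apply/has_deriveP; apply: is_deriveN. Qed.

Lemma has_deriveM (u v : R -> R) x a b : has_derive u x a -> has_derive v x b ->
  has_derive (fun y => u y * v y) x (a * v x + u x * b).
Proof.
move=> /has_deriveP hu /has_deriveP hv; apply/has_deriveP.
rewrite addrC [a * _]mulrC; exact: (is_deriveM hu hv).
Qed.

Lemma has_derive_cst (r x : R) : has_derive (fun=> r) x 0.
Proof. by apply/has_deriveP; apply: is_derive_cst. Qed.

Lemma has_cderive_cst k x : has_cderive (fun=> k) x 0.
Proof. by split; exact: has_derive_cst. Qed.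

Lemma has_cderiveD f g x z z' : has_cderive f x z -> has_cderive g x z' ->
  has_cderive (fun y => f y + g y) x (z + z').
Proof.
move=> [f1 f2] [g1 g2]; split; rewrite !reimE.
  by under eq_fun do rewrite reimE; exact: has_deriveD.
by under eq_fun do rewrite reimE; exact: has_deriveD.
Qed.

Lemma has_cderiveN f x z : has_cderive f x z -> has_cderive (fun y => - f y) x (- z).
Proof.
move=> [f1 f2]; split; rewrite !reimE.
  by under eq_fun do rewrite reimE; exact: has_deriveN.
by under eq_fun do rewrite reimE; exact: has_deriveN.
Qed.

Lemma has_cderive_conj f x z : has_cderive f x z ->
  has_cderive (fun y => conjc (f y)) x (conjc z).
Proof.
move=> [f1 f2]; split; rewrite !reimE; first by under eq_fun do rewrite reimE.
by under eq_fun do rewrite reimE; exact: has_deriveN.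
Qed.

Lemma has_cderiveM f g x z z' : has_cderive f x z -> has_cderive g x z' ->
  has_cderive (fun y => f y * g y) x (z * g x + f x * z').
Proof.
move=> [f1 f2] [g1 g2]; split.
  under eq_fun do rewrite reimE; rewrite !reimE.
  have := has_deriveD (has_deriveM f1 g1) (has_deriveN (has_deriveM f2 g2)).
  by congr has_derive; ring.
under eq_fun do rewrite reimE; rewrite !reimE.
have := has_deriveD (has_deriveM f1 g2) (has_deriveM f2 g1).
by congr has_derive; ring.
Qed.

Definition cabs_continuous c d f : Prop :=
  abs_continuous c d (fun x => Re (f x)) /\ abs_continuous c d (fun x => Im (f x)).

Lemma eq_abs_continuous c d (u v : R -> R) : u =1 v -> abs_continuous c d u ->
  abs_continuous c d v.
Proof. by move=> /funext ->. Qed.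

Lemma cabs_continuousD c d f g : cabs_continuous c d f -> cabs_continuous c d g ->
  cabs_continuous c d (fun x => f x + g x).
Proof.
move=> [f1 f2] [g1 g2]; split.
  by apply: eq_abs_continuous (abs_continuousD f1 g1) => x; rewrite reimE.
by apply: eq_abs_continuous (abs_continuousD f2 g2) => x; rewrite reimE.
Qed.

Lemma cabs_continuousN c d f : cabs_continuous c d f ->
  cabs_continuous c d (fun x => - f x).
Proof.
move=> [f1 f2]; split.
  by apply: eq_abs_continuous (abs_continuousN f1) => x; rewrite reimE.
by apply: eq_abs_continuous (abs_continuousN f2) => x; rewrite reimE.
Qed.

Lemma cabs_continuous_conj c d f : cabs_continuous c d f ->
  cabs_continuous c d (fun x => conjc (f x)).
Proof.
move=> [f1 f2]; split; first by apply: eq_abs_continuous f1 => x; rewrite reimE.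
by apply: eq_abs_continuous (abs_continuousN f2) => x; rewrite reimE.
Qed.

Lemma cabs_continuousM c d f g : cabs_continuous c d f -> cabs_continuous c d g ->
  cabs_continuous c d (fun x => f x * g x).
Proof.
move=> [f1 f2] [g1 g2]; split.
  by apply: eq_abs_continuous (abs_continuousB (abs_continuousM f1 g1)
    (abs_continuousM f2 g2)) => x; rewrite reimE.
by apply: eq_abs_continuous (abs_continuousD (abs_continuousM f1 g2)
    (abs_continuousM f2 g1)) => x; rewrite reimE.
Qed.

Lemma cabs_continuous_cst c d k : cabs_continuous c d (fun=> k).
Proof. by split; exact: abs_continuous_cst. Qed.

(** * Integrals of complex-valued functions *)

Section Integrals.
Variable D : set (measurableTypeR R).
Hypothesis mD : measurable D.

Definition cintegrable f : Prop :=
  mu.-integrable D (EFin \o (fun x => Re (f x))) /\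
  mu.-integrable D (EFin \o (fun x => Im (f x))).

Lemma eq_integrableR (u v : R -> R) : u =1 v ->
  mu.-integrable D (EFin \o u) -> mu.-integrable D (EFin \o v).
Proof. by move=> /funext ->. Qed.

Lemma cintegrableD f g : cintegrable f -> cintegrable g ->
  cintegrable (fun x => f x + g x).
Proof.
move=> [f1 f2] [g1 g2]; split.
  by apply: eq_integrableR (integrableRD mD f1 g1) => x; rewrite reimE.
by apply: eq_integrableR (integrableRD mD f2 g2) => x; rewrite reimE.
Qed.

Lemma cintegrableM k f : cintegrable f -> cintegrable (fun x => k * f x).
Proof.
move=> [f1 f2]; split.
  apply: eq_integrableR (integrableRB mD (integrableRZ (Re k) mD f1)
    (integrableRZ (Im k) mD f2)) => x; by rewrite reimE.
by apply: eq_integrableR (integrableRD mD (integrableRZ (Re k) mD f2)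
    (integrableRZ (Im k) mD f1)) => x; rewrite reimE.
Qed.

Lemma Re_cintegral f : Re (cintegral D f) = (\int[mu]_(x in D) Re (f x))%R.
Proof. by []. Qed.

Lemma Im_cintegral f : Im (cintegral D f) = (\int[mu]_(x in D) Im (f x))%R.
Proof. by []. Qed.

Lemma cintegral_lin k f g : cintegrable f -> cintegrable g ->
  cintegral D (fun x => k * f x + g x) = k * cintegral D f + cintegral D g.
Proof.
move=> [f1 f2] [g1 g2]; apply: complexP; rewrite !(ReD, ImD, ReM, ImM) ?(Re_cintegral, Im_cintegral);
  under eq_Rintegral do rewrite !reimE.
  rewrite RintegralD ?RintegralB ?RintegralZl//; [exact: integrableRZ..|].
  by apply: integrableRB => //; exact: integrableRZ.
rewrite RintegralD ?RintegralD ?RintegralZl//; [exact: integrableRZ..|].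
by apply: integrableRD => //; exact: integrableRZ.
Qed.

Lemma cintegral_conj f : cintegrable f ->
  cintegral D (fun x => conjc (f x)) = conjc (cintegral D f).
Proof.
move=> [f1 f2]; apply: complexP; rewrite !(Re_conj, Im_conj) ?(Re_cintegral, Im_cintegral);
  under eq_Rintegral do rewrite !reimE; first by [].
by rewrite -mulN1r -RintegralZl//; apply: eq_Rintegral => x _; rewrite mulN1r.
Qed.

Lemma cintegral_ae f g : measurable_fun D (fun x => Re (f x)) ->
  measurable_fun D (fun x => Im (f x)) -> measurable_fun D (fun x => Re (g x)) ->
  measurable_fun D (fun x => Im (g x)) ->
  {ae mu, forall x, D x -> f x = g x} -> cintegral D f = cintegral D g.
Proof.
move=> f1 f2 g1 g2 fg; apply: complexP; apply: ae_Rintegral => //;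
  by apply: aeS fg => x /[apply] ->.
Qed.

End Integrals.

(** * Square-integrable functions with a weight *)

Section SquareIntegrable.
Variables (D : set R) (rho : R -> R).
Hypotheses (mD : measurable D) (mrho : measurable_fun D rho).

Let mD' : measurable (D : set (measurableTypeR R)) := mD.

Lemma measurable_nsq f : measurable_fun D (fun x => Re (f x)) ->
  measurable_fun D (fun x => Im (f x)) -> measurable_fun D (fun x => nsq (f x)).
Proof.
by move=> m1 m2; rewrite /nsq; apply: measurable_funD; exact: measurable_funX.
Qed.

Lemma sqr_int_dominated (C : R) f g h : 0 <= C ->
  measurable_fun D (fun x => Re (f x)) -> measurable_fun D (fun x => Im (f x)) ->
  (forall x, D x -> nsq (f x) <= C * (nsq (g x) + nsq (h x))) ->
  sqr_int D rho g -> sqr_int D rho h -> sqr_int D rho f.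
Proof.
move=> C0 f1 f2 fgh [g1 g2 gi] [h1 h2 hi]; split => //.
(* The weight has no sign here, so the dominating function is built from absolute values. *)
have := integrableRZ C mD' (integrableRD mD' (integrable_norm gi) (integrable_norm hi)).
apply: integrable_dominated => //.
  apply: measurable_funM => //; exact: measurable_nsq.
move=> x Dx; rewrite !normrM -mulrDl mulrA.
by apply: ler_wpM2r => //; rewrite !ger0_norm ?nsq_ge0//; exact: fgh.
Qed.

Lemma sqr_int0 : sqr_int D rho (fun=> 0).
Proof.
split; [exact: measurable_cst..|].
by apply: eq_integrableR (integrable0 mu D : mu.-integrable _ (EFin \o (fun=> 0))) => x;
  rewrite /= expr0n addr0 mul0r.
Qed.

Lemma sqr_int_lin k f g : sqr_int D rho f -> sqr_int D rho g ->
  sqr_int D rho (fun x => k * f x + g x).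
Proof.
move=> sf sg; have [f1 f2 _] := sf; have [g1 g2 _] := sg.
apply: (@sqr_int_dominated (2 * (nsq k + 1)) _ f g) => //.
- by rewrite mulr_ge0// addr_ge0// nsq_ge0.
- under eq_fun do rewrite !reimE.
  by apply: measurable_funD => //; apply: measurable_funB; exact: measurable_funM.
- under eq_fun do rewrite !reimE.
  by apply: measurable_funD => //; apply: measurable_funD; exact: measurable_funM.
- move=> x _; apply: le_trans (nsqD _ _) _; rewrite nsqM -mulrA ler_wpM2l//.
  have := nsq_ge0 (f x); have := nsq_ge0 (g x); have := nsq_ge0 k; nra.
Qed.

Lemma sqr_int_mul f g : sqr_int D rho f -> sqr_int D rho g ->
  cintegrable D (fun x => f x * conjc (g x) * (rho x)%:C).
Proof.
move=> [f1 f2 fi] [g1 g2 gi].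
have dom := integrableRD mD' (integrable_norm fi) (integrable_norm gi).
have bound (a x : R) : `|a| <= nsq (f x) + nsq (g x) ->
    `|a * rho x| <= `|nsq (f x) * rho x| + `|nsq (g x) * rho x|.
  move=> h; rewrite !normrM -mulrDl ler_wpM2r//.
  by rewrite (ger0_norm (nsq_ge0 _)) (ger0_norm (nsq_ge0 _)).
have sq (a b : R) : 0 <= (a - b) ^+ 2 /\ 0 <= (a + b) ^+ 2 by rewrite !sqr_ge0.
split; apply: integrable_dominated dom => //.
- under eq_fun do rewrite !reimE mulr0 subr0.
  apply: measurable_funM => //; under eq_fun do rewrite mulrN opprK.
  by apply: measurable_funD; exact: measurable_funM.
- move=> x _; rewrite !reimE mulr0 subr0; apply: bound.
  have := sq (Re (f x)) (Re (g x)); have := sq (Im (f x)) (Im (g x)).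
  rewrite /nsq ler_norml => -[? ?] [? ?]; apply/andP; split; nra.
- under eq_fun do rewrite !reimE mulr0 add0r.
  apply: measurable_funM => //; apply: measurable_funD; apply: measurable_funM => //.
  exact: measurableT_comp.
- move=> x _; rewrite !reimE mulr0 add0r; apply: bound.
  have := sq (Re (f x)) (Im (g x)); have := sq (Im (f x)) (Re (g x)).
  rewrite /nsq ler_norml => -[? ?] [? ?]; apply/andP; split; nra.
Qed.

End SquareIntegrable.

End ComplexCalculus.

(** * The weighted L^2 space *)

Section WeightedHilbertSpace.
Local Open Scope classical_set_scope.
Local Open Scope ring_scope.
Local Open Scope complex_scope.
Context {R : realType}.
Variable l : sturm_liouville R.
Notation mu := (@lebesgue_measure R).
Notation Re := complex.Re.
Notation Im := complex.Im.
Notation I := (interval_of l).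
Notation p := (sl_p l).
Notation w := (sl_w l).
Implicit Types (f g h : R -> R[i]) (c d x y : R) (k z : R[i]) (e : endpoint).

Lemma measurable_loc_integrable (u : R -> R) :
  (forall c d, I c -> I d -> mu.-integrable `[c, d] (EFin \o u)) ->
  measurable_fun I u.
Proof.
move=> H; apply: measurable_fun_interval => c d Ic Id.
apply: measurable_funS (integrable_measurable (H c d Ic Id)) => //.
exact: subset_itv_oo_cc.
Qed.

Lemma measurable_w : measurable_fun I w.
Proof.
by apply: measurable_loc_integrable => c d [ac _] [_ db]; have [] := sl_loc_integrable ac db.
Qed.

Lemma measurable_pV : measurable_fun I (fun x => (p x)^-1).
Proof.
by apply: measurable_loc_integrable => c d [ac _] [_ db]; have [] := sl_loc_integrable ac db.
Qed.

Lemma w_gt0 : {ae mu, forall x, I x -> 0 < w x}.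
Proof. by apply: aeS (sl_w_gt0 l) => x H [? ?]; exact: H. Qed.

Lemma p_gt0 : {ae mu, forall x, I x -> 0 < p x}.
Proof. by apply: aeS (sl_p_gt0 l) => x H [? ?]; exact: H. Qed.

Let mI : measurable I. Proof. exact: measurable_interval. Qed.
Let mI' : measurable (I : set (measurableTypeR R)). Proof. exact: measurable_interval. Qed.
Let mw := measurable_w.

Lemma hilb0 : hilb l (fun=> 0). Proof. exact: sqr_int0. Qed.

Lemma hilb_lin k f g : hilb l f -> hilb l g -> hilb l (fun x => k * f x + g x).
Proof. exact: sqr_int_lin. Qed.

Lemma hilbM k f : hilb l f -> hilb l (fun x => k * f x).
Proof.
move=> /(hilb_lin k)/(_ hilb0); congr (hilb l _).
by apply/funext => x; rewrite addr0.
Qed.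

Lemma hilbD f g : hilb l f -> hilb l g -> hilb l (fun x => f x + g x).
Proof.
move=> hf hg; have := hilb_lin 1 hf hg; congr (hilb l _).
by apply/funext => x; rewrite mul1r.
Qed.

Lemma hilbB f g : hilb l f -> hilb l g -> hilb l (fun x => f x - g x).
Proof.
move=> hf hg; have := hilb_lin (-1) hg hf; congr (hilb l _).
by apply/funext => x; rewrite mulN1r addrC.
Qed.

Lemma hdot_integrable f g : hilb l f -> hilb l g ->
  cintegrable I (fun x => f x * conjc (g x) * (w x)%:C).
Proof. exact: sqr_int_mul. Qed.

Lemma hdot_lin k f g h : hilb l f -> hilb l g -> hilb l h ->
  hdot l (fun x => k * f x + g x) h = k * hdot l f h + hdot l g h.
Proof.
move=> hf hg hh; rewrite /hdot -cintegral_lin//; [|exact: hdot_integrable..].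
by congr cintegral; apply/funext => x; ring.
Qed.

Lemma eq_hdotl f f' g : f =1 f' -> hdot l f g = hdot l f' g.
Proof. by move=> /funext ->. Qed.

Lemma hdot0l g : hilb l g -> hdot l (fun=> 0) g = 0.
Proof.
move=> hg; have := hdot_lin (-1) hilb0 hilb0 hg.
rewrite (@eq_hdotl _ (fun=> 0)); last by move=> x; rewrite mulr0 addr0.
by rewrite mulN1r addNr.
Qed.

Lemma hdotMl k f h : hilb l f -> hilb l h ->
  hdot l (fun x => k * f x) h = k * hdot l f h.
Proof.
move=> hf hh; rewrite -[RHS]addr0 -(hdot0l hh) -hdot_lin//; last exact: hilb0.
by apply: eq_hdotl => x; rewrite addr0.
Qed.

Lemma hdotDl f g h : hilb l f -> hilb l g -> hilb l h ->
  hdot l (fun x => f x + g x) h = hdot l f h + hdot l g h.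
Proof.
move=> hf hg hh; rewrite -[X in X + _]mul1r -hdot_lin//.
by apply: eq_hdotl => x; rewrite mul1r.
Qed.

Lemma hdotBl f g h : hilb l f -> hilb l g -> hilb l h ->
  hdot l (fun x => f x - g x) h = hdot l f h - hdot l g h.
Proof.
move=> hf hg hh; rewrite addrC -[X in X + _]mulN1r -hdot_lin//.
by apply: eq_hdotl => x; rewrite mulN1r addrC.
Qed.

Lemma hdotC f g : hilb l f -> hilb l g -> hdot l g f = conjc (hdot l f g).
Proof.
move=> hf hg; rewrite /hdot -cintegral_conj//; last exact: hdot_integrable.
by congr cintegral; apply/funext => x; apply: complexP; rewrite !reimE; ring.
Qed.

Lemma hdotMr k f h : hilb l f -> hilb l h ->
  hdot l f (fun x => k * h x) = conjc k * hdot l f h.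
Proof.
move=> hf hh; rewrite hdotC//; last exact: hilbM.
by rewrite hdotMl// conjM -hdotC.
Qed.

Lemma hdotDr f g h : hilb l f -> hilb l g -> hilb l h ->
  hdot l f (fun x => g x + h x) = hdot l f g + hdot l f h.
Proof.
move=> hf hg hh; rewrite hdotC//; last exact: hilbD.
by rewrite hdotDl// conjD -!hdotC.
Qed.

Lemma hdotBr f g h : hilb l f -> hilb l g -> hilb l h ->
  hdot l f (fun x => g x - h x) = hdot l f g - hdot l f h.
Proof.
move=> hf hg hh; rewrite hdotC//; last exact: hilbB.
by rewrite hdotBl// conjD conjN -!hdotC.
Qed.

Lemma hdot_ae f f' g g' : hilb l f -> hilb l f' -> hilb l g -> hilb l g' ->
  eq_ae I f f' -> eq_ae I g g' -> hdot l f g = hdot l f' g'.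
Proof.
move=> hf hf' hg hg' ff' gg'.
have [/integrable_measurable m1 /integrable_measurable m2] := hdot_integrable hf hg.
have [/integrable_measurable m3 /integrable_measurable m4] := hdot_integrable hf' hg'.
apply: cintegral_ae => //.
by apply: aeS2 ff' gg' => x H1 H2 Ix; rewrite H1// H2.
Qed.

Lemma hnorm2_integral f :
  hnorm2 l f = (\int[mu]_(x in I) (nsq (f x) * w x))%R.
Proof.
by rewrite /hnorm2 /hdot Re_cintegral; apply: eq_Rintegral => x _;
  rewrite mul_conj !reimE mulr0 subr0.
Qed.

Lemma hdot_self f : hilb l f -> hdot l f f = (hnorm2 l f)%:C.
Proof.
move=> hf; apply: complexP => //; rewrite Im_real.
have := congr1 (@complex.Im R) (hdotC hf hf); rewrite reimE.
by move=> /eqP; rewrite -addr_eq0 -mulr2n mulrn_eq0 => /eqP.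
Qed.

Let hmeas f : hilb l f -> measurable_fun I (fun x => nsq (f x) * w x).
Proof. by move=> [_ _] /integrable_measurable. Qed.

Lemma hnorm2_ge0 f : hilb l f -> 0 <= hnorm2 l f.
Proof.
move=> hf; rewrite hnorm2_integral.
rewrite (@ae_Rintegral _ I _ (fun x => `|nsq (f x) * w x|))//.
- by apply: Rintegral_ge0 => x _.
- exact: hmeas.
- by apply: measurableT_comp => //; exact: hmeas.
- by apply: aeS w_gt0 => x H Ix; rewrite ger0_norm// mulr_ge0 ?nsq_ge0// ltW// H.
Qed.

Lemma hnorm2_eq0 f : hilb l f -> hnorm2 l f = 0 -> eq_ae I f (fun=> 0).
Proof.
move=> hf; rewrite hnorm2_integral.
have mE : measurable_fun I (fun x => `|nsq (f x) * w x|).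
  by apply: measurableT_comp => //; exact: hmeas.
rewrite (@ae_Rintegral _ I _ (fun x => `|nsq (f x) * w x|))//; last 2 first.
- exact: hmeas.
- by apply: aeS w_gt0 => x H Ix; rewrite ger0_norm// mulr_ge0 ?nsq_ge0// ltW// H.
move=> /eqP; rewrite /Rintegral => /eqP f0.
have fin : (\int[mu]_(x in I) (`|nsq (f x) * w x|)%:E \is a fin_num)%E.
  apply: integrable_fin_num => //.
  by have [_ _ ?] := hf; exact: integrable_norm.
have : (\int[mu]_(x in I) `|(nsq (f x) * w x)%:E| = 0)%E by rewrite -(fineK fin) f0.
move=> /(ae_eq_integral_abs mu mI').
have mf : measurable_fun (I : set (measurableTypeR R)) (EFin \o (fun x => nsq (f x) * w x)).
  by apply/measurable_EFinP; exact: hmeas.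
move=> /(_ mf); apply: aeS2 w_gt0 => x wx H Ix.
have := H Ix => -[] /eqP; rewrite mulf_eq0 (gt_eqF (wx Ix)) orbF => /eqP.
exact: nsq_eq0.
Qed.

(** [lim_at] has a value for divergent functions too; [ccvg] records the convergence itself. *)
Definition ccvg e f z : Prop :=
  ((fun x => Re (f x)) : R -> R) @ end_filter l e --> Re z /\
  ((fun x => Im (f x)) : R -> R) @ end_filter l e --> Im z.

Lemma lim_atE e f z : ccvg e f z -> lim_at l e f = z.
Proof.
by move=> [f1 f2]; apply: complexP; rewrite /lim_at /=; apply: cvg_lim => //;
  exact: Rhausdorff.
Qed.

Lemma ccvg_cst e k : ccvg e (fun=> k) k.
Proof. by split; exact: cvg_cst. Qed.

Lemma ccvgD e f g z z' : ccvg e f z -> ccvg e g z' -> ccvg e (fun x => f x + g x) (z + z').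
Proof.
by move=> [f1 f2] [g1 g2]; split; under eq_fun do rewrite reimE; rewrite reimE; exact: cvgD.
Qed.

Lemma ccvgN e f z : ccvg e f z -> ccvg e (fun x => - f x) (- z).
Proof.
by move=> [f1 f2]; split; under eq_fun do rewrite reimE; rewrite reimE; exact: cvgN.
Qed.

Lemma ccvgM e f g z z' : ccvg e f z -> ccvg e g z' -> ccvg e (fun x => f x * g x) (z * z').
Proof.
move=> [f1 f2] [g1 g2]; split; under eq_fun do rewrite reimE; rewrite reimE.
  by apply: cvgB; exact: cvgM.
by apply: cvgD; exact: cvgM.
Qed.

Lemma ccvg_conj e f z : ccvg e f z -> ccvg e (fun x => conjc (f x)) (conjc z).
Proof.
move=> [f1 f2]; split; under eq_fun do rewrite reimE; rewrite reimE => //.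
exact: cvgN.
Qed.

Lemma ccvg_near e f g z : (\forall x \near end_filter l e, f x = g x) ->
  ccvg e f z -> ccvg e g z.
Proof.
move=> fg [f1 f2]; split.
  by apply: cvg_trans f1; apply: near_eq_cvg; apply: filterS fg => x ->.
by apply: cvg_trans f2; apply: near_eq_cvg; apply: filterS fg => x ->.
Qed.

Lemma near_interval e : \forall x \near end_filter l e, I x.
Proof.
by have [c Ic] := interval_nonempty l; exists c => // x; exact: piece_sub.
Qed.

Lemma ccvg_eq e f g z : (forall x, I x -> f x = g x) -> ccvg e f z -> ccvg e g z.
Proof. by move=> fg; apply: ccvg_near; apply: filterS fg (near_interval e). Qed.

Lemma ccvg_unique e f z z' : ccvg e f z -> ccvg e f z' -> z = z'.
Proof. by move=> /lim_atE <- /lim_atE. Qed.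

End WeightedHilbertSpace.

(** * Quasi-derivatives and Green's identity *)

Section QuasiDifferentialSystem.
Local Open Scope classical_set_scope.
Local Open Scope ring_scope.
Local Open Scope complex_scope.
Context {R : realType}.
Variable l : sturm_liouville R.
Notation mu := (@lebesgue_measure R).
Notation Re := complex.Re.
Notation Im := complex.Im.
Notation I := (interval_of l).
Notation p := (sl_p l).
Notation q := (sl_q l).
Notation w := (sl_w l).
Implicit Types (f g h F G H K : R -> R[i]) (c d x y : R) (k z : R[i]) (e : endpoint).

Let mI : measurable I. Proof. exact: measurable_interval. Qed.
Let mI' : measurable (I : set (measurableTypeR R)). Proof. exact: measurable_interval. Qed.

Lemma interval_nbhsP x : I x -> nbhs x I.
Proof.
move=> /interval_nbhs[c [d [Ic Id cxd]]].
have : nbhs x `]c, d[%classic by apply: near_in_itvoo; rewrite in_itv/=.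
apply: filterS => y /=; rewrite in_itv/= => /andP[/ltW cy /ltW yd].
exact: interval_between cy yd.
Qed.

Lemma interval_open : open I.
Proof. by rewrite openE => x /interval_nbhsP. Qed.

Lemma abs_continuous_interval_continuous (u : R -> R) x :
  (forall c d, I c -> I d -> abs_continuous c d u) -> I x -> {for x, continuous u}.
Proof.
move=> acu /interval_nbhs[c [d [Ic Id cxd]]].
exact: abs_continuous_continuous (acu _ _ Ic Id) cxd.
Qed.

Lemma abs_continuous_interval_measurable (u : R -> R) :
  (forall c d, I c -> I d -> abs_continuous c d u) -> measurable_fun I u.
Proof.
move=> acu; apply: open_continuous_measurable_fun; first exact: interval_open.
by move=> x /set_mem Ix; exact: abs_continuous_interval_continuous.
Qed.

Lemma AC_loc_measurable f : AC_loc l f ->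
  measurable_fun I (fun x => Re (f x)) /\ measurable_fun I (fun x => Im (f x)).
Proof.
by move=> acf; split; apply: abs_continuous_interval_measurable => c d Ic Id;
  have [] := acf c d Ic Id.
Qed.

(** By continuity a non-zero value persists on a ball, which is not negligible. This makes
    absolutely continuous representatives unique on the interval. *)
Lemma abs_continuous_eq0 (u : R -> R) :
  (forall c d, I c -> I d -> abs_continuous c d u) ->
  {ae mu, forall x, I x -> u x = 0} -> forall x, I x -> u x = 0.
Proof.
move=> acu u0 x Ix; apply/eqP; apply: contraT => ux0.
have cu := abs_continuous_interval_continuous acu Ix.
have : \forall y \near x, u y != 0 /\ I y.
  apply: filterI (interval_nbhsP Ix).
  exact: (cvgr_neq0 (u x) cu ux0).
move=> /nbhs_ballP[r r0 rP].
have : mu.-negligible (ball x r).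
  case: u0 => N [mN N0 sN]; exists N; split => // y /rP[uy Iy].
  by apply: sN => /= /(_ Iy) uy0; rewrite uy0 eqxx in uy.
move=> neg; have : mu (ball x r) = 0%E.
  by apply: measure_negligible neg; exact: measurable_ball.
move=> /eqP; rewrite lebesgue_measure_ball ?eqe ?mulrn_eq0/= ?gt_eqF//; exact: ltW.
Qed.

Lemma AC_loc_cst k : AC_loc l (fun=> k).
Proof. by move=> c d _ _; exact: cabs_continuous_cst. Qed.

Lemma AC_locD f g : AC_loc l f -> AC_loc l g -> AC_loc l (fun x => f x + g x).
Proof. by move=> af ag c d Ic Id; apply: cabs_continuousD; [exact: af|exact: ag]. Qed.

Lemma AC_locN f : AC_loc l f -> AC_loc l (fun x => - f x).
Proof. by move=> af c d Ic Id; apply: cabs_continuousN; exact: af. Qed.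

Lemma AC_locM f g : AC_loc l f -> AC_loc l g -> AC_loc l (fun x => f x * g x).
Proof. by move=> af ag c d Ic Id; apply: cabs_continuousM; [exact: af|exact: ag]. Qed.

Lemma AC_loc_conj f : AC_loc l f -> AC_loc l (fun x => conjc (f x)).
Proof. by move=> af c d Ic Id; apply: cabs_continuous_conj; exact: af. Qed.

Lemma AC_loc_eq f g : AC_loc l f -> AC_loc l g -> eq_ae I f g ->
  forall x, I x -> f x = g x.
Proof.
move=> af ag fg x Ix; apply/eqP; rewrite -subr_eq0; apply/eqP.
have ad := AC_locD af (AC_locN ag).
apply: complexP.
  apply: (@abs_continuous_eq0 (fun x => Re (f x - g x))) => //.
    by move=> c d Ic Id; have [] := ad c d Ic Id.
  by apply: aeS fg => y H Iy; rewrite H// subrr.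
apply: (@abs_continuous_eq0 (fun x => Im (f x - g x))) => //.
  by move=> c d Ic Id; have [] := ad c d Ic Id.
by apply: aeS fg => y H Iy; rewrite H// subrr.
Qed.

Lemma abs_continuous_interval_derive (u : R -> R) :
  (forall c d, I c -> I d -> abs_continuous c d u) ->
  {ae mu, forall x, I x -> has_derive u x (derive1 u x)}.
Proof.
move=> acu; apply: ae_interval => c d Ic Id.
have [cd|dc] := leP c d; last first.
  by apply: aeW => x /andP[cx xd]; have := lt_trans dc (lt_trans cx xd); rewrite ltxx.
have [g [_ _]] := abs_continuous_ae_derive cd (acu _ _ Ic Id).
by apply: aeS => x H /H[dx _].
Qed.

Lemma AC_loc_derive f : AC_loc l f ->
  {ae mu, forall x, I x -> has_cderive f x (cderive f x)}.
Proof.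
move=> af.
have := abs_continuous_interval_derive (fun c d Ic Id => (af c d Ic Id).1).
have := abs_continuous_interval_derive (fun c d Ic Id => (af c d Ic Id).2).
by apply: aeS2 => x H1 H2 Ix; split; [exact: H2|exact: H1].
Qed.

Lemma cderive_eq f g x : (forall y, I y -> f y = g y) -> I x ->
  cderive f x = cderive g x.
Proof.
move=> fg Ix; have near := interval_nbhsP Ix.
apply: complexP; rewrite /cderive /= !derive1E.
  by apply: near_eq_derive; apply: filterS near => y /fg ->.
by apply: near_eq_derive; apply: filterS near => y /fg ->.
Qed.

(* [F] is the quasi-derivative of [f], and [H] is [ell f]. *)
Definition quasi_system f F H : Prop :=
  [/\ AC_loc l f, AC_loc l F,
    {ae mu, forall x, I x -> has_cderive f x (F x * ((p x)^-1)%:C)} &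
    {ae mu, forall x, I x ->
      has_cderive F x (- ((w x)%:C * H x) - (q x)%:C * f x)}].

Lemma quasi_system_lin k f F H g G K :
  quasi_system f F H -> quasi_system g G K ->
  quasi_system (fun x => k * f x + g x) (fun x => k * F x + G x)
    (fun x => k * H x + K x).
Proof.
move=> [f1 f2 f3 f4] [g1 g2 g3 g4]; split.
- by apply: AC_locD => //; apply: AC_locM => //; exact: AC_loc_cst.
- by apply: AC_locD => //; apply: AC_locM => //; exact: AC_loc_cst.
- apply: aeS2 f3 g3 => x h1 h2 Ix.
  have := has_cderiveD (has_cderiveM (has_cderive_cst k x) (h1 Ix)) (h2 Ix).
  by congr has_cderive; ring.
- apply: aeS2 f4 g4 => x h1 h2 Ix.
  have := has_cderiveD (has_cderiveM (has_cderive_cst k x) (h1 Ix)) (h2 Ix).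
  by congr has_cderive; ring.
Qed.

Lemma quasi_system_ae f F H H' : quasi_system f F H -> eq_ae I H H' ->
  quasi_system f F H'.
Proof.
move=> [f1 f2 f3 f4] HH'; split => //.
by apply: aeS2 f4 HH' => x h1 h2 Ix; rewrite -h2//; exact: h1.
Qed.

Lemma regular_quasi_system f : regular l f ->
  quasi_system f (quasi_derivative l f) (ell l f).
Proof.
move=> [af eF]; set F := quasi_derivative l f.
have [aF FE] : is_quasi_derivative l f F.
  by case: eF => G GP; exact: (@xgetI _ _ [set F | is_quasi_derivative l f F] G).
split => //.
  apply: aeS3 (AC_loc_derive af) FE (p_gt0 l) => x h1 h2 h3 Ix.
  have := h1 Ix; congr has_cderive; rewrite h2//.
  have p0 : (p x)%:C != 0 by rewrite (inj_eq (@complexI _)) gt_eqF// h3.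
  by rewrite mulrAC -rmorphM/= mulfV ?mul1r// gt_eqF// h3.
apply: aeS2 (AC_loc_derive aF) (w_gt0 l) => x h1 h2 Ix.
have := h1 Ix; congr has_cderive.
have e : (w x)%:C * ((w x)^-1)%:C = 1.
  by rewrite -rmorphM/= mulfV ?gt_eqF ?h2.
by rewrite /ell -/F mulrA mulrN e mulN1r opprK addrK.
Qed.

Lemma quasi_system_is_quasi_derivative f F H : quasi_system f F H ->
  is_quasi_derivative l f F.
Proof.
move=> [f1 f2 f3 f4]; split => //; apply: aeS2 f3 (p_gt0 l) => x h1 h2 Ix.
rewrite (has_cderiveE (h1 Ix)) mulrCA -rmorphM/= mulfV ?mulr1//.
by rewrite gt_eqF// h2.
Qed.

(** The choice inside [quasi_derivative] is harmless: two locally absolutely continuous versions of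
    p f' agree almost everywhere, hence at every point of the interval. *)
Lemma quasi_derivativeE f F H : quasi_system f F H ->
  forall x, I x -> quasi_derivative l f x = F x.
Proof.
move=> fFH; have iF := quasi_system_is_quasi_derivative fFH.
have [aG GE] : is_quasi_derivative l f (quasi_derivative l f).
  exact: (@xgetI _ _ [set F | is_quasi_derivative l f F] F).
have [aF FE] := iF; apply: AC_loc_eq => //.
by apply: aeS2 GE FE => x h1 h2 Ix; rewrite h1// h2.
Qed.

Lemma ellE f F H : quasi_system f F H -> eq_ae I (ell l f) H.
Proof.
move=> fFH; have [f1 f2 f3 f4] := fFH; apply: aeS2 f4 (w_gt0 l) => x h1 h2 Ix.
rewrite /ell (cderive_eq (quasi_derivativeE fFH) Ix) (has_cderiveE (h1 Ix)).
rewrite subrK mulrNN mulrA -rmorphM/= mulVf ?mul1r//.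
by rewrite gt_eqF// h2.
Qed.

Lemma quasi_system_D_max f F H : quasi_system f F H -> hilb l f -> hilb l H ->
  D_max l f.
Proof.
move=> fFH hf hH; have [f1 f2 f3 f4] := fFH; split => //.
  by split => //; exists F; exact: quasi_system_is_quasi_derivative fFH.
by exists H => //; apply: aeS (ellE fFH) => x h Ix; rewrite h.
Qed.

Lemma D_max_quasi_system f : D_max l f -> exists2 H, hilb l H &
  quasi_system f (quasi_derivative l f) H.
Proof.
move=> [rf hf [H hH HE]]; exists H => //.
apply: quasi_system_ae (regular_quasi_system rf) _.
by apply: aeS HE => x h Ix; rewrite h.
Qed.

Lemma solution_quasi_system lam f : solution l lam f ->
  quasi_system f (quasi_derivative l f) (fun x => lam * f x).
Proof. by move=> [rf fE]; apply: quasi_system_ae (regular_quasi_system rf) fE. Qed.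

(** The bracket with the quasi-derivatives as explicit arguments, which keeps the choice inside
    [quasi_derivative] out of the computations. *)
Definition wronskian f F g G : R -> R[i] := fun x =>
  f x * conjc (G x) - F x * conjc (g x).

Lemma bracketE f F H g G K : quasi_system f F H -> quasi_system g G K ->
  forall x, I x -> bracket l f g x = wronskian f F g G x.
Proof.
move=> fs gs x Ix.
by rewrite /bracket (quasi_derivativeE fs)// (quasi_derivativeE gs).
Qed.

Lemma wronskian_AC f F H g G K : quasi_system f F H -> quasi_system g G K ->
  AC_loc l (wronskian f F g G).
Proof.
move=> [f1 f2 _ _] [g1 g2 _ _].
by apply: AC_locD; [|apply: AC_locN]; apply: AC_locM => //; exact: AC_loc_conj.
Qed.

Lemma wronskian_derive f F H g G K : quasi_system f F H -> quasi_system g G K ->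
  {ae mu, forall x, I x -> has_cderive (wronskian f F g G) x
    (H x * conjc (g x) * (w x)%:C - f x * conjc (K x) * (w x)%:C)}.
Proof.
move=> [_ _ f3 f4] [_ _ g3 g4].
have := aeS2 (fun x => @conj _ _) f4 g4; apply: aeS3 f3 g3 => x h1 h2 [h3 h4] Ix.
have := has_cderiveD (has_cderiveM (h1 Ix) (has_cderive_conj (h4 Ix)))
  (has_cderiveN (has_cderiveM (h3 Ix) (has_cderive_conj (h2 Ix)))).
by congr has_cderive; rewrite !conjE; ring.
Qed.

(** On the interval [u] differs by a constant from the primitive of [v] that vanishes at the left
    end, and this primitive has limits at both ends. *)
Lemma abs_continuous_ends (u v : R -> R) :
  (forall c d, I c -> I d -> abs_continuous c d u) ->
  mu.-integrable I (EFin \o v) -> {ae mu, forall x, I x -> derive1 u x = v x} ->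
  exists La Lb : R, [/\ u @ end_filter l Left --> La,
    u @ end_filter l Right --> Lb & Lb - La = (\int[mu]_(x in I) v x)%R].
Proof.
move=> acu iv uv; have [c Ic] := interval_nonempty l.
pose P := primitive l Left v.
have uE x : I x -> u x = (u c - P c) + P x.
  move=> Ix; wlog : c x Ic Ix / c <= x => [W|cx].
    have [cx|/ltW xc] := leP c x; first exact: W.
    by rewrite (W x c)//; ring.
  have iv' : mu.-integrable `[c, x] (EFin \o v).
    apply: integrableS iv => // t /=; rewrite in_itv/= => /andP[ct tx].
    exact: interval_between Ic Ix ct tx.
  have [|_ H] := abs_continuous_FTC cx (acu _ _ Ic Ix) (integrable_measurable iv').
    apply: aeS uv => t H /andP[ct tx]; apply: H.
    exact: interval_between Ic Ix (ltW ct) (ltW tx).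
  by rewrite -(primitiveB iv Left Ic Ix cx) in H; rewrite -/P in H; lra.
have nearE e : \forall x \near end_filter l e, (u c - P c) + P x = u x.
  by apply: filterS (near_interval l e) => x /uE ->.
exists (u c - P c + 0), (u c - P c + 1 * (\int[mu]_(x in I) v x)%R).
split; last by ring.
- apply: cvg_trans (near_eq_cvg (nearE Left)) _.
  by apply: cvgD; [exact: cvg_cst|exact: primitive_cvg0].
- apply: cvg_trans (near_eq_cvg (nearE Right)) _.
  have h : P @ end_filter l Right --> 1 * (\int[mu]_(x in I) v x)%R.
    exact: (@primitive_cvg _ _ _ iv Left).
  by apply: cvgD; [exact: cvg_cst|exact: h].
Qed.

Lemma AC_loc_ends f g : AC_loc l f -> cintegrable I g ->
  {ae mu, forall x, I x -> has_cderive f x (g x)} ->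
  exists La Lb, [/\ ccvg l Left f La, ccvg l Right f Lb & Lb - La = cintegral I g].
Proof.
move=> af [g1 g2] fg.
have [||a1 [b1 [A1 B1 E1]]] := @abs_continuous_ends (fun x => Re (f x)) _ _ g1.
- by move=> c d Ic Id; have [] := af c d Ic Id.
- by apply: aeS fg => x h /h[[_ h1] _].
have [||a2 [b2 [A2 B2 E2]]] := @abs_continuous_ends (fun x => Im (f x)) _ _ g2.
- by move=> c d Ic Id; have [] := af c d Ic Id.
- by apply: aeS fg => x h /h[_ [_ h1]].
exists (a1 +i* a2), (b1 +i* b2); split; [by split|by split|].
by apply: complexP.
Qed.

Lemma green f F H g G K : quasi_system f F H -> quasi_system g G K ->
  hilb l f -> hilb l H -> hilb l g -> hilb l K ->
  exists La Lb, [/\ ccvg l Left (wronskian f F g G) La,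
    ccvg l Right (wronskian f F g G) Lb & Lb - La = hdot l H g - hdot l f K].
Proof.
move=> fs gs hf hH hg hK.
have i1 := hdot_integrable hH hg; have i2 := hdot_integrable hf hK.
have i3 := cintegrableM mI' (-1) i2.
have [|La [Lb [A B E]]] := AC_loc_ends (wronskian_AC fs gs) (cintegrableD mI' i3 i1).
  apply: aeS (wronskian_derive fs gs) => x h Ix; have := h Ix.
  by congr has_cderive; ring.
exists La, Lb; split => //; rewrite E cintegral_lin// mulN1r addrC.
by [].
Qed.

End QuasiDifferentialSystem.

(** * Variation of constants *)

Section VariationOfConstants.
Local Open Scope classical_set_scope.
Local Open Scope ring_scope.
Local Open Scope complex_scope.
Context {R : realType}.
Variable l : sturm_liouville R.
Notation mu := (@lebesgue_measure R).
Notation Re := complex.Re.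
Notation Im := complex.Im.
Notation I := (interval_of l).
Notation w := (sl_w l).
Implicit Types (f g h F G H K : R -> R[i]) (c d x y : R) (k z : R[i]) (e : endpoint).

Let mI : measurable I. Proof. exact: measurable_interval. Qed.
Let mI' : measurable (I : set (measurableTypeR R)). Proof. exact: measurable_interval. Qed.

Definition cprimitive e g : R -> R[i] := fun x =>
  primitive l e (fun t => Re (g t)) x +i* primitive l e (fun t => Im (g t)) x.

Lemma primitive_bounded e (u : R -> R) x : I x -> mu.-integrable I (EFin \o u) ->
  `|primitive l e u x| <= (\int[mu]_(t in I) `|u t|)%R.
Proof.
move=> Ix iu; rewrite normrM; have -> : `|sgn_end e : R| = 1.
  by case: e; rewrite /= ?normrN normr1.
have mp : measurable (piece l e x : set (measurableTypeR R)) by exact: measurable_piece.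
have iup : mu.-integrable (piece l e x) (EFin \o u).
  by apply: integrableS iu => //; exact: piece_sub.
rewrite mul1r; apply: le_trans (le_normr_Rintegral mp iup) _.
by apply: ge0_Rintegral_subset => //; [exact: piece_sub|exact: integrable_norm].
Qed.

Section Primitive.
Variables (e : endpoint) (g : R -> R[i]).
Hypothesis ig : cintegrable I g.

Lemma cprimitive_AC : AC_loc l (cprimitive e g).
Proof.
by move=> c d Ic Id; split;
  [exact: (primitive_abs_continuous ig.1)|exact: (primitive_abs_continuous ig.2)].
Qed.

Lemma cprimitive_derive :
  {ae mu, forall x, I x -> has_cderive (cprimitive e g) x (g x)}.
Proof.
apply: aeS2 (primitive_derive ig.1 e) (primitive_derive ig.2 e) => x h1 h2 Ix.
by split; [exact: h1|exact: h2].
Qed.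

Lemma cprimitive_cvg0 : ccvg l e (cprimitive e g) 0.
Proof.
by split; [exact: (primitive_cvg0 ig.1)|exact: (primitive_cvg0 ig.2)].
Qed.

Lemma cprimitive_bounded : exists C : R, forall x, I x -> nsq (cprimitive e g x) <= C.
Proof.
pose A := (\int[mu]_(x in I) `|Re (g x)|)%R.
pose B := (\int[mu]_(x in I) `|Im (g x)|)%R.
exists (A ^+ 2 + B ^+ 2) => x Ix.
have bound (u : R -> R) : mu.-integrable I (EFin \o u) ->
    primitive l e u x ^+ 2 <= (\int[mu]_(x in I) `|u x|)%R ^+ 2.
  move=> iu; rewrite -[leLHS]real_normK ?num_real// ler_sqr ?nnegrE//.
    exact: primitive_bounded.
  by apply: Rintegral_ge0.
by rewrite /nsq lerD//; apply: bound; [exact: ig.1|exact: ig.2].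
Qed.

End Primitive.

(** Two real solutions with Wronskian 1, square-integrable up to both ends. Reality is asked for on
    the interval only, because [U] and [V] will be values of [quasi_derivative], which are not
    determined outside it. *)
Record fundamental (lam : R) (u U v V : R -> R[i]) : Prop := Fundamental {
  fund_u : quasi_system l u U (fun x => lam%:C * u x);
  fund_v : quasi_system l v V (fun x => lam%:C * v x);
  fund_uC : forall x, I x -> conjc (u x) = u x;
  fund_UC : forall x, I x -> conjc (U x) = U x;
  fund_vC : forall x, I x -> conjc (v x) = v x;
  fund_VC : forall x, I x -> conjc (V x) = V x;
  fund_W : forall x, I x -> u x * V x - U x * v x = 1;
  fund_hu : hilb l u;
  fund_hv : hilb l v
}.

Section Solve.
Variables (lam : R) (u U v V : R -> R[i]) (fund : fundamental lam u U v V).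
Variable e : endpoint.

Let hu := fund_hu fund.
Let hv := fund_hv fund.
Let us := fund_u fund.
Let vs := fund_v fund.

Definition coef_u h := cprimitive e (fun x => h x * conjc (v x) * (w x)%:C).
Definition coef_v h := fun x =>
  - cprimitive e (fun x => h x * conjc (u x) * (w x)%:C) x.

(* Variation of constants for [(ell - lam) y = h], with zero data at [e]. *)
Definition solve h : R -> R[i] := fun x => coef_u h x * u x + coef_v h x * v x.
Definition solveq h : R -> R[i] := fun x => coef_u h x * U x + coef_v h x * V x.

Variable h : R -> R[i].
Hypothesis hh : hilb l h.

Let ihv := hdot_integrable hh hv.
Let ihu := hdot_integrable hh hu.

Lemma coef_u_AC : AC_loc l (coef_u h). Proof. exact: cprimitive_AC. Qed.
Lemma coef_v_AC : AC_loc l (coef_v h).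
Proof. by apply: AC_locN; exact: cprimitive_AC. Qed.

Lemma solve_system :
  quasi_system l (solve h) (solveq h) (fun x => h x + lam%:C * solve h x).
Proof.
have [u1 u2 u3 u4] := us; have [v1 v2 v3 v4] := vs.
have d1 := cprimitive_derive e ihv; have d2 := cprimitive_derive e ihu.
have d12 := aeS2 (fun x => @conj _ _) d1 d2.
split.
- by apply: AC_locD; apply: AC_locM => //; [exact: coef_u_AC|exact: coef_v_AC].
- by apply: AC_locD; apply: AC_locM => //; [exact: coef_u_AC|exact: coef_v_AC].
- apply: aeS3 u3 v3 d12 => x h1 h2 [h3 h4] Ix.
  have := has_cderiveD (has_cderiveM (h3 Ix) (h1 Ix))
    (has_cderiveM (has_cderiveN (h4 Ix)) (h2 Ix)).
  by congr has_cderive; rewrite /solveq /coef_u /coef_v (fund_uC fund)// (fund_vC fund)//; ring.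
- apply: aeS3 u4 v4 d12 => x h1 h2 [h3 h4] Ix.
  have := has_cderiveD (has_cderiveM (h3 Ix) (h1 Ix))
    (has_cderiveM (has_cderiveN (h4 Ix)) (h2 Ix)).
  congr has_cderive; rewrite /solve /coef_u /coef_v (fund_uC fund)// (fund_vC fund)//.
  (* The derivatives of the coefficients contribute h w (v U - u V), which the Wronskian turns into
     - h w. To let [ring] see this, h w (1 - 1) is subtracted and its first 1 replaced by the
     Wronskian. *)
  rewrite -[RHS]subr0 -[X in _ = _ - X](mulr0 (h x * (w x)%:C)) -(subrr 1).
  by rewrite -{1}(fund_W fund Ix); ring.
Qed.

(** The coefficients are primitives of integrable functions, hence bounded, and [u] and [v] are
    square-integrable. *)
Lemma solve_hilb : hilb l (solve h).
Proof.
have [A AP] := cprimitive_bounded e ihv; have [B BP] := cprimitive_bounded e ihu.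
have [sa _ _ _] := solve_system; have [m1 m2] := AC_loc_measurable sa.
have AB (z z' : R) : z * z' <= `|z| * `|z'| by rewrite -normrM ler_norm.
refine (@sqr_int_dominated _ _ _ mI (@measurable_w _ l) (2 * (`|A| + `|B|)) (solve h) u v _ m1 m2 _ hu hv).
  by rewrite mulr_ge0// addr_ge0.
move=> x Ix; apply: le_trans (nsqD _ _) _; rewrite !nsqM -mulrA ler_wpM2l//.
have := AP x Ix; have := BP x Ix.
rewrite -/(coef_u h x) => bB bA.
have -> : nsq (coef_v h x) = nsq (cprimitive e (fun x => h x * conjc (u x) * (w x)%:C) x).
  by rewrite /nsq !reimE !sqrrN.
have := nsq_ge0 (u x); have := nsq_ge0 (v x).
have := le_trans bA (ler_norm A); have := le_trans bB (ler_norm B).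
have := normr_ge0 A; have := normr_ge0 B.
by move=> *; nra.
Qed.

(** Both coefficients tend to 0 at [e], while the brackets of [u] and [v] with [g] have finite
    limits. *)
Lemma solve_wronskian g G L : ccvg l e (wronskian u U g G) L ->
  forall M, ccvg l e (wronskian v V g G) M ->
  ccvg l e (wronskian (solve h) (solveq h) g G) 0.
Proof.
move=> cu M cv; have c1 := cprimitive_cvg0 e ihv.
have c2 := ccvgN (cprimitive_cvg0 e ihu).
have := ccvgD (ccvgM c1 cu) (ccvgM c2 cv).
rewrite oppr0 !mul0r addr0; apply: ccvg_eq => x Ix.
by rewrite /wronskian /solve /solveq /coef_u /coef_v; ring.
Qed.

Lemma solve_eq0 x : I x -> (forall t, piece l e x t -> t != x -> h t = 0) ->
  solve h x = 0 /\ solveq h x = 0.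
Proof.
move=> Ix h0.
have prim0 (g : R -> R[i]) : cprimitive e (fun x => h x * g x * (w x)%:C) x = 0.
  have zero (b : R -> R) : (forall t, piece l e x t -> t != x -> b t = 0) ->
      primitive l e b x = 0.
    move=> b0; rewrite /primitive.
    have -> : (\int[mu]_(t in piece l e x) b t =
        \int[mu]_(t in piece l e x) (b \_ [set x]) t)%R.
      apply: eq_Rintegral => t /set_mem pt; rewrite patchE; case: ifPn => // /negP tx.
      by apply: b0 => //; apply/eqP => tx'; apply: tx; rewrite inE.
    rewrite -Rintegral_mkcondr (_ : _ `&` _ = [set x]) ?Rintegral_set1 ?mulr0//.
    by apply/setIidPr => t ->; exact: piece_refl.
  by apply: complexP; apply: zero => t pt tx; rewrite h0// !mul0r.
rewrite /solve /solveq /coef_u /coef_v.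
by rewrite (prim0 (fun x => conjc (v x))) (prim0 (fun x => conjc (u x))) oppr0 !mul0r addr0.
Qed.

End Solve.

End VariationOfConstants.

(** * Non-principal solutions and boundary values *)

Section NonPrincipalSolutions.
Local Open Scope classical_set_scope.
Local Open Scope ring_scope.
Local Open Scope complex_scope.
Context {R : realType}.
Variable l : sturm_liouville R.
Notation mu := (@lebesgue_measure R).
Notation Re := complex.Re.
Notation Im := complex.Im.
Notation I := (interval_of l).
Notation p := (sl_p l).
Notation w := (sl_w l).
Implicit Types (f g h F G H K : R -> R[i]) (c d x y : R) (k z : R[i]) (e : endpoint).
Implicit Types (u v : R -> R).

Let mI : measurable I. Proof. exact: measurable_interval. Qed.
Let mI' : measurable (I : set (measurableTypeR R)). Proof. exact: measurable_interval. Qed.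

Lemma measurable_invr : measurable_fun setT (fun x : R => x^-1).
Proof.
rewrite -(setvU [set 0]); apply/measurable_funU => //; first exact: measurableC.
split; last first.
  have m0 : measurable_fun [set (0 : R)] (fun=> 0 : R) by exact: measurable_cst.
  by apply: eq_measurable_fun m0 => x /set_mem -> /=; rewrite invr0.
apply: open_continuous_measurable_fun.
  by apply: closed_openC; exact: closed_eq.
by move=> x /set_mem /eqP x0; exact: inv_continuous.
Qed.

Lemma integrable_union (A B : set (measurableTypeR R)) u :
  measurable A -> measurable B ->
  mu.-integrable A (EFin \o u) -> mu.-integrable B (EFin \o u) ->
  mu.-integrable (A `|` B) (EFin \o u).
Proof.
move=> mA mB /integrableP[mfA iA] /integrableP[mfB iB].
have mf : measurable_fun (A `|` B) (EFin \o u) by exact/measurable_funU.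
apply/integrableP; split => //.
have mBA : measurable (B `\` A) by exact: measurableD.
have mAf : measurable_fun (A `|` B) (fun x => `|(EFin \o u) x|%E).
  exact: measurableT_comp.
have AB : A `|` B = A `|` (B `\` A).
  by rewrite setDE setUIr setUv setIT.
rewrite AB ge0_integral_setU//; last 2 first.
- by rewrite -AB.
- by apply/disj_setPS => x [Ax [_ /(_ Ax)]].
apply: lte_add_pinfty => //; apply: le_lt_trans iB.
apply: ge0_subset_integral => //; exact: measurableT_comp.
Qed.

Lemma has_deriveV u x a : u x != 0 -> has_derive u x a ->
  has_derive (fun y => (u y)^-1) x (- a / u x ^+ 2).
Proof.
move=> u0 /has_deriveP hu; apply/has_deriveP.
by have := is_deriveV u0 hu; congr is_derive; rewrite /GRing.scale/=; ring.
Qed.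

Lemma AC_loc_constant f : AC_loc l f ->
  {ae mu, forall x, I x -> has_cderive f x 0} ->
  forall x y, I x -> I y -> f x = f y.
Proof.
move=> af df x y; wlog xy : x y / x <= y => [W Ix Iy|Ix Iy].
  by have [xy|/ltW yx] := leP x y; [exact: W|apply/esym; exact: W].
have [a1 a2] := af x y Ix Iy.
have sub t : x < t < y -> I t.
  by move=> /andP[/ltW xt /ltW ty]; exact: interval_between Ix Iy xt ty.
have zero (b : R -> R) : abs_continuous x y b ->
    {ae mu, forall t, x < t < y -> derive1 b t = 0} -> b x = b y.
  move=> ab db; have m0 : measurable_fun `[x, y] (fun=> 0 : R) by exact: measurable_cst.
  have [_] := abs_continuous_FTC xy ab m0 db.
  by rewrite Rintegral_cst// mul0r => /eqP; rewrite subr_eq0 => /eqP.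
apply: complexP; [apply: (zero _ a1)|apply: (zero _ a2)].
  by apply: aeS df => t h /sub /h[[_ ->] _].
by apply: aeS df => t h /sub /h[_ [_ ->]].
Qed.

(** Between the two pieces [f] is bounded and the weight integrable. If the pieces overlap,
    exchanging the two points shrinks both and leaves a segment in between. *)
Lemma AC_loc_piece_hilb f : AC_loc l f ->
  (exists2 c, I c & sqr_int (piece l Left c) w f) ->
  (exists2 c, I c & sqr_int (piece l Right c) w f) -> hilb l f.
Proof.
move=> af [c Ic [_ _ ic]] [d Id [_ _ id]].
have [m1 m2] := AC_loc_measurable af; split => //.
wlog cd : c d Ic Id ic id / c <= d => [W|].
  have [cd|/ltW dc] := leP c d; first exact: (W c d).
  apply: (W d c) => //; [apply: integrableS ic|apply: integrableS id] => //.
  - exact: measurable_piece.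
  - exact: measurable_piece.
  - by apply: piece_trans; case: Id; split.
  - exact: measurable_piece.
  - exact: measurable_piece.
  - by apply: piece_trans; case: Ic; split.
have imid : mu.-integrable `[c, d] (EFin \o (fun x => nsq (f x) * w x)).
  have [a1 a2] := af c d Ic Id.
  have [A A0 AP] := abs_continuous_bounded a1; have [B B0 BP] := abs_continuous_bounded a2.
  have [_ _ iw] := sl_loc_integrable Ic.1 Id.2.
  have := integrableRZ (A ^+ 2 + B ^+ 2) (measurable_itv _) (integrable_norm iw).
  have sub : `[c, d]%classic `<=` I.
    by move=> t /=; rewrite in_itv/= => /andP[ct td]; exact: interval_between Ic Id ct td.
  apply: integrable_dominated => //.
    apply: measurable_funM; last exact: integrable_measurable iw.
    by apply: measurable_funS (measurable_nsq m1 m2).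
  move=> t /=; rewrite in_itv/= => /andP[ct td]; rewrite normrM ler_wpM2r//.
  rewrite ger0_norm ?nsq_ge0// /nsq lerD// -[leLHS]real_normK ?num_real//.
    by rewrite ler_sqr ?nnegrE// ?AP// ltW.
  by rewrite ler_sqr ?nnegrE// ?BP// ltW.
have := integrable_union _ _ (integrable_union _ _ ic imid) id.
have mc : measurable (piece l Left c : set (measurableTypeR R)) by exact: measurable_piece.
have md : measurable (piece l Right d : set (measurableTypeR R)) by exact: measurable_piece.
move=> /(_ _ md mc)/(_ (measurable_itv _)) H.
have {}H := H (measurableU _ _ mc (measurable_itv _)).
apply: integrableS H => //; first by apply: measurableU => //; exact: measurableU.
move=> t [at_ tb]; have [tc|ct] := leP t c; first by left; left.
have [td|dt] := leP t d; last by right; split => //; exact: ltW.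
by left; right; rewrite /= in_itv/= td ltW.
Qed.


Notation qd u := (quasi_derivative l (toC u)).

(** Since [u] is real, the imaginary part of its quasi-derivative divided by p is the derivative of
    0. It vanishes almost everywhere, and by absolute continuity everywhere. *)
Lemma solution_real lam u : solution l lam%:C (toC u) ->
  forall x, I x -> conjc (qd u x) = qd u x.
Proof.
move=> /solution_quasi_system[s1 s2 s3 s4] x Ix.
apply: complexP; rewrite reimE//.
have acI c d : I c -> I d -> abs_continuous c d (fun x => Im (qd u x)).
  by move=> Ic Id; have [] := s2 c d Ic Id.
rewrite (abs_continuous_eq0 acI) ?oppr0//.
apply: aeS2 s3 (p_gt0 l) => y h1 h2 Iy.
have [_ [_]] := h1 Iy; rewrite ImM Re_real Im_real mulr0 add0r /toC /=.
have -> : derive1 (fun _ : R => 0 : R) y = 0 by have [_] := has_derive_cst (0 : R) y.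
move=> /esym/eqP; rewrite mulf_eq0 invr_eq0 (gt_eqF (h2 Iy)) orbF.
by move=> /eqP.
Qed.

Lemma solution_hilb lam f : limit_circle l Left -> limit_circle l Right ->
  solution l lam f -> hilb l f.
Proof.
by move=> HL HR sf; apply: AC_loc_piece_hilb; [case: sf => -[]|exact: HL sf|exact: HR sf].
Qed.

(** The Wronskian of two real solutions for the same real [lam] is constant, hence equal to its
    limit 1; the limit-circle property at both ends puts the solutions in L^2. *)
Lemma normalized_fundamental e lam u v :
  limit_circle l Left -> limit_circle l Right ->
  solution l lam%:C (toC u) -> solution l lam%:C (toC v) ->
  lim_at l e (bracket l (toC u) (toC v)) = 1 ->
  fundamental l lam (toC u) (qd u) (toC v) (qd v).
Proof.
move=> HL HR su sv lim1; have us := solution_quasi_system su.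
have vs := solution_quasi_system sv.
have W0 : {ae mu, forall x, I x ->
    has_cderive (wronskian (toC u) (qd u) (toC v) (qd v)) x 0}.
  apply: aeS (wronskian_derive us vs) => x h Ix; have := h Ix.
  by congr has_cderive; rewrite conjM !conj_real; ring.
have Wcst := AC_loc_constant (wronskian_AC us vs) W0.
have hu : hilb l (toC u) := solution_hilb HL HR su.
have hv : hilb l (toC v) := solution_hilb HL HR sv.
split => //; do ?[by move=> x _; exact: conj_real].
- exact: (solution_real su).
- exact: (solution_real sv).
move=> x Ix; rewrite -(solution_real sv Ix) -lim1.
have -> : lim_at l e (bracket l (toC u) (toC v)) =
    wronskian (toC u) (qd u) (toC v) (qd v) x.
  apply: lim_atE; apply: ccvg_eq (ccvg_cst l e _) => y Iy.
  by rewrite (bracketE us vs)//; exact: Wcst.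
by rewrite /wronskian /toC conj_real.
Qed.

(** [pair_ratio] is the form in which principality of [u] enters later: [u] is negligible against
    [v] at [e], so that the limit of f / v depends on the bracket of f with [u] alone. *)
Record non_principal_pair e lam u v : Prop := NonPrincipalPair {
  pair_fund : fundamental l lam (toC u) (qd u) (toC v) (qd v);
  pair_free : exists c, [/\ I c, zero_free (piece l e c) v &
    mu.-integrable (piece l e c) (EFin \o (fun x => (p x * v x ^+ 2)^-1))];
  pair_ratio : (fun x => u x / v x) @ end_filter l e --> (0 : R)
}.

Lemma fundamental_real lam u v :
  fundamental l lam (toC u) (qd u) (toC v) (qd v) ->
  forall x, I x -> u x * Re (qd v x) - Re (qd u x) * v x = 1.
Proof.
move=> fd x Ix; have := congr1 (@complex.Re R) (fund_W fd Ix).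
by rewrite /toC !reimE !mulr0 !mul0r !subr0.
Qed.

Lemma piece_abs_continuousV e c v : I c -> zero_free (piece l e c) v ->
  (forall x y, I x -> I y -> abs_continuous x y v) ->
  forall x y, piece l e c x -> piece l e c y ->
    abs_continuous x y (fun t => (v t)^-1).
Proof.
move=> Ic v0 acv x y px py; apply: abs_continuousV.
  exact: acv (piece_sub Ic px) (piece_sub Ic py).
by move=> t xt ty; apply: v0; exact: piece_between px py xt ty.
Qed.

Lemma Re_mul_real z (r : R) : Re (z * r%:C) = Re z * r.
Proof. by rewrite ReM Re_real Im_real mulr0 subr0. Qed.

(** The quotient rule for c / s when the derivatives of c and s are [a / r] and [b / r], with p for
    [r]: the numerator becomes a Wronskian. *)
Lemma quotient_derive_eq (a b c r s : R) : r != 0 -> s != 0 ->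
  a / r * s^-1 + c * (- (b / r) / s ^+ 2) = - (c * b - a * s) / (r * s ^+ 2).
Proof. by move=> r0 s0; field; rewrite r0 s0. Qed.

(** Applied with [s] the limit of u / v; the 4 is the inverse square of the fraction 1/2 of this
    limit that u / v retains near the endpoint. *)
Lemma inv_psqr_le (a b r s : R) : a != 0 -> b != 0 -> s != 0 ->
  `|s| / 2 <= `|a / b| -> `|(r * a ^+ 2)^-1| <= 4 / s ^+ 2 * `|(r * b ^+ 2)^-1|.
Proof.
move=> a0 b0 s0 sab.
have E c : `|(r * c ^+ 2)^-1| = `|r^-1| * (c ^+ 2)^-1.
  by rewrite invfM normrM [`|(c ^+ 2)^-1|]ger0_norm// invr_ge0 sqr_ge0.
rewrite !E mulrCA ler_wpM2l//.
have a2 : 0 < a ^+ 2 by rewrite exprn_even_gt0.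
have b2 : 0 < b ^+ 2 by rewrite exprn_even_gt0.
have s2 : 0 < s ^+ 2 by rewrite exprn_even_gt0.
have -> : 4 / s ^+ 2 * (b ^+ 2)^-1 = (s ^+ 2 * b ^+ 2 / 4)^-1.
  by field; rewrite s0 b0.
have sab2 : s ^+ 2 * b ^+ 2 / 4 <= a ^+ 2.
  have : (`|s| / 2) ^+ 2 <= `|a / b| ^+ 2 by rewrite ler_sqr ?nnegrE// divr_ge0.
  rewrite expr_div_n !real_normK ?num_real// [(a / b) ^+ 2]expr_div_n ler_pdivlMr//.
  by move: (s ^+ 2) (b ^+ 2) (a ^+ 2) => *; lra.
by rewrite lef_pV2 ?posrE// divr_gt0// mulr_gt0.
Qed.

Lemma measurable_inv_psqr u : measurable_fun I u ->
  measurable_fun I (fun x => (p x * u x ^+ 2)^-1).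
Proof.
move=> mu_; have m1 : measurable_fun I (fun x => (p x)^-1 * (u x)^-1 ^+ 2).
  apply: measurable_funM; first exact: measurable_pV.
  by apply: measurable_funX; apply: (measurableT_comp measurable_invr).
by apply: eq_measurable_fun m1 => x _; rewrite invfM exprVn.
Qed.

Lemma piece_split e c x : I c -> piece l e c x -> exists y z : R,
  [/\ I y, I z, y <= z, `[y, z]%classic `<=` piece l e c &
      piece l e c `<=` piece l e x `|` `[y, z]%classic].
Proof.
move=> Ic px; have Ix := piece_sub Ic px; have pc := piece_refl e Ic.
case: e px pc => -[h1 h2] pc.
  exists x, c; split => // t.
    by rewrite /= in_itv/= => /andP[xt tc]; apply: piece_between pc xt tc; split.
  move=> [at_ tc]; have [tx|/ltW xt] := leP t x; first by left.
  by right; rewrite /= in_itv/= xt.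
exists c, x; split => // t.
  by rewrite /= in_itv/= => /andP[ct tx]; apply: piece_between pc _ ct tx; split.
move=> [ct tb]; have [xt|/ltW tx] := leP x t; first by left.
by right; rewrite /= in_itv/= ct.
Qed.

(** As the Wronskian is 1, (u / v)' = - 1/(p v^2), which is integrable, so u / v has a limit [L]. A
    non-zero [L] would make 1/(p u^2) comparable to 1/(p v^2) near [e], hence integrable, against
    the principality of [u]. *)
Lemma normalized_pair e lam v : limit_circle l Left -> limit_circle l Right ->
  normalized_non_principal l e lam v -> exists u, non_principal_pair e lam u v.
Proof.
move=> HL HR [[sv [c2 [Ic2 v0 iv]]] [u [su [c1 [Ic1 u0 iu]]] lim1]].
have fd := normalized_fundamental HL HR su sv lim1.
exists u; split => //; first by exists c2.
have [u1 _ u3 _] := fund_u fd; have [v1 _ v3 _] := fund_v fd.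
have acu x y : I x -> I y -> abs_continuous x y u by move=> Ix Iy; have [] := u1 x y Ix Iy.
have acv x y : I x -> I y -> abs_continuous x y v by move=> Ix Iy; have [] := v1 x y Ix Iy.
have acr x y : piece l e c2 x -> piece l e c2 y -> abs_continuous x y (fun t => u t / v t).
  move=> px py; apply: abs_continuousM.
    exact: acu (piece_sub Ic2 px) (piece_sub Ic2 py).
  exact: piece_abs_continuousV Ic2 v0 acv _ _ px py.
have ivN : mu.-integrable (piece l e c2) (EFin \o (fun x => - (p x * v x ^+ 2)^-1)).
  have mp : measurable (piece l e c2 : set (measurableTypeR R)) by exact: measurable_piece.
  by apply: eq_integrableR (integrableRZ (-1) mp iv) => x; rewrite mulN1r.
have dr : {ae mu, forall x, piece l e c2 x -> x != c2 ->
    derive1 (fun t => u t / v t) x = - (p x * v x ^+ 2)^-1}.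
  apply: aeS3 u3 v3 (p_gt0 l) => x h1 h2 h3 px _; have Ix := piece_sub Ic2 px.
  have du : has_derive u x (Re (qd u x) * (p x)^-1).
    by rewrite -Re_mul_real; have [] := h1 Ix.
  have dv : has_derive v x (Re (qd v x) * (p x)^-1).
    by rewrite -Re_mul_real; have [] := h2 Ix.
  have p0 := lt0r_neq0 (h3 Ix).
  have vx0 := v0 _ px.
  have [_ ->] := has_deriveM du (has_deriveV vx0 dv).
  by rewrite (quotient_derive_eq _ _ _ p0 vx0) (fundamental_real fd Ix) mulN1r.
have /cvg_ex[L cL] := piece_cvg Ic2 acr ivN dr.
have [L0|L0] := eqVneq L 0; first by move: cL; rewrite L0.
exfalso; apply: iu.
have L20 : 0 < `|L| / 2 by rewrite divr_gt0// normr_gt0.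
have [c3 Ic3 c3P] : \forall x \near end_filter l e, `|L - u x / v x| < `|L| / 2.
  by move/cvgrPdist_lt: cL => /(_ _ L20).
have [c4 Ic4 c4P] := piece_cap e (l := l) Ic3 Ic2.
have [c5 Ic5 c5P] := piece_cap e (l := l) Ic4 Ic1.
have mp c : I c -> measurable (piece l e c : set (measurableTypeR R)).
  exact: measurable_piece.
have p5 t : piece l e c5 t -> [/\ piece l e c3 t, piece l e c2 t & piece l e c1 t].
  by move=> /c5P[/c4P[]].
have muI : measurable_fun I (fun x => (p x * u x ^+ 2)^-1).
  by apply: measurable_inv_psqr; exact: abs_continuous_interval_measurable.
have near_e : mu.-integrable (piece l e c5) (EFin \o (fun x => (p x * u x ^+ 2)^-1)).
  have ivs : mu.-integrable (piece l e c5) (EFin \o (fun x => (p x * v x ^+ 2)^-1)).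
    by apply: integrableS iv; [exact: mp|exact: mp|move=> t /p5[]].
  have := integrableRZ (4 / L ^+ 2) (mp _ Ic5) (integrable_norm ivs).
  apply: integrable_dominated; first exact: mp.
    by apply: measurable_funS muI => //; exact: piece_sub.
  move=> t pt; have [t3 t2 t1] := p5 _ pt.
  have := c3P _ t3; have ut := u0 _ t1; have vt := v0 _ t2.
  move=> close; have far : `|L| / 2 <= `|u t / v t|.
    have := ler_distD (u t / v t) L 0; rewrite !subr0 => tri.
    by move: close tri; lra.
  exact: inv_psqr_le.
have c15 : piece l e c1 c5 by have [] := p5 _ (piece_refl e Ic5).
have [y [z [Iy Iz yz sub cover]]] := piece_split Ic1 c15.
(* What is left of the piece on which [u] is zero-free lies in a compact segment, where 1/u is
   bounded and 1/p integrable. *)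
have seg : mu.-integrable `[y, z] (EFin \o (fun x => (p x * u x ^+ 2)^-1)).
  have py : piece l e c1 y by apply: sub; rewrite /= in_itv/= lexx.
  have pz : piece l e c1 z by apply: sub; rewrite /= in_itv/= lexx andbT.
  have [M M0 MP] := abs_continuous_bounded (piece_abs_continuousV Ic1 u0 acu py pz).
  have [ip _ _] := sl_loc_integrable Iy.1 Iz.2.
  have := integrableRZ (M ^+ 2) (measurable_itv _) (integrable_norm ip).
  apply: integrable_dominated => //.
    by apply: measurable_funS muI => // t /sub; exact: piece_sub.
  move=> t /=; rewrite in_itv/= => /andP[yt tz].
  rewrite invfM -exprVn normrM mulrC ler_wpM2r// normrX.
  by rewrite ler_sqr ?nnegrE ?(ltW M0)// MP.
have := integrable_union (mp _ Ic5) (measurable_itv _) near_e seg.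
by apply: integrableS => //; [apply: measurableU => //; exact: mp|exact: mp].
Qed.

End NonPrincipalSolutions.

(** * Boundary values of functions in the maximal domain and in the form domain *)

Section BoundaryValues.
Local Open Scope classical_set_scope.
Local Open Scope ring_scope.
Local Open Scope complex_scope.
Context {R : realType}.
Variable l : sturm_liouville R.
Notation mu := (@lebesgue_measure R).
Notation Re := complex.Re.
Notation Im := complex.Im.
Notation I := (interval_of l).
Notation p := (sl_p l).
Notation qd u := (quasi_derivative l (toC u)).
Implicit Types (f g h F G H K : R -> R[i]) (c d x y : R) (k z A B : R[i]) (e : endpoint).
Implicit Types (u v : R -> R).

Let mI : measurable I. Proof. exact: measurable_interval. Qed.
Let mI' : measurable (I : set (measurableTypeR R)). Proof. exact: measurable_interval. Qed.

Definition boundary_data e u v f F A B : Prop :=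
  ccvg l e (wronskian f F (toC u) (qd u)) A /\
  ccvg l e (wronskian f F (toC v) (qd v)) B.

Lemma boundary_data_ex e lam u v f F H :
  fundamental l lam (toC u) (qd u) (toC v) (qd v) ->
  quasi_system l f F H -> hilb l f -> hilb l H ->
  exists A B, boundary_data e u v f F A B.
Proof.
move=> fd fs hf hH; have hu := fund_hu fd; have hv := fund_hv fd.
have [A1 [A2 [a1 a2 _]]] := green fs (fund_u fd) hf hH hu (hilbM lam%:C hu).
have [B1 [B2 [b1 b2 _]]] := green fs (fund_v fd) hf hH hv (hilbM lam%:C hv).
by case: e; [exists A1, B1|exists A2, B2].
Qed.

Lemma boundary_data_lin e u v f F A B k f' F' A' B' :
  boundary_data e u v f F A B -> boundary_data e u v f' F' A' B' ->
  boundary_data e u v (fun x => k * f x + f' x) (fun x => k * F x + F' x)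
    (k * A + A') (k * B + B').
Proof.
move=> [a b] [a' b']; split.
  have := ccvgD (ccvgM (ccvg_cst l e k) a) a'; apply: ccvg_eq => x _.
  by rewrite /wronskian; ring.
have := ccvgD (ccvgM (ccvg_cst l e k) b) b'; apply: ccvg_eq => x _.
by rewrite /wronskian; ring.
Qed.

Lemma fundamental_decomposition lam (u U v V : R -> R[i]) f F x :
  fundamental l lam u U v V -> I x ->
  f x = wronskian f F v V x * u x - wronskian f F u U x * v x.
Proof.
move=> fd Ix; rewrite /wronskian (fund_UC fd)// (fund_VC fd)// (fund_uC fd)//.
rewrite (fund_vC fd)// -[LHS]mulr1 -(fund_W fd Ix); ring.
Qed.

(** A Plücker relation: since the bracket of [u] and [v] is 1, any bracket is the determinant of the
    brackets with [u] and [v]. In the limit, boundary terms are thus expressed by boundary data. *)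
Lemma plucker lam (u U v V : R -> R[i]) f F g G x :
  fundamental l lam u U v V -> I x ->
  wronskian f F g G x = wronskian f F u U x * conjc (wronskian g G v V x)
    - wronskian f F v V x * conjc (wronskian g G u U x).
Proof.
move=> fd Ix; rewrite /wronskian !conjE (fund_UC fd)// (fund_VC fd)// (fund_uC fd)//.
by rewrite (fund_vC fd)// -[LHS]mulr1 -(fund_W fd Ix); ring.
Qed.

Lemma quotient_eq (a b c s : R[i]) : s != 0 -> a * (c / s) - b = (a * c - b * s) / s.
Proof. by move=> s0; rewrite mulrBl mulfK// mulrA. Qed.

(** Decomposing [f] along [u] and [v] gives f / v = [f, v] u / v - [f, u], and u / v tends to 0. *)
Lemma quotient_cvg e lam u v f F A B : non_principal_pair l e lam u v ->
  boundary_data e u v f F A B -> ccvg l e (fun x => f x / (v x)%:C) (- A).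
Proof.
move=> [fd [c [Ic v0 _]] ratio] [cA cB].
have cr : ccvg l e (fun x => (u x / v x)%:C) 0.
  by split; [exact: ratio|exact: cvg_cst].
have := ccvgD (ccvgM cB cr) (ccvgN cA); rewrite mulr0 add0r.
apply: ccvg_near; exists c => // x px; have Ix := piece_sub Ic px.
rewrite (fundamental_decomposition f F fd Ix) rmorphM/= fmorphV/=.
have vx0 : (v x)%:C != 0 by rewrite (inj_eq (@complexI _)) v0.
exact: (quotient_eq _ _ _ vx0).
Qed.

Lemma wronskian_cvg e lam u v f F A B g G A' B' :
  fundamental l lam (toC u) (qd u) (toC v) (qd v) ->
  boundary_data e u v f F A B -> boundary_data e u v g G A' B' ->
  ccvg l e (wronskian f F g G) (A * conjc B' - B * conjc A').
Proof.
move=> fd [cA cB] [cA' cB'].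
have := ccvgD (ccvgM cA (ccvg_conj cB')) (ccvgN (ccvgM cB (ccvg_conj cA'))).
by apply: ccvg_eq => x Ix; rewrite (plucker f F g G fd Ix).
Qed.

Lemma measurable_sqrtr : measurable_fun setT (@Num.sqrt R).
Proof. by apply: continuous_measurable_fun; exact: sqrt_continuous. Qed.

(** The derivative of f / v is N f times 1/(sqrt p v), a product of two square-integrable functions,
    so it is integrable near [e]. Real and imaginary parts are treated separately. *)
Lemma form_domain_cvg e c v f : I c -> zero_free (piece l e c) v ->
  (forall x y, I x -> I y -> abs_continuous x y v) ->
  (exists2 c', I c' &
    mu.-integrable (piece l e c') (EFin \o (fun x => (p x * v x ^+ 2)^-1))) ->
  AC_loc l f -> sqr_int_ae (piece l e c) (fun=> 1) (N_op l v f) ->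
  exists z, ccvg l e (fun x => f x / (v x)%:C) z.
Proof.
move=> Ic v0 acv [c' Ic' iv] af [G [G1 G2 iG] GE].
have [c2 Ic2 c2P] := piece_cap e Ic Ic'.
have mp x : I x -> measurable (piece l e x : set (measurableTypeR R)).
  exact: measurable_piece.
have v02 : zero_free (piece l e c2) v by move=> x /c2P[/v0].
have vI : measurable_fun I v by exact: abs_continuous_interval_measurable.
have real_part (phi gam : R -> R) :
    (forall x y, I x -> I y -> abs_continuous x y phi) ->
    measurable_fun (piece l e c2) gam ->
    (forall x, piece l e c2 x -> gam x ^+ 2 <= nsq (G x)) ->
    {ae mu, forall x, piece l e c2 x ->
       gam x = Num.sqrt (p x) * v x * derive1 (fun t => phi t / v t) x} ->
    cvg ((fun x => phi x / v x) @ end_filter l e).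
  move=> acphi mgam gamG gamE.
  apply: (@piece_cvg _ l e c2 _ (fun x => gam x * (Num.sqrt (p x)^-1 * (v x)^-1))) => //.
  - move=> x y px py; apply: abs_continuousM.
      exact: acphi (piece_sub Ic2 px) (piece_sub Ic2 py).
    exact: piece_abs_continuousV Ic2 v02 acv _ _ px py.
  - have iG2 : mu.-integrable (piece l e c2) (EFin \o (fun x => nsq (G x) * 1)).
      by apply: integrableS iG; [exact: mp|exact: mp|move=> t /c2P[]].
    have iv2 : mu.-integrable (piece l e c2) (EFin \o (fun x => (p x * v x ^+ 2)^-1)).
      by apply: integrableS iv; [exact: mp|exact: mp|move=> t /c2P[]].
    have := integrableRD (mp _ Ic2) iG2 (integrable_norm iv2).
    apply: integrable_dominated; first exact: mp.
      apply: measurable_funM => //; apply: measurable_funM.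
        apply: measurableT_comp; first exact: measurable_sqrtr.
        by apply: measurable_funS (@measurable_pV _ l) => //; exact: piece_sub.
      apply: measurableT_comp; first exact: measurable_invr.
      by apply: measurable_funS vI => //; exact: piece_sub.
    move=> x px; have := gamG _ px; rewrite mulr1 => g2.
    (* The bound has to hold at every point, also on the null set where p is negative; there the
       square root is 0. *)
    have b2 : (Num.sqrt (p x)^-1 * (v x)^-1) ^+ 2 <= `|(p x * v x ^+ 2)^-1|.
      rewrite exprMn invfM normrM exprVn [`|(v x ^+ 2)^-1|]ger0_norm ?invr_ge0 ?sqr_ge0//.
      rewrite ler_wpM2r ?invr_ge0 ?sqr_ge0//.
      have [h|h] := leP 0 (p x)^-1; first by rewrite sqr_sqrtr// ler_norm.
      by rewrite ltr0_sqrtr// expr0n/= normr_ge0.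
    move: (Num.sqrt _ * _) (gam x) g2 b2 => b a g2 b2.
    have h1 := sqr_ge0 (a - b); have h2 := sqr_ge0 (a + b).
    by rewrite ler_norml; apply/andP; split; nra.
  - apply: aeS2 gamE (p_gt0 l) => x h1 h2 px _; have Ix := piece_sub Ic2 px.
    rewrite h1// sqrtrV ?ltW ?h2//.
    have s0 : Num.sqrt (p x) != 0 by rewrite gt_eqF// sqrtr_gt0 h2.
    by have vx := v02 _ px; field; rewrite s0 vx.
have [mG1 mG2] : measurable_fun (piece l e c2) (fun x => Re (G x)) /\
    measurable_fun (piece l e c2) (fun x => Im (G x)).
  by split; [apply: measurable_funS G1|apply: measurable_funS G2] => //;
    do ?[exact: measurable_piece]; move=> t /c2P[].
have Eq1 (z : R[i]) (r : R) : Re (z / r%:C) = Re z / r.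
  by rewrite -fmorphV/= Re_mul_real.
have Eq2 (z : R[i]) (r : R) : Im (z / r%:C) = Im z / r.
  by rewrite -fmorphV/= ImM Re_real Im_real mulr0 add0r.
have NE x : N_op l v f x = (Num.sqrt (p x) * v x)%:C *
    (derive1 (fun t => Re (f t) / v t) x +i* derive1 (fun t => Im (f t) / v t) x).
  rewrite /N_op /cderive.
  have -> : (fun y => Re (f y / (v y)%:C)) = (fun t => Re (f t) / v t).
    by apply/funext => t; rewrite Eq1.
  have -> // : (fun y => Im (f y / (v y)%:C)) = (fun t => Im (f t) / v t).
  by apply/funext => t; rewrite Eq2.
have /cvg_ex[a ca] : cvg ((fun x => Re (f x) / v x) @ end_filter l e).
  apply: (real_part _ (fun x => Re (G x))) => //.
  - by move=> x y Ix Iy; have [] := af x y Ix Iy.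
  - by move=> x _; rewrite /nsq lerDl sqr_ge0.
  - apply: aeS GE => x h /c2P[px _]; rewrite h// NE ReM Re_real Im_real mul0r subr0.
    by [].
have /cvg_ex[b cb] : cvg ((fun x => Im (f x) / v x) @ end_filter l e).
  apply: (real_part _ (fun x => Im (G x))) => //.
  - by move=> x y Ix Iy; have [] := af x y Ix Iy.
  - by move=> x _; rewrite /nsq lerDr sqr_ge0.
  - apply: aeS GE => x h /c2P[px _]; rewrite h// NE ImM Re_real Im_real mul0r addr0.
    by [].
exists (a +i* b); split => /=.
  by rewrite (_ : (fun x => _) = fun x => Re (f x) / v x)//; apply/funext => x; rewrite Eq1.
by rewrite (_ : (fun x => _) = fun x => Im (f x) / v x)//; apply/funext => x; rewrite Eq2.
Qed.

End BoundaryValues.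

(** * The maximal domain and the adjoint of the minimal operator *)

Section MaximalDomain.
Local Open Scope classical_set_scope.
Local Open Scope ring_scope.
Local Open Scope complex_scope.
Context {R : realType}.
Variable l : sturm_liouville R.
Notation I := (interval_of l).
Notation p := (sl_p l).
Notation qd u := (quasi_derivative l (toC u)).
Implicit Types (f g h F G H K : R -> R[i]) (c d x y : R) (k z A B : R[i]) (e : endpoint).

Lemma quasi_system_zero f F H : quasi_system l f F H -> hilb l f ->
  hnorm2 l f = 0 -> forall x, I x -> f x = 0 /\ F x = 0.
Proof.
move=> [f1 f2 f3 f4] hf /(hnorm2_eq0 hf) f0.
have fz : forall x, I x -> f x = 0 := AC_loc_eq f1 (@AC_loc_cst _ l 0) f0.
move=> x Ix; split; first exact: fz.
apply: (AC_loc_eq f2 (@AC_loc_cst _ l 0)) => //.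
apply: aeS2 f3 (p_gt0 l) => y h1 h2 Iy.
have := has_cderiveE (h1 Iy); rewrite (cderive_eq fz Iy).
rewrite (has_cderiveE (has_cderive_cst 0 y)) => /esym/eqP; rewrite mulf_eq0.
have /negbTE-> : ((p y)^-1)%:C != 0 by rewrite (inj_eq (@complexI _)) invr_eq0 gt_eqF// h2.
by rewrite orbF => /eqP.
Qed.

Lemma fundamental_hnorm2_neq0 lam (u U v V : R -> R[i]) :
  fundamental l lam u U v V -> hnorm2 l v != 0.
Proof.
move=> fd; apply/eqP => v0; have [x Ix] := interval_nonempty l.
have [vx Vx] := quasi_system_zero (fund_v fd) (fund_hv fd) v0 Ix.
by have := fund_W fd Ix; rewrite vx Vx !mulr0 subr0 => /eqP; rewrite eq_sym oner_eq0.
Qed.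

(* The Gram determinant of two linearly independent solutions is not zero. *)
Lemma fundamental_gram lam (u U v V : R -> R[i]) : fundamental l lam u U v V ->
  forall y0 y1 : R[i], exists a b : R[i],
    hdot l (fun x => a * u x + b * v x) u = y0 /\
    hdot l (fun x => a * u x + b * v x) v = y1.
Proof.
move=> fd y0 y1; have hu := fund_hu fd; have hv := fund_hv fd.
set al := hdot l u u; set be := hdot l u v; set ga := hdot l v v.
have vu : hdot l v u = conjc be by exact: hdotC.
have ga0 : ga != 0.
  rewrite /ga hdot_self// (inj_eq (@complexI _)).
  exact: fundamental_hnorm2_neq0 fd.
have gaC : conjc ga = ga by rewrite /ga hdot_self// conj_real.
have D0 : al * ga - be * conjc be != 0.
  apply/eqP => D0.
  (* The combination is ga u - be v, whose squared norm is ga times the determinant. Since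
     [quasi_system_lin] does not scale its second term, - be v is written as (- be - 1) v + v. *)
  have zs := quasi_system_lin ga (fund_u fd)
    (quasi_system_lin (- be - 1) (fund_v fd) (fund_v fd)).
  set z := (fun x => _ + _) in zs.
  have zE : z = fun x => ga * u x + - be * v x by apply/funext => x; rewrite /z; ring.
  have hz : hilb l z by rewrite zE; apply: hilb_lin => //; exact: hilbM.
  have z0 : hnorm2 l z = 0.
    have hzz : hdot l z z = 0.
      rewrite zE hdot_lin//; [|exact: hilbM|by rewrite -zE].
      rewrite hdotMl//; last by rewrite -zE.
      rewrite !hdotDr//; do ?[exact: hilbM].
      rewrite !hdotMr// conjN gaC -/al -/be -/ga vu.
      by move: D0 => /(congr1 (fun t => ga * t)); rewrite mulr0 => <-; ring.
    by rewrite /hnorm2 hzz.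
  have [x Ix] := interval_nonempty l.
  have [zx Zx] := quasi_system_zero zs hz z0 Ix.
  have W : ga * (u x * V x - U x * v x) = 0.
    have -> : ga * (u x * V x - U x * v x) =
      z x * V x - (ga * U x + ((- be - 1) * V x + V x)) * v x by rewrite /z; ring.
    by rewrite zx Zx !mul0r subr0.
  by move/eqP: W; rewrite (fund_W fd Ix) mulr1 (negbTE ga0).
exists ((y0 * ga - y1 * conjc be) / (al * ga - be * conjc be)),
  ((y1 * al - y0 * be) / (al * ga - be * conjc be)).
have ha k : hilb l (fun x => k * v x) by exact: hilbM.
split; rewrite hdot_lin// hdotMl// ?vu -/al -/be -/ga; field => //.
Qed.

(* [f] is in [D_max] and [H] is its image under [L_max]. *)
Definition max_elem f F H : Prop :=
  [/\ quasi_system l f F H, hilb l f & hilb l H].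

Lemma max_elem_lin k f F H g G K : max_elem f F H -> max_elem g G K ->
  max_elem (fun x => k * f x + g x) (fun x => k * F x + G x) (fun x => k * H x + K x).
Proof.
move=> [f1 f2 f3] [g1 g2 g3]; split; [exact: quasi_system_lin|exact: hilb_lin..].
Qed.

Lemma fundamental_max_u lam (u U v V : R -> R[i]) : fundamental l lam u U v V ->
  max_elem u U (fun x => lam%:C * u x).
Proof. by move=> fd; split; [exact: fund_u fd|exact: fund_hu fd|exact: hilbM (fund_hu fd)]. Qed.

Lemma fundamental_max_v lam (u U v V : R -> R[i]) : fundamental l lam u U v V ->
  max_elem v V (fun x => lam%:C * v x).
Proof. by move=> fd; split; [exact: fund_v fd|exact: fund_hv fd|exact: hilbM (fund_hv fd)]. Qed.

Lemma solve_max e lam (u U v V : R -> R[i]) (fd : fundamental l lam u U v V) h :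
  hilb l h -> max_elem (solve l u v e h) (solveq l u U v V e h)
    (fun x => h x + lam%:C * solve l u v e h x).
Proof.
move=> hh; have hs := solve_hilb fd e hh.
by split; [exact: solve_system|exact: hs|apply: hilbD => //; exact: hilbM].
Qed.

Lemma max_green f F H g G K : max_elem f F H -> max_elem g G K ->
  exists La Lb, [/\ ccvg l Left (wronskian f F g G) La,
    ccvg l Right (wronskian f F g G) Lb & Lb - La = hdot l H g - hdot l f K].
Proof. by move=> [? ? ?] [? ? ?]; exact: green. Qed.

Lemma max_wronskian_cvg e f F H g G K : max_elem f F H -> max_elem g G K ->
  exists L, ccvg l e (wronskian f F g G) L.
Proof.
by move=> fm gm; have [La [Lb [a b _]]] := max_green fm gm; case: e; [exists La|exists Lb].
Qed.

Lemma solve_wronskian0 e lam (u U v V : R -> R[i]) (fd : fundamental l lam u U v V) h :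
  hilb l h -> forall g G K, max_elem g G K ->
  ccvg l e (wronskian (solve l u v e h) (solveq l u U v V e h) g G) 0.
Proof.
move=> hh g G K gm.
have [L Lc] := max_wronskian_cvg e (fundamental_max_u fd) gm.
have [M Mc] := max_wronskian_cvg e (fundamental_max_v fd) gm.
exact: (solve_wronskian fd hh Lc Mc).
Qed.

(** Green's identity, with no contribution from [e]. The boundary data at the other end are
    therefore inner products of [h] with solutions, and can be prescribed through [h]. *)
Lemma solve_wronskian_opp e lam (u U v V : R -> R[i]) (fd : fundamental l lam u U v V) h :
  hilb l h -> forall g G, max_elem g G (fun x => lam%:C * g x) ->
  ccvg l (opp_end e) (wronskian (solve l u v e h) (solveq l u U v V e h) g G)
    ((sgn_end e)%:C * hdot l h g).
Proof.
move=> hh g G gm; have sm := solve_max e fd hh; have [_ hs _] := sm.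
have [_ hg _] := gm.
have [La [Lb [a b E]]] := max_green sm gm.
have {}E : Lb - La = hdot l h g.
  rewrite E hdotDl//; last exact: hilbM.
  by rewrite hdotMl// hdotMr// conj_real addrK.
have s0 := solve_wronskian0 e fd hh gm.
rewrite -E; case: e {sm hs E} a b s0 => a b s0 /=.
  by rewrite (ccvg_unique a s0) subr0 mul1r.
by rewrite (ccvg_unique b s0) sub0r rmorphN mulN1r opprK.
Qed.

(** From [g] one subtracts a solution [y0] of (ell - lam) y0 = h - lam g and the combination [s] of
    [u] and [v] that makes the remainder [z'] orthogonal to both. The solution [f] of (ell - lam) f
    = z' with zero data on the left then has zero data on the right too, so it lies in the minimal
    domain, and testing the adjoint relation with it gives z' = 0 almost everywhere. *)
Lemma adjoint_L_min lam (u v : R -> R) g h :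
  fundamental l lam (toC u) (qd u) (toC v) (qd v) ->
  adjoint l (L_min l) (g, h) ->
  exists f F K, [/\ max_elem f F K, eq_ae I g f & eq_ae I h K].
Proof.
move=> fd [/= hg hh adj].
have um := fundamental_max_u fd; have vm := fundamental_max_v fd.
have hu := fund_hu fd; have hv := fund_hv fd.
pose k x := h x - lam%:C * g x.
have hk : hilb l k by apply: hilbB => //; exact: hilbM.
have y0m := solve_max Left fd hk.
set y0 := solve _ _ _ _ k in y0m; set Y0 := solveq _ _ _ _ _ _ k in y0m.
have [_ hy0 hK0] := y0m.
pose z x := g x - y0 x; have hz : hilb l z by exact: hilbB.
have [a [b [sa sb]]] := fundamental_gram fd (hdot l z (toC u)) (hdot l z (toC v)).
pose s x := a * toC u x + b * toC v x.
have hs : hilb l s by apply: hilb_lin => //; exact: hilbM.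
pose z' x := z x - s x; have hz' : hilb l z' by exact: hilbB.
have zu : hdot l z' (toC u) = 0 by rewrite hdotBl// sa subrr.
have zv : hdot l z' (toC v) = 0 by rewrite hdotBl// sb subrr.
have fm := solve_max Left fd hz'.
set f := solve _ _ _ _ z' in fm; set F := solveq _ _ _ _ _ _ z' in fm.
have [fs hf hH] := fm.
have f_end e g' G' K' : max_elem g' G' K' -> ccvg l e (wronskian f F g' G') 0.
  case: e => gm; first exact: (solve_wronskian0 Left fd hz' gm).
  have cu := solve_wronskian_opp Left fd hz' um; have cv := solve_wronskian_opp Left fd hz' vm.
  rewrite zu mulr0 in cu; rewrite zv mulr0 in cv.
  have [gs hg' hK'] := gm.
  have [A' [B' cg]] := boundary_data_ex Right fd gs hg' hK'.
  have := wronskian_cvg fd (conj cu cv : boundary_data l Right u v f F 0 0) cg.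
  by rewrite !mul0r subr0.
have fmin : D_min l f.
  split; first exact: quasi_system_D_max fs hf hH.
  move=> g' dg'; have [K' hK' gs'] := D_max_quasi_system dg'; have [_ hg' _] := dg'.
  have gm : max_elem g' (quasi_derivative l g') K' by split.
  have br e : lim_at l e (bracket l f g') = 0.
    apply: lim_atE; apply: ccvg_eq (f_end e _ _ _ gm) => x Ix.
    by rewrite (bracketE fs gs').
  by rewrite !br subrr.
have Lf : L_min l (f, fun x => z' x + lam%:C * f x).
  split => //=; exists f; split => //; first exact/aeW.
  by apply: aeS (ellE fs) => x hx Ix; rewrite hx.
have E1 := adj _ _ Lf; rewrite /= hdotDl ?hdotMl// in E1; last exact: hilbM.
have [La [Lb [ca cb E2]]] := max_green fm y0m.
rewrite (ccvg_unique ca (f_end Left _ _ _ y0m)) in E2.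
rewrite (ccvg_unique cb (f_end Right _ _ _ y0m)) subrr in E2.
have E2a : hdot l (fun x => z' x + lam%:C * f x) y0 =
    hdot l z' y0 + lam%:C * hdot l f y0.
  by rewrite hdotDl ?hdotMl//; exact: hilbM.
have E2b : hdot l f (fun x => k x + lam%:C * y0 x) =
    hdot l f h - lam%:C * hdot l f g + lam%:C * hdot l f y0.
  rewrite hdotDr//; last exact: hilbM.
  by rewrite hdotBr//; [rewrite !hdotMr// conj_real|exact: hilbM].
have E3 : hdot l z' z = 0.
  rewrite hdotBr//; move: E2; rewrite E2a E2b -E1 => E2.
  by rewrite -[RHS]oppr0 E2; ring.
have E4 : hnorm2 l z' = 0.
  have sz : hdot l z' s = 0.
    rewrite hdotDr ?hdotMr//; do ?[exact: hilbM].
    by rewrite zu zv !mulr0 addr0.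
  by rewrite /hnorm2 hdotBr// E3 sz subrr.
have z0 := hnorm2_eq0 hz' E4.
have sm := max_elem_lin a um (max_elem_lin (b - 1) vm vm).
have ym := max_elem_lin 1 y0m sm.
eexists; eexists; eexists; split; first exact: ym.
  apply: aeS z0 => x hx Ix; have /eqP := hx Ix.
  by rewrite /z' /z subr_eq0 subr_eq /s => /eqP ->; ring.
apply: aeS z0 => x hx Ix; have /eqP := hx Ix.
rewrite /z' /z subr_eq0 subr_eq /s => /eqP gE.
by rewrite /k gE; ring.
Qed.

End MaximalDomain.

(** * The boundary maps: Green's identity and surjectivity *)

Section BoundaryMaps.
Local Open Scope classical_set_scope.
Local Open Scope ring_scope.
Local Open Scope complex_scope.
Context {R : realType}.
Variable l : sturm_liouville R.
Notation I := (interval_of l).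
Notation qd u := (quasi_derivative l (toC u)).
Implicit Types (f g h F G H K : R -> R[i]) (c d x y : R) (k z A B : R[i]) (e : endpoint)
  (X Y : 'cV[R[i]]_2).

Lemma vec2E (a b : R[i]) : (vec2 a b 0 0 = a) * (vec2 a b 1 0 = b).
Proof. by split; rewrite mxE. Qed.

Lemma vec2P X Y : X 0 0 = Y 0 0 -> X 1 0 = Y 1 0 -> X = Y.
Proof.
move=> h0 h1; apply/matrixP => i j; rewrite (ord1 j).
by case: i => -[|[|//]] hi; [rewrite (_ : Ordinal hi = 0)|rewrite (_ : Ordinal hi = 1)] => //; exact/val_inj.
Qed.

Lemma dot2E X Y : dot2 X Y = X 0 0 * conjc (Y 0 0) + X 1 0 * conjc (Y 1 0).
Proof. by rewrite /dot2 big_ord_recl big_ord1; congr (_ + X _ 0 * conjc (Y _ 0)); apply/val_inj. Qed.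

Lemma dot2_lin k X X' Y : dot2 (k *: X + X') Y = k * dot2 X Y + dot2 X' Y.
Proof. by rewrite !dot2E !mxE; ring. Qed.

Lemma dot2B X X' Y : dot2 (X - X') Y = dot2 X Y - dot2 X' Y.
Proof. by rewrite !dot2E !mxE; ring. Qed.

Lemma dot2C X Y : dot2 Y X = conjc (dot2 X Y).
Proof. by rewrite !dot2E conjD !conjM !conjK [X in X + _]mulrC [X in _ + X]mulrC. Qed.

Lemma dot20l Y : dot2 0 Y = 0.
Proof. by rewrite dot2E !mxE !mul0r addr0. Qed.

Lemma dot2_eq0 X : dot2 X X = 0 -> X = 0.
Proof.
rewrite dot2E !mul_conj -rmorphD => /eqP; rewrite (inj_eq (@complexI _)).
rewrite paddr_eq0 ?nsq_ge0// => /andP[/eqP h0 /eqP h1].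
by apply: vec2P; rewrite mxE; exact/nsq_eq0.
Qed.

Lemma wronskian_lin k f F g G h H x :
  wronskian (fun x => k * f x + g x) (fun x => k * F x + G x) h H x =
  k * wronskian f F h H x + wronskian g G h H x.
Proof. by rewrite /wronskian; ring. Qed.

Section FundamentalWronskian.
Variables (lam : R) (u U v V : R -> R[i]).
Hypothesis fd : fundamental l lam u U v V.
Variable x : R.
Hypothesis Ix : I x.

Lemma wronskian_uu : wronskian u U u U x = 0.
Proof. by rewrite /wronskian (fund_UC fd)// (fund_uC fd)// mulrC subrr. Qed.

Lemma wronskian_vv : wronskian v V v V x = 0.
Proof. by rewrite /wronskian (fund_VC fd)// (fund_vC fd)// mulrC subrr. Qed.

Lemma wronskian_uv : wronskian u U v V x = 1.
Proof. by rewrite /wronskian (fund_VC fd)// (fund_vC fd)// (fund_W fd). Qed.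

Lemma wronskian_vu : wronskian v V u U x = - 1.
Proof.
rewrite /wronskian (fund_UC fd)// (fund_uC fd)// -(fund_W fd Ix) opprB.
by rewrite [u x * _]mulrC [U x * _]mulrC.
Qed.

End FundamentalWronskian.

Variables (lam : R) (u v : endpoint -> R -> R).
Hypothesis pairs : forall e, non_principal_pair l e lam (u e) (v e).

Let fd e := pair_fund (pairs e).

(* [X] and [Y] are the values of [Gamma_0] and [Gamma_1] at [f]. *)
Definition trace f F X Y : Prop := exists A B : endpoint -> R[i],
  [/\ forall e, boundary_data l e (u e) (v e) f F (A e) (B e),
      X = vec2 (- A Left) (- A Right) & Y = vec2 (- B Left) (B Right)].

Lemma trace_ex f F H : max_elem l f F H -> exists X Y, trace f F X Y.
Proof.
move=> [f1 f2 f3].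
have bd e := boundary_data_ex e (fd e) f1 f2 f3.
have [Aa [Ba ha]] := bd Left; have [Ab [Bb hb]] := bd Right.
eexists; eexists; exists (fun e => if e is Left then Aa else Ab).
by exists (fun e => if e is Left then Ba else Bb); split => // -[].
Qed.

Lemma trace_lin k f F X Y g G X' Y' : trace f F X Y -> trace g G X' Y' ->
  trace (fun x => k * f x + g x) (fun x => k * F x + G x) (k *: X + X') (k *: Y + Y').
Proof.
move=> [A [B [h1 -> ->]]] [A' [B' [h1' -> ->]]].
exists (fun e => k * A e + A' e), (fun e => k * B e + B' e); split.
- by move=> e; exact: boundary_data_lin.
- by apply: vec2P; rewrite !mxE /=; ring.
- by apply: vec2P; rewrite !mxE /=; ring.
Qed.

Lemma trace_maps f F H X Y : quasi_system l f F H -> trace f F X Y ->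
  Lambda l (v Left) (v Right) f = X /\ Gamma1 l (v Left) (v Right) f = Y.
Proof.
move=> fs [A [B [h -> ->]]]; split.
  by congr vec2; apply: lim_atE; exact: quotient_cvg (pairs _) (h _).
have br e : lim_at l e (bracket l f (toC (v e))) = B e.
  apply: lim_atE; have [_ ] := h e; apply: ccvg_eq => x Ix.
  by rewrite (bracketE fs (fund_v (fd e))).
by rewrite /Gamma1 !br.
Qed.

Lemma trace_green f F H X Y g G K X' Y' :
  max_elem l f F H -> trace f F X Y -> max_elem l g G K -> trace g G X' Y' ->
  hdot l H g - hdot l f K = dot2 Y X' - dot2 X Y'.
Proof.
move=> fm [A [B [h -> ->]]] gm [A' [B' [h' -> ->]]].
have [La [Lb [a b <-]]] := max_green fm gm.
rewrite (ccvg_unique a (wronskian_cvg (fd _) (h _) (h' _))).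
rewrite (ccvg_unique b (wronskian_cvg (fd _) (h _) (h' _))).
by rewrite !dot2E !vec2E !conjN; ring.
Qed.

(** A combination of the two left solutions attains the values at the left end. Those at the right
    end are corrected by a [solve] with zero data on the left, whose right data are inner products
    with the right solutions, prescribed by [fundamental_gram]. *)
Lemma trace_surj X Y : exists f F H, max_elem l f F H /\ trace f F X Y.
Proof.
have um := fundamental_max_u (fd Left); have vm := fundamental_max_v (fd Left).
(* At the left end both boundary values are brackets with a minus sign, so X v - Y u has the values
   X and Y; (X - 1) v + v stands for X v. *)
have wm := max_elem_lin (- Y 0 0) um (max_elem_lin (X 0 0 - 1) vm vm).
set f0 := (fun x => - Y 0 0 * _ + _) in wm; set F0 := (fun x => _ + _) in wm.
have [X0 [Y0 tr0]] := trace_ex wm; have [A0 [B0 [b0 X0E Y0E]]] := tr0.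
have A0E : A0 Left = - X 0 0.
  have [/ccvg_unique E _] := b0 Left; apply: E.
  apply: ccvg_eq (ccvg_cst l Left (- X 0 0)) => x Ix.
  by rewrite !wronskian_lin (wronskian_uu (fd _))// (wronskian_vu (fd _))//; ring.
have B0E : B0 Left = - Y 0 0.
  have [_ /ccvg_unique E] := b0 Left; apply: E.
  apply: ccvg_eq (ccvg_cst l Left (- Y 0 0)) => x Ix.
  by rewrite !wronskian_lin (wronskian_uv (fd _))// (wronskian_vv (fd _))//; ring.
have [a [b [hu hv]]] := fundamental_gram (fd Right) (- (X 1 0 - X0 1 0)) (Y 1 0 - Y0 1 0).
set h := fun x => _ + _ in hu hv.
have hh : hilb l h.
  by apply: hilb_lin; [exact: fund_hu (fd _)|exact/hilbM/(fund_hv (fd _))].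
have sm := solve_max Left (fd Left) hh.
have st : trace (solve l (toC (u Left)) (toC (v Left)) Left h)
    (solveq l (toC (u Left)) (qd (u Left)) (toC (v Left)) (qd (v Left)) Left h)
    (vec2 0 (X 1 0 - X0 1 0)) (vec2 0 (Y 1 0 - Y0 1 0)).
  exists (fun e => if e is Left then 0 else - (X 1 0 - X0 1 0)).
  exists (fun e => if e is Left then 0 else Y 1 0 - Y0 1 0); split.
  - case.
      by split; [exact: (solve_wronskian0 Left (fd Left) hh um)|
                 exact: (solve_wronskian0 Left (fd Left) hh vm)].
    have := solve_wronskian_opp Left (fd Left) hh (fundamental_max_u (fd Right)).
    have := solve_wronskian_opp Left (fd Left) hh (fundamental_max_v (fd Right)).
    by rewrite hu hv !mul1r.
  - by rewrite oppr0 opprK.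
  - by rewrite oppr0.
have M := max_elem_lin 1 wm sm.
eexists; eexists; eexists; split; first exact: M.
have -> : X = 1 *: X0 + vec2 0 (X 1 0 - X0 1 0).
  by apply: vec2P; rewrite !mxE /= X0E !vec2E ?A0E ?opprK; ring.
have -> : Y = 1 *: Y0 + vec2 0 (Y 1 0 - Y0 1 0).
  by apply: vec2P; rewrite !mxE /= Y0E !vec2E ?B0E ?opprK; ring.
exact: trace_lin.
Qed.

End BoundaryMaps.

(** * The form identity *)

Section Approximation.
Local Open Scope classical_set_scope.
Local Open Scope ring_scope.
Local Open Scope complex_scope.
Context {R : realType}.
Variable l : sturm_liouville R.
Notation mu := (@lebesgue_measure R).
Notation Re := complex.Re.
Notation Im := complex.Im.
Notation I := (interval_of l).
Notation p := (sl_p l).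
Notation w := (sl_w l).
Notation qd u := (quasi_derivative l (toC u)).
Implicit Types (f g h F G H K : R -> R[i]) (c d x y : R) (k z A B : R[i]).

Lemma ae_le_Rintegral (D : set (measurableTypeR R)) (a b : R -> R) : measurable D ->
  mu.-integrable D (EFin \o a) -> mu.-integrable D (EFin \o b) ->
  {ae mu, forall x, D x -> a x <= b x} ->
  (\int[mu]_(x in D) a x <= \int[mu]_(x in D) b x)%R.
Proof.
move=> mD ia ib ab; rewrite -subr_ge0 -RintegralB//.
have iba := integrableRB mD ib ia.
rewrite (@ae_Rintegral _ _ _ (fun x => `|b x - a x|))//.
- by apply: Rintegral_ge0.
- exact: integrable_measurable.
- by apply: integrable_measurable; exact: integrable_norm iba.
- by apply: aeS ab => x h Dx; rewrite ger0_norm// subr_ge0 h.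
Qed.

Lemma piece_opp_disjoint e x t s : ~ piece l e x t -> I t -> piece l (opp_end e) t s ->
  ~ piece l e x s.
Proof.
case: e => /= xt [at_ tb] ts xs; apply: xt; split => //.
  by case: ts xs => ts _ [_]; exact: le_trans.
by case: ts xs => _ ts [xs _]; exact: le_trans xs ts.
Qed.

Lemma piece_opp_self e x s : piece l (opp_end e) x s -> s != x -> ~ piece l e x s.
Proof.
case: e => /= h /eqP sx h'; apply: sx; apply/eqP; rewrite eq_le.
  by case: h h' => -> _ [_ ->].
by case: h h' => _ -> [-> _].
Qed.

Lemma hdot_real_le (k v g : R -> R[i]) (tau : R) : hilb l k -> hilb l v -> hilb l g ->
  (forall x, I x -> Im (k x) = 0) -> (forall x, I x -> Im (v x) = 0) ->
  (forall x, I x -> `|Re (k x) * Re (g x)| <= tau * (Re (k x) * Re (v x))) ->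
  `|Re (hdot l k g)| <= tau * Re (hdot l k v).
Proof.
move=> hk hv hg k0 v0 bnd.
have mI : measurable (I : set (measurableTypeR R)) := measurable_interval l.
have [i1 _] := hdot_integrable hk hg; have [i2 _] := hdot_integrable hk hv.
rewrite /hdot !Re_cintegral; apply: le_trans (le_normr_Rintegral mI i1) _.
rewrite -RintegralZl//; apply: ae_le_Rintegral => //; first exact: integrable_norm.
  exact: integrableRZ.
apply: aeS (w_gt0 l) => x w0 Ix; have {}w0 := w0 Ix.
rewrite !reimE k0// v0// !mul0r !mulr0 !subr0 normrM (gtr0_norm w0) mulrA ler_pM2r//.
exact: bnd.
Qed.

Lemma combination_wronskian (a b y Y z Z : R[i]) :
  (a * y + b * z) * Z - (a * Y + b * Z) * z = a * (y * Z - Y * z).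
Proof. by ring. Qed.

Lemma solve_real e lam (u U v V : R -> R[i]) (fd : fundamental l lam u U v V) h x :
  (forall t, I t -> Im (h t) = 0) -> I x -> Im (solve l u v e h x) = 0.
Proof.
move=> h0 Ix.
have Imf (g : R -> R[i]) : (forall t, I t -> conjc (g t) = g t) -> forall t, I t -> Im (g t) = 0.
  by move=> gC t It; have := congr1 (fun z => Im z) (gC t It); rewrite Im_conj; lra.
have Imp (g : R -> R[i]) : (forall t, I t -> conjc (g t) = g t) ->
    Im (cprimitive l e (fun t => h t * conjc (g t) * (w t)%:C) x) = 0.
  move=> gC; rewrite /cprimitive/= /primitive.
  rewrite (_ : (\int[mu]_(t in _) _)%R = (\int[mu]_(t in piece l e x) cst (0 : R) t)%R).
    by rewrite /Rintegral integral0 mulr0.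
  apply: eq_Rintegral => t /set_mem /(piece_sub Ix) It.
  by rewrite !reimE h0// Imf//; rewrite /=; ring.
rewrite /solve /coef_u /coef_v !reimE !Imp ?(Imf u) ?(Imf v) ?(fund_uC fd) ?(fund_vC fd)//.
- by ring.
- exact: fund_vC fd.
- exact: fund_uC fd.
- exact: fund_uC fd.
- exact: fund_vC fd.
Qed.

Variables (lam : R) (u v : R -> R) (e : endpoint) (c0 : R).
Hypothesis fd : fundamental l lam (toC u) (qd u) (toC v) (qd v).
Hypothesis Ic0 : I c0.
Hypothesis v0 : zero_free (piece l e c0) v.
Hypothesis iv : mu.-integrable (piece l e c0) (EFin \o (fun x => (p x * v x ^+ 2)^-1)).

Let hv : hilb l (toC v) := fund_hv fd.

Let cut x : R -> R[i] := toC (fun t => v t * \1_(piece l e x) t).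

(* The part of [v] near [e], scaled so that [hdot (bump x) g] is a weighted mean
   of the conjugate of [g / v] near [e]. *)
Definition bump x : R -> R[i] := fun t => ((hnorm2 l (cut x))^-1)%:C * cut x t.

Let Icut x : piece l e c0 x -> I x. Proof. exact: piece_sub. Qed.

Let cutE x t : piece l e x t -> cut x t = toC v t.
Proof. by move=> pt; rewrite /cut /toC indicE mem_set// mulr1. Qed.

Let cut0 x t : ~ piece l e x t -> cut x t = 0.
Proof. by move=> pt; rewrite /cut /toC indicE memNset// mulr0. Qed.

Let cut_hilb x : piece l e c0 x -> hilb l (cut x).
Proof.
move=> px; have [m1 m2 _] := hv.
have mp : measurable (piece l e x : set (measurableTypeR R)) by apply: measurable_piece; exact: Icut.
have mI : measurable (I : set (measurableTypeR R)) := measurable_interval l.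
refine (@sqr_int_dominated _ _ _ mI (@measurable_w _ l) 1 _ (toC v) (toC v) ler01 _ _ _ hv hv) => //=.
- by apply: measurable_funM => //; exact: measurable_indic.
- move=> t _; rewrite mul1r; have [pt|pt] := pselect (piece l e x t).
    by rewrite (cutE pt) lerDl nsq_ge0.
  by rewrite (cut0 pt) {1}/nsq /= expr0n /= addr0 addr_ge0 ?nsq_ge0.
Qed.

(** The piece contains a non-degenerate interval, and [v] has no zero on it. *)
Let cut_gt0 x : piece l e c0 x -> 0 < hnorm2 l (cut x).
Proof.
move=> px; have Ix := Icut px.
rewrite lt_neqAle hnorm2_ge0 ?andbT; last exact: cut_hilb.
apply/eqP => /esym /(hnorm2_eq0 (cut_hilb px)) z0.
have [c Ic [pc npc]] := piece_beyond e Ix.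
have null (s t : R) : s < t -> `[s, t]%classic `<=` piece l e x -> False.
  move=> st sub.
  have : mu.-negligible `[s, t]%classic.
    apply: negligibleS z0 => y ys h; have py := sub y ys.
    have := congr1 (fun z => Re z) (h (piece_sub Ix py)); rewrite (cutE py) /= => /eqP.
    by apply/negP/v0; exact: piece_trans px _ py.
  move=> nm; have : mu `[s, t]%classic = 0%E := (negligibleP mu (measurable_itv `[s, t])).1 nm; rewrite lebesgue_measure_itv/= lte_fin st.
  by rewrite -EFinB => -[] /eqP; rewrite subr_eq0 gt_eqF.
have : c != x by apply/eqP => cx; apply: npc; rewrite cx; exact: piece_refl.
rewrite neq_lt => /orP[] lt; apply: (null _ _ lt) => y /=; rewrite in_itv/= => /andP[h1 h2].
  exact: piece_between pc (piece_refl e Ix) h1 h2.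
exact: piece_between (piece_refl e Ix) pc h1 h2.
Qed.

Lemma bump_hilb x : piece l e c0 x -> hilb l (bump x).
Proof. by move=> px; apply: hilbM; exact: cut_hilb. Qed.

Lemma bump_real x t : Im (bump x t) = 0.
Proof. by rewrite /bump !reimE mulr0 mul0r addr0. Qed.

Lemma bump_out x t : ~ piece l e x t -> bump x t = 0.
Proof. by move=> pt; rewrite /bump cut0// mulr0. Qed.

Lemma bump_v x : piece l e c0 x -> hdot l (bump x) (toC v) = 1.
Proof.
move=> px; have hc := cut_hilb px.
rewrite hdotMl//; have -> : hdot l (cut x) (toC v) = hdot l (cut x) (cut x).
  congr cintegral; apply/funext => t; have [pt|pt] := pselect (piece l e x t).
    by rewrite cutE.
  by rewrite cut0// !mul0r.
by rewrite hdot_self// -rmorphM/= mulVf// gt_eqF// cut_gt0.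
Qed.

(** [bump x] is [v] times a non-negative weight, scaled so that its product with [v] is 1; it
    averages the conjugate of g / v. The factor 2 results from bounding the real and the imaginary
    part separately, the latter as the real part obtained for i g. *)
Lemma bump_le x g (tau : R) : piece l e c0 x -> hilb l g -> 
  (forall t, piece l e x t -> `|Re (g t)| <= tau * `|v t| /\ `|Im (g t)| <= tau * `|v t|) ->
  nsq (hdot l (bump x) g) <= 2 * tau ^+ 2.
Proof.
move=> px hg gv; have hb := bump_hilb px.
have main g' : hilb l g' -> (forall t, piece l e x t -> `|Re (g' t)| <= tau * `|v t|) ->
    Re (hdot l (bump x) g') ^+ 2 <= tau ^+ 2.
  move=> hg' bnd.
  have : `|Re (hdot l (bump x) g')| <= tau * Re (hdot l (bump x) (toC v)).
    apply: hdot_real_le => //; first by move=> *; exact: bump_real.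
    move=> t It; have [pt|pt] := pselect (piece l e x t); last first.
      by rewrite bump_out// !mul0r normr0 mulr0.
    rewrite /bump cutE// !reimE mulr0 subr0 -!mulrA normrM.
    have M0 : 0 <= (hnorm2 l (cut x))^-1 by rewrite invr_ge0 ltW// cut_gt0.
    rewrite (ger0_norm M0) [leRHS]mulrCA ler_wpM2l// normrM -expr2 -real_normK ?num_real//.
    by rewrite expr2 mulrCA ler_wpM2l// bnd.
  by rewrite bump_v// mulr1 ler_norml => /andP[h1 h2]; nra.
have h1 := main _ hg (fun t pt => (gv t pt).1).
have hig : hilb l (fun t => 'i%C * g t) by exact: hilbM.
have h2 : Im (hdot l (bump x) g) ^+ 2 <= tau ^+ 2.
  have E : Re (hdot l (bump x) (fun t => 'i%C * g t)) = Im (hdot l (bump x) g).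
    by rewrite hdotMr// ReM Re_conj Im_conj /= mul0r sub0r mulN1r opprK.
  rewrite -E; apply: main => // t pt.
  by rewrite !reimE/= mul0r mul1r sub0r normrN; have [] := gv t pt.
by rewrite /nsq; lra.
Qed.

(* [Gamma_1] of [peak x] is a fixed unit vector, although [peak x] tends to 0 in
   [L^2] as [x] tends to [e]. *)
Definition peak x := solve l (toC u) (toC v) (opp_end e) (bump x).
Definition peakq x := solveq l (toC u) (qd u) (toC v) (qd v) (opp_end e) (bump x).

Lemma peak_max x : piece l e c0 x ->
  max_elem l (peak x) (peakq x) (fun t => bump x t + lam%:C * peak x t).
Proof. by move=> px; apply: (solve_max _ fd); exact: bump_hilb. Qed.

Lemma peak_opp x g G K : piece l e c0 x -> max_elem l g G K ->
  ccvg l (opp_end e) (wronskian (peak x) (peakq x) g G) 0.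
Proof. by move=> px; apply: (solve_wronskian0 _ fd); exact: bump_hilb. Qed.

Lemma peak_end x : piece l e c0 x ->
  ccvg l e (wronskian (peak x) (peakq x) (toC v) (qd v)) (sgn_end (opp_end e))%:C.
Proof.
move=> px.
have := solve_wronskian_opp (opp_end e) fd (bump_hilb px) (fundamental_max_v fd).
by rewrite bump_v// mulr1 /peak /peakq; case: (e).
Qed.

Let peak_eq0 x t : I t ->
  (forall s, piece l (opp_end e) t s -> s != t -> ~ piece l e x s) -> peak x t = 0.
Proof.
move=> It out; have bump0 s : piece l (opp_end e) t s -> s != t -> bump x s = 0.
  by move=> ps st; rewrite bump_out//; exact: out.
by have [] := solve_eq0 (toC u) (qd u) (toC v) (qd v) It bump0.
Qed.

Lemma peak_out x t : I t -> ~ piece l e x t -> peak x t = 0.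
Proof. by move=> It pt; apply: peak_eq0 => // s ps _; exact: piece_opp_disjoint ps. Qed.

(** On the piece the quotient by [v] has derivative - a / (p v^2), where [a] is the coefficient of
    [u], and it vanishes at [x] because the bump lives beyond [x]. Integrating from [x] gives the
    bound. *)
Lemma peak_le x t : piece l e c0 x -> I t ->
  `|Re (peak x t)| <= (\int[mu]_(s in piece l e x) `|(p s * v s ^+ 2)^-1|)%R * `|v t| /\
  Im (peak x t) = 0.
Proof.
move=> px It; have Ix := Icut px; split; last first.
  by apply: (solve_real (opp_end e) fd) => // s _; exact: bump_real.
have mp : measurable (piece l e x : set (measurableTypeR R)) by exact: measurable_piece.
have [pt|pt] := pselect (piece l e x t); last first.
  by rewrite peak_out// normr0 mulr_ge0// Rintegral_ge0.
have px0 : piece l e x `<=` piece l e c0 by exact: piece_trans.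
have vx0 : zero_free (piece l e x) v by move=> s /px0 /v0.
have [[s1 _ s3 _] _ _] := peak_max px.
have [v1 _ v3 _] := fund_v fd.
have acv (y z : R) : I y -> I z -> abs_continuous y z v.
  by move=> Iy Iz; have [] := v1 y z Iy Iz.
pose a s := Re (coef_u l (toC v) (opp_end e) (bump x) s).
have ibv := hdot_integrable (bump_hilb px) hv.
(* [a] is a partial integral of bump times v times w, which is non-negative almost everywhere and
   has total integral 1. *)
have a1 s : I s -> `|a s| <= 1.
  move=> Is; apply: le_trans (primitive_bounded (opp_end e) Is ibv.1) _.
  rewrite (@ae_Rintegral _ _ _ (fun s => Re (bump x s * conjc (toC v s) * (w s)%:C))).
  - by rewrite -Re_cintegral -/(hdot l (bump x) (toC v)) bump_v.
  - exact: measurable_interval.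
  - by apply: integrable_measurable; exact: integrable_norm ibv.1.
  - exact: integrable_measurable ibv.1.
  apply: aeS (w_gt0 l) => y wy Iy; apply: ger0_norm.
  have bv : 0 <= Re (bump x y) * v y.
    have [py|py] := pselect (piece l e x y); last by rewrite bump_out// mul0r.
    rewrite /bump (cutE py) !reimE mulr0 subr0 -mulrA mulr_ge0//.
      by rewrite invr_ge0 ltW// cut_gt0.
    by rewrite -expr2 sqr_ge0.
  move: (bump x y) (bump_real x y) bv => b b0 bv.
  by rewrite !reimE b0 oppr0 !mulr0 !subr0 mulr_ge0// ltW// wy.
have wr s : I s -> Re (peak x s) * Re (qd v s) - Re (peakq x s) * v s = a s.
  move=> Is.
  have vC : Im (qd v s) = 0.
    by have := congr1 (fun z => Im z) (fund_VC fd Is); rewrite Im_conj; lra.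
  rewrite /a -(mulr1 (coef_u _ _ _ _ _)) -(fund_W fd Is).
  transitivity (Re (peak x s * qd v s - peakq x s * toC v s)).
    move: (peak x s) (peakq x s) (qd v s) vC => P Q V V0.
    by rewrite !reimE V0 !mulr0 !subr0.
  by congr Re; exact: combination_wronskian.
have iv' : mu.-integrable (piece l e x) (EFin \o (fun s => (p s * v s ^+ 2)^-1)).
  by apply: integrableS iv => //; exact: measurable_piece.
have iva : mu.-integrable (piece l e x) (EFin \o (fun s => - a s * (p s * v s ^+ 2)^-1)).
  apply: integrable_dominated (integrable_norm iv') => //.
    apply: measurable_funM; last exact: integrable_measurable.
    apply: measurableT_comp => //.
    have [ma _] := AC_loc_measurable (cprimitive_AC (opp_end e) ibv).
    by apply: measurable_funS ma => //; [exact: measurable_interval|exact: piece_sub].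
  by move=> s ps; rewrite normrM normrN ler_piMl// a1//; exact: piece_sub ps.
have acr (y z : R) : piece l e x y -> piece l e x z ->
    abs_continuous y z (fun s => Re (peak x s) / v s).
  move=> py pz; apply: abs_continuousM.
    by have [] := s1 y z (piece_sub Ix py) (piece_sub Ix pz).
  exact: (piece_abs_continuousV Ix vx0 acv py pz).
have dr : {ae mu, forall s, piece l e x s -> s != x ->
    derive1 (fun s => Re (peak x s) / v s) s = - a s * (p s * v s ^+ 2)^-1}.
  apply: aeS3 s3 v3 (p_gt0 l) => s h1 h2 h3 ps _; have Is := piece_sub Ix ps.
  have du : has_derive (fun s => Re (peak x s)) s (Re (peakq x s) * (p s)^-1).
    by rewrite -Re_mul_real; have [] := h1 Is.
  have dv : has_derive v s (Re (qd v s) * (p s)^-1).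
    by rewrite -Re_mul_real; have [] := h2 Is.
  have p0 := lt0r_neq0 (h3 Is).
  have vs0 := vx0 _ ps.
  have [_ ->] := has_deriveM du (has_deriveV vs0 dv).
  by rewrite (quotient_derive_eq _ _ _ p0 vs0) wr.
have := piece_variation Ix acr iva dr pt (piece_refl e Ix).
have -> : peak x x = 0.
  by apply: peak_eq0 => // s ps sx; exact: piece_opp_self.
rewrite mul0r subr0 normrM normfV ler_pdivrMr ?normr_gt0 ?vx0// => /le_trans; apply.
rewrite ler_wpM2r//; apply: le_Rintegral => //; try exact: integrable_norm.
by move=> s ps; rewrite normrM normrN ler_piMl// a1//; exact: piece_sub ps.
Qed.

End Approximation.

(** * Real sequences that are eventually below every positive number *)

Section Vanishing.
Local Open Scope ring_scope.
Context {R : realType}.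
Implicit Types (a b : nat -> R).

(** Only the upper bound is asked for; the sequences to which this is applied are non-negative, such
    as squared norms. *)
Definition vanishing a : Prop :=
  forall eps : R, 0 < eps -> exists N : nat, forall n, (N <= n)%N -> a n < eps.

Lemma vanishing_le (C : R) a b : 0 <= C -> (forall n, b n <= C * a n) ->
  vanishing a -> vanishing b.
Proof.
move=> C0 ba va eps e0; have C1 : 0 < C + 1 by rewrite ltr_wpDl.
have [N NP] := va (eps / (C + 1)) (divr_gt0 e0 C1); exists N => n /NP.
rewrite ltr_pdivlMr// => an; apply: le_lt_trans (ba n) _.
have [a0|a0] := leP 0 (a n); first by apply: le_lt_trans an; rewrite mulrC mulrDr mulr1 lerDl.
by apply: le_lt_trans e0; rewrite mulr_ge0_le0// ltW.
Qed.

Lemma vanishingD a b : vanishing a -> vanishing b -> vanishing (fun n => a n + b n).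
Proof.
move=> va vb eps e0; have e2 : 0 < eps / 2 by rewrite divr_gt0.
have [N NP] := va _ e2; have [M MP] := vb _ e2; exists (maxn N M) => n.
by rewrite geq_max => /andP[/NP h1 /MP h2]; lra.
Qed.

Lemma vanishing_cst (x : R) : vanishing (fun=> x) -> x <= 0.
Proof. by move=> vx; rewrite leNgt; apply/negP => /vx[N /(_ N (leqnn N))]; rewrite ltxx. Qed.

End Vanishing.

(** * Integration by parts for the form *)

Section FormGreen.
Local Open Scope classical_set_scope.
Local Open Scope ring_scope.
Local Open Scope complex_scope.
Context {R : realType}.
Variable l : sturm_liouville R.
Notation mu := (@lebesgue_measure R).
Notation Re := complex.Re.
Notation Im := complex.Im.
Notation I := (interval_of l).
Notation p := (sl_p l).
Implicit Types (f g h F G H K : R -> R[i]) (c d x y : R) (k z A B : R[i]) (e : endpoint)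
  (X Y : 'cV[R[i]]_2).

(** Cauchy-Schwarz for a possibly degenerate form. Non-negativity is used at f - s(f, g) / (1 + s(g,
    g)) g; the summand 1 avoids a division by zero and reappears in the bound. *)
Lemma semidefinite_cauchy (D : set (R -> R[i])) (s : (R -> R[i]) -> (R -> R[i]) -> R[i]) :
  Defs.subspace D ->
  (forall k f f' g, D f -> D f' -> D g ->
    s (fun x => k * f x + f' x) g = k * s f g + s f' g) ->
  (forall f g, D f -> D g -> s g f = conjc (s f g)) ->
  (forall f, D f -> 0 <= Re (s f f)) ->
  forall f g, D f -> D g -> nsq (s f g) <= (1 + Re (s g g)) * Re (s f f).
Proof.
move=> [_ Dlin] slin sherm spos f g Df Dg.
have pos k : 0 <= nsq k * Re (s g g) + 2 * Re (k * conjc (s f g)) + Re (s f f).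
  have Dh := Dlin k _ _ Dg Df; have := spos _ Dh.
  rewrite slin//; have -> : s g (fun x => k * g x + f x) = conjc (k * s g g + s f g).
    by rewrite -slin// -sherm.
  have -> : s f (fun x => k * g x + f x) = conjc (k * conjc (s f g) + s f f).
    by rewrite -sherm// -slin// -sherm.
  congr (_ <= _); case: k {Dh} (s f g) (s g g) (s f f) => [a b] [c1 c2] [d1 d2] [e1 e2].
  by rewrite /nsq/=; ring.
have G0 := spos _ Dg.
have := pos ((- (1 + Re (s g g))^-1)%:C * s f g).
have t0 : 0 < 1 + Re (s g g) by lra.
rewrite -[_ * _ * conjc _]mulrA mul_conj -rmorphM Re_real nsqM nsq_real sqrrN.
move: (nsq_ge0 (s f g)); rewrite -(ler_pdivrMl _ _ t0).
move: (nsq (s f g)) (Re (s g g)) (Re (s f f)) G0 t0 => N G F G0 t0 N0 h.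
have tt : (1 + G)^-1 * (1 + G) = 1 by rewrite mulVf// gt_eqF.
have ti : 0 < (1 + G)^-1 by rewrite invr_gt0.
move: ((1 + G)^-1) tt ti h => a tt ti h.
have : a ^+ 2 * N * G <= a * N.
  have -> : a * N = (a * (1 + G)) * (a * N) by rewrite tt mul1r.
  have aN : 0 <= a ^+ 2 * N by rewrite mulr_ge0 ?sqr_ge0.
  by nra.
by lra.
Qed.

Lemma Re_subDM (a b b' : R[i]) (m : R) :
  Re (a - b + m%:C * b') = Re a - Re b + m * Re b'.
Proof. by rewrite !reimE mul0r subr0. Qed.

Lemma norm_scale_diff (a b : R[i]) (m : R) :
  `|Re (- (a - b) * m%:C)| = `|Re a - Re b| * `|m| /\
  `|Im (- (a - b) * m%:C)| = `|Im a - Im b| * `|m|.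
Proof.
by rewrite !(ReM, ImM, Re_real, Im_real, ReN, ImN, ReD, ImD) !mulr0 subr0 add0r !normrM !normrN.
Qed.

Lemma nsqN k : nsq (- k) = nsq k. Proof. by rewrite /nsq ReN ImN !sqrrN. Qed.

Lemma fval_diff_eq k (a b b' y y' : R[i]) :
  a - b - k * y - (a - b' - k * y') = b' - b + k * (y' - y).
Proof. by ring. Qed.

Lemma shift_diff_eq (a b b' : R[i]) : -1 * b + a - (-1 * b' + a) = b' - b.
Proof. by ring. Qed.

Lemma Re_subM (a b : R[i]) (m : R) : Re (a - m%:C * b) = Re a - m * Re b.
Proof. by rewrite !reimE mul0r subr0. Qed.

Lemma hdot_cauchy f g : hilb l f -> hilb l g ->
  nsq (hdot l f g) <= (1 + hnorm2 l g) * hnorm2 l f.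
Proof.
apply: semidefinite_cauchy => //.
- by split; [exact: hilb0|move=> k f1 f2; exact: hilb_lin].
- by move=> k f1 f2 h h1 h2 h3; exact: hdot_lin.
- exact: hdotC.
- exact: hnorm2_ge0.
Qed.

Lemma hnorm2_le (C : R) f g : hilb l f -> hilb l g ->
  (forall x, I x -> nsq (f x) <= C * nsq (g x)) -> hnorm2 l f <= C * hnorm2 l g.
Proof.
move=> hf hg fg; have mI : measurable (I : set (measurableTypeR R)) := measurable_interval l.
have [_ _ i1] := hf; have [_ _ i2] := hg.
rewrite !hnorm2_integral -RintegralZl//; apply: ae_le_Rintegral => //.
  exact: integrableRZ.
apply: aeS (w_gt0 l) => x w0 Ix; have {}w0 := w0 Ix.
by rewrite mulrA ler_pM2r// fg.
Qed.

Variable t : sesq_form R.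
Hypothesis t_closed : closed_semibounded_form l t.

Let t_hilb f : fdom t f -> hilb l f.
Proof. by move=> tf; have [[[h _] _ _ _ _] _ _] := t_closed; exact: h. Qed.

Let t_lin k f g : fdom t f -> fdom t g -> fdom t (fun x => k * f x + g x).
Proof. by move=> tf tg; have [[[_ [_ h]] _ _ _ _] _ _] := t_closed; exact: h. Qed.

Let fval_lin k f f' g : fdom t f -> fdom t f' -> fdom t g ->
  fval t (fun x => k * f x + f' x) g = k * fval t f g + fval t f' g.
Proof. by have [[_ _ _ h _] _ _] := t_closed; exact: h. Qed.

Let t_sub f g : fdom t f -> fdom t g -> fdom t (fun x => f x - g x).
Proof.
move=> tf tg; rewrite (_ : (fun x => _) = fun x => -1 * g x + f x); first exact: t_lin.
by apply/funext => x; rewrite mulN1r addrC.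
Qed.

Let fvalB f f' g : fdom t f -> fdom t f' -> fdom t g ->
  fval t (fun x => f x - f' x) g = fval t f g - fval t f' g.
Proof.
move=> tf tf' tg; rewrite -[in RHS](addrC (- _)) -mulN1r -fval_lin//.
by congr fval; apply/funext => x; rewrite mulN1r addrC.
Qed.

(** Subtracting [m] times the inner product, with [m] a lower bound of [t], gives a non-negative
    form. Cauchy-Schwarz for it and for the inner product bounds the difference by [form_dist] and
    the squared norm, with coefficients [A] and [B]. *)
Lemma fval_cvg (f_ : nat -> R -> R[i]) f g : (forall n, fdom t (f_ n)) -> fdom t f ->
  vanishing (fun n => hnorm2 l (fun x => f_ n x - f x)) ->
  vanishing (fun n => form_dist t (f_ n) f) -> fdom t g ->
  vanishing (fun n => nsq (fval t (f_ n) g - fval t f g)).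
Proof.
move=> tf_ tf van1 van2 tg.
have [[[_ [h0 hlin]] _ _ _ herm] [m mP] _] := t_closed.
pose s f g := fval t f g - m%:C * hdot l f g.
have s_ge0 f' : fdom t f' -> 0 <= Re (s f' f').
  by move=> tf'; rewrite /s Re_subM subr_ge0; exact: mP.
have cauchy := @semidefinite_cauchy (fdom t) s.
have {}cauchy f1 f2 : fdom t f1 -> fdom t f2 -> nsq (s f1 f2) <= (1 + Re (s f2 f2)) * Re (s f1 f1).
  apply: cauchy => //.
  - move=> k a b c' ta tb tc; rewrite /s fval_lin// hdot_lin//; [ring|exact: t_hilb..].
  - by move=> a b ta tb; rewrite /s herm// (hdotC (t_hilb ta) (t_hilb tb)) conjD conjN conjM conj_real.
have sg := s_ge0 _ tg; have ng := hnorm2_ge0 (t_hilb tg).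
pose A := 2 * (1 + Re (s g g)); pose B := 2 * ((1 + Re (s g g)) * `|m| + m ^+ 2 * (1 + hnorm2 l g)).
have vanA : vanishing (fun n => A * form_dist t (f_ n) f).
  by apply: (@vanishing_le _ A) van2 => //; rewrite /A; lra.
have vanB : vanishing (fun n => B * hnorm2 l (fun x => f_ n x - f x)).
  apply: (@vanishing_le _ B) van1 => //.
  by rewrite /B mulr_ge0// addr_ge0// mulr_ge0 ?sqr_ge0//; lra.
apply: (@vanishing_le _ 1) (vanishingD vanA vanB) => // n.
rewrite mul1r -fvalB//; set d := (fun x => _ - _).
have td : fdom t d by exact: t_sub.
have c1 := cauchy _ _ td tg; have c2 := hdot_cauchy (t_hilb td) (t_hilb tg).
have -> : fval t d g = s d g + m%:C * hdot l d g by rewrite /s subrK.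
apply: le_trans (nsqD _ _) _; rewrite nsqM nsq_real /A /B -/(form_dist t (f_ n) f).
have sd : Re (s d d) <= form_dist t (f_ n) f + `|m| * hnorm2 l d.
  rewrite /s Re_subM -/(hnorm2 l d) /form_dist -/d.
  have := ler_norm (Re (fval t d d)); have := ler_norm (- m); rewrite normrN.
  have := hnorm2_ge0 (t_hilb td); nra.
have nd := hnorm2_ge0 (t_hilb td).
have h1 : nsq (s d g) <= (1 + Re (s g g)) * (form_dist t (f_ n) f + `|m| * hnorm2 l d).
  by apply: le_trans c1 _; rewrite ler_wpM2l//; lra.
have h2 : m ^+ 2 * nsq (hdot l d g) <= m ^+ 2 * ((1 + hnorm2 l g) * hnorm2 l d).
  by rewrite ler_wpM2l// sqr_ge0.
by lra.
Qed.

Variables (lam : R) (u v : endpoint -> R -> R).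
Hypothesis pairs : forall e, non_principal_pair l e lam (u e) (v e).
Hypothesis t_AC : forall g, fdom t g -> AC_loc l g.
Hypothesis t_cvg : forall e g, fdom t g -> exists z, ccvg l e (fun x => g x / (v e x)%:C) z.
Hypothesis t_A0 : form_operator l t = A_0 l (v Left) (v Right).

Notation Lam := (Lambda l (v Left) (v Right)).
Notation trace := (trace l u v).

(* [f] has a representative in the form domain for which integration by parts
   produces [H] and the boundary term [Y]. *)
Definition form_green f H Y : Prop := exists f0, [/\ fdom t f0,
  forall x, I x -> f x = f0 x &
  forall g, fdom t g -> fval t f0 g = hdot l H g - dot2 Y (Lam g)].

Lemma form_green_lin k f H Y f' H' Y' : hilb l H -> hilb l H' ->
  form_green f H Y -> form_green f' H' Y' ->
  form_green (fun x => k * f x + f' x) (fun x => k * H x + H' x) (k *: Y + Y').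
Proof.
move=> hH hH' [f0 [t0 E0 g0]] [f1 [t1 E1 g1]].
exists (fun x => k * f0 x + f1 x); split; first exact: t_lin.
  by move=> x Ix; rewrite E0// E1.
move=> g tg; rewrite fval_lin// g0// g1// hdot_lin// ?dot2_lin; last exact: t_hilb.
by ring.
Qed.

(** The link between [t] and A_0. It yields an element of the form domain equal to [f] almost
    everywhere; both are locally absolutely continuous, so they agree on the interval. *)
Lemma form_green_A_0 f F H X : max_elem l f F H -> trace f F X 0 -> form_green f H 0.
Proof.
move=> [fs hf hH] tr.
have : A_0 l (v Left) (v Right) (f, H).
  split => //=; exists f; split; last first.
  - by apply: aeS (ellE fs) => x h Ix; rewrite h.
  - exact/aeW.
  - by split; [exact: quasi_system_D_max fs hf hH|have [_ ->] := trace_maps pairs fs tr].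
rewrite -t_A0 => -[_ _ [f0 /= [tf0 E0 g0]]]; exists f0; split => //.
  by have [f1 _ _ _] := fs; exact: AC_loc_eq f1 (t_AC tf0) E0.
by move=> g tg; rewrite g0// dot20l subr0.
Qed.

Definition unit2 e : 'cV[R[i]]_2 := if e is Left then vec2 1 0 else vec2 0 1.

Lemma peak_form_green e : exists r q H X,
  [/\ max_elem l r q H, trace r q X (unit2 e) & form_green r H (unit2 e)].
Proof.
have fd := pair_fund (pairs e).
have [c0 [Ic0 v0 iv]] := pair_free (pairs e).
have [x_ [Ix_ cof]] := cofinal_seq l e; have [N0 N0P] := cof _ Ic0.
pose y n := x_ (N0 + n)%N.
have py n : piece l e c0 (y n) by apply: N0P; rewrite leq_addr.
have ycof c : I c -> exists N, forall n, (N <= n)%N -> piece l e c (y n).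
  by move=> /cof[N NP]; exists N => n Nn; apply: NP; exact: leq_trans Nn (leq_addl _ _).
pose k n := bump l (v e) e (y n).
pose r n := peak l (u e) (v e) e (y n).
pose q n := peakq l (u e) (v e) e (y n).
pose H n := fun s => k n s + lam%:C * r n s.
have hv := fund_hv fd.
have hk n : hilb l (k n) by exact: (bump_hilb fd Ic0 (py n)).
have rm n : max_elem l (r n) (q n) (H n) by exact: (peak_max fd Ic0 (py n)).
have hr n : hilb l (r n) by have [] := rm n.
have hH n : hilb l (H n) by have [] := rm n.
have tr n : exists X, trace (r n) (q n) X (unit2 e).
  have [X [Y tr]] := trace_ex pairs (rm n); have [A [B [bd _ YE]]] := tr.
  suff -> : unit2 e = Y by exists X.
  (* At the left end the bracket is - 1 and Gamma_1 changes its sign; at the right end the bracket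
     is 1 and is kept. *)
  have be := ccvg_unique (bd e).2 (peak_end fd Ic0 v0 (py n)).
  have bo := ccvg_unique (bd (opp_end e)).2
    (peak_opp fd Ic0 (py n) (fundamental_max_v (pair_fund (pairs (opp_end e))))).
  by rewrite YE /unit2; move: be bo; case: (e) => /= -> ->; rewrite ?oppr0 ?rmorphN ?opprK.
pose tau n := (\int[mu]_(s in piece l e (y n)) `|(p s * v e s ^+ 2)^-1|)%R.
have tau_ge0 n : 0 <= tau n by exact: Rintegral_ge0.
have van_tau : vanishing tau.
  move=> eps e0; have /end_filterP[c Ic cP] := piece_tail Ic0 iv e0.
  by have [N NP] := ycof _ Ic; exists N => n /NP /cP[_].
have rle n s : I s -> `|Re (r n s)| <= tau n * `|v e s| /\ Im (r n s) = 0.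
  exact: (peak_le fd Ic0 v0 iv (py n)).
have nsq_le (C : R) a b : `|a| <= C * `|b| -> a ^+ 2 <= C ^+ 2 * b ^+ 2 :> R.
  move=> ab; rewrite -[leLHS]real_normK ?num_real// -[b ^+ 2]real_normK ?num_real//.
  by rewrite -exprMn ler_sqr// nnegrE// (le_trans _ ab).
have van_tau2 : vanishing (fun n => tau n ^+ 2).
  move=> eps e0; have d0 : 0 < Num.min 1 eps by rewrite lt_min ltr01.
  have [N NP] := van_tau _ d0.
  by exists N => n /NP; rewrite lt_min => /andP[h1 h2]; have := tau_ge0 n; nra.
have van_r : vanishing (fun n => hnorm2 l (r n)).
  apply: (@vanishing_le _ (hnorm2 l (toC (v e)))) van_tau2; first exact: hnorm2_ge0.
  move=> n; rewrite mulrC; apply: hnorm2_le => // s Is; have [r1 r2] := rle n s Is.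
  by rewrite {1}/nsq r2 nsq_real expr0n addr0 nsq_le.
(* All r_n have the same Gamma_1, so r_0 - r_n is in the domain of A_0; [f_ n] will be its
   representative in the form domain. *)
have dif n : form_green (fun x => -1 * r n x + r 0%N x) (fun x => -1 * H n x + H 0%N x) 0.
  have [X0 tr0] := tr 0%N; have [Xn trn] := tr n.
  have := trace_lin (-1) trn tr0; rewrite !scaleN1r addNr.
  exact: form_green_A_0 (max_elem_lin (-1) (rm n) (rm 0%N)).
have [f_ fP] := choice dif.
have tf n : fdom t (f_ n) by have [] := fP n.
have van1 : vanishing (fun n => hnorm2 l (fun x => f_ n x - r 0%N x)).
  apply: (@vanishing_le _ 1) van_r => // n; apply: hnorm2_le => //.
    by apply: hilbB => //; exact: t_hilb.
  move=> x Ix; have [_ <- // _] := fP n.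
  by rewrite mul1r mulN1r addrK nsqN.
have fval_f n g : fdom t g ->
    fval t (f_ n) g = hdot l (H 0%N) g - hdot l (k n) g - lam%:C * hdot l (r n) g.
  move=> tg; have hg := t_hilb tg; have [_ _ ->//] := fP n.
  rewrite dot20l subr0 hdot_lin// [hdot l (H n) g]hdotDl//; last exact: hilbM.
  by rewrite hdotMl//; ring.
(* For D = r_m - r_n the form is <k_m, D> - <k_n, D> + lam |D|^2. As |D| <= T |v| with T = tau n +
   tau m, each of the two means is at most 2 T, and |D|^2 is at most T^2 |v|^2. *)
have form_dist_le n m : form_dist t (f_ n) (f_ m) <=
    4 * (tau n + tau m) + `|lam| * ((tau n + tau m) ^+ 2 * hnorm2 l (toC (v e))).
  rewrite /form_dist; set D := fun x => _ - _; set T := tau n + tau m.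
  have tD : fdom t D by exact: t_sub.
  have hD := t_hilb tD.
  have DE s : I s -> D s = r m s - r n s.
    move=> Is; have [_ En _] := fP n; have [_ Em _] := fP m.
    transitivity (f_ n s - f_ m s) => //; rewrite -En// -Em//; exact: shift_diff_eq.
  have fvalD : fval t D D = fval t (f_ n) D - fval t (f_ m) D by exact: fvalB.
  clearbody D.
  have Dle s : I s -> `|Re (D s)| <= T * `|v e s| /\ Im (D s) = 0.
    move=> Is; rewrite DE//; have [n1 n2] := rle n s Is; have [m1 m2] := rle m s Is.
    rewrite ReD ReN ImD ImN n2 m2 subrr; split=> //.
    by apply: le_trans (ler_normB _ _) _; rewrite /T mulrDl addrC lerD.
  have T0 : 0 <= T by rewrite addr_ge0.
  have kD j : `|Re (hdot l (k j) D)| <= 2 * T.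
    have : nsq (hdot l (k j) D) <= 2 * T ^+ 2.
      apply: (bump_le fd Ic0 v0 (py j)) => // s ps.
      have Is := piece_sub (piece_sub Ic0 (py j)) ps.
      by have [h1 ->] := Dle s Is; rewrite normr0 mulr_ge0.
    rewrite /nsq; move: (Re _) (Im _) => a b ab.
    by rewrite ler_norml; apply/andP; split; nra.
  have nD : hnorm2 l D <= T ^+ 2 * hnorm2 l (toC (v e)).
    apply: hnorm2_le => // s Is; have [h1 h2] := Dle s Is.
    by rewrite {1}/nsq h2 nsq_real expr0n addr0 nsq_le.
  have -> : fval t D D = hdot l (k m) D - hdot l (k n) D + lam%:C * hdot l D D.
    have -> : hdot l D D = hdot l (r m) D - hdot l (r n) D.
      rewrite -hdotBl//; apply: hdot_ae => //; first exact: hilbB.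
        by apply/aeW => s Is; rewrite DE.
      exact/aeW.
    by rewrite fvalD !fval_f//; exact: fval_diff_eq.
  rewrite Re_subDM -/(hnorm2 l D).
  have := kD m; have := kD n; move: (Re _) (Re _) => a b ha hb.
  apply: le_trans (ler_normD _ _) _; apply: lerD.
    by apply: le_trans (ler_normB _ _) _; lra.
  by rewrite normrM ler_wpM2l// ger0_norm// hnorm2_ge0.
have van2 : forall eps : R, 0 < eps -> exists N, forall n m,
    (N <= n)%N -> (N <= m)%N -> form_dist t (f_ n) (f_ m) < eps.
  (* When each tau is below 1/2 their sum is at most 1 and dominates its square, so the estimate
     becomes linear with constant [C]. *)
  pose C := 4 + `|lam| * hnorm2 l (toC (v e)).
  have V0 := hnorm2_ge0 hv.
  have C0 : 0 < C by rewrite ltr_pwDl// mulr_ge0.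
  move=> eps e0; have d0 : 0 < Num.min (1 / 2) (eps / (2 * C)).
    by rewrite lt_min !divr_gt0// mulr_gt0.
  have [N NP] := van_tau _ d0; exists N => n m /NP h1 /NP h2.
  apply: le_lt_trans (form_dist_le n m) _.
  move: h1 h2; rewrite !lt_min !ltr_pdivlMr ?mulr_gt0// => /andP[n1 n2] /andP[m1 m2].
  have T0 : 0 <= tau n + tau m by rewrite addr_ge0.
  have T1 : (tau n + tau m) ^+ 2 <= tau n + tau m.
    by move: T0 n1 m1; move: (tau n) (tau m) => a b T0 n1 m1; nra.
  apply: (@le_lt_trans _ _ ((tau n + tau m) * C)).
    have := mulr_ge0 (mulr_ge0 (normr_ge0 lam) V0) (_ : 0 <= tau n + tau m - (tau n + tau m) ^+ 2).
    rewrite subr_ge0 => /(_ T1); rewrite /C.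
    move: (hnorm2 _ _) `|lam| (tau n + tau m) => V L T; nra.
  by move: n2 m2; move: (tau n) (tau m) => x1 x2; lra.
have [[_ _ _ _ _] _ closed] := t_closed.
have [f0 [tf0 E0 van3]] := closed _ _ tf (hr 0%N) van1 van2.
have E0' : forall x, I x -> r 0%N x = f0 x.
  by have [[r1 _ _ _] _ _] := rm 0%N; exact: AC_loc_eq r1 (t_AC tf0) E0.
have [X tr0] := tr 0%N.
exists (r 0%N), (q 0%N), (H 0%N), X; split => //; exists f0; split => // g tg.
have hg := t_hilb tg.
have [z zc] := t_cvg e tg.
have -> : dot2 (unit2 e) (Lam g) = conjc z.
  rewrite dot2E /unit2 /Lambda !vec2E; move: zc; case: (e) => zc.
    by rewrite !vec2E (lim_atE zc) mul1r mul0r addr0.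
  by rewrite !vec2E (lim_atE zc) mul1r mul0r add0r.
(* Because <k_n, v> = 1, the difference is <k_n, g - z v>, a mean of the conjugate of g / v - z near
   [e]. The bounds 1 and eps / 4 on [d] give 2 d^2 <= eps / 2. *)
have van_k : vanishing (fun n => nsq (hdot l (k n) g - conjc z)).
  move=> eps e0; have d0 : 0 < Num.min 1 (eps / 4) by rewrite lt_min ltr01 divr_gt0.
  set d := Num.min _ _ in d0.
  have [/cvgrPdist_lt/(_ _ d0)/end_filterP[c Ic cP]
        /cvgrPdist_lt/(_ _ d0)/end_filterP[c' Ic' cP']] := zc.
  have [N NP] := ycof _ Ic; have [N' NP'] := ycof _ Ic'.
  exists (maxn N N') => n; rewrite geq_max => /andP[/NP yc /NP' yc'].
  have hzv : hilb l (fun s => z * toC (v e) s) by exact: hilbM.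
  have -> : hdot l (k n) g - conjc z = hdot l (k n) (fun s => g s - z * toC (v e) s).
    by rewrite hdotBr// hdotMr// (bump_v fd Ic0 v0 (py n)) mulr1.
  have dle : nsq (hdot l (k n) (fun s => g s - z * toC (v e) s)) <= 2 * d ^+ 2.
    apply: (bump_le fd Ic0 v0 (py n)); first exact: hilbB.
    move=> s ps; have vs := v0 _ (piece_trans (py n) ps).
    have vs0 : (v e s)%:C != 0 by rewrite (inj_eq (@complexI _)) vs.
    have h1 := cP _ (piece_trans yc ps); have h2 := cP' _ (piece_trans yc' ps).
    have -> : g s - z * toC (v e) s = - (z - g s / (v e s)%:C) * (v e s)%:C.
      by rewrite opprB mulrBl divfK.
    move: (g s / _) h1 h2 => b h1 h2.
    have [-> ->] := norm_scale_diff z b (v e s).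
    by split; rewrite ler_wpM2r// ltW.
  apply: le_lt_trans dle _.
  have d1 : d <= 1 by rewrite /d ge_min lexx.
  have d4 : d <= eps / 4 by rewrite /d ge_min lexx orbT.
  by nra.
have van_rg : vanishing (fun n => nsq (lam%:C * hdot l (r n) g)).
  apply: (@vanishing_le _ (lam ^+ 2 * (1 + hnorm2 l g))) van_r.
    by rewrite mulr_ge0 ?sqr_ge0// addr_ge0// hnorm2_ge0.
  by move=> n; rewrite nsqM nsq_real -mulrA ler_wpM2l ?sqr_ge0//; exact: hdot_cauchy.
have van_f := fval_cvg tf tf0 _ van3 tg.
have {}van_f : vanishing (fun n => nsq (fval t (f_ n) g - fval t f0 g)).
  apply: van_f; apply: (@vanishing_le _ 1) van1 => // n; rewrite mul1r.
  rewrite -[leRHS]mul1r; apply: hnorm2_le; do ?[by apply: hilbB => //; exact: t_hilb].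
  by move=> x Ix; rewrite E0'// mul1r.
(* The squared modulus of the defect in the identity does not depend on n and is bounded by
   vanishing sequences, so it is 0. *)
apply/eqP; rewrite -subr_eq0; apply/eqP/nsq_eq0/le_anti; rewrite nsq_ge0 andbT.
apply: vanishing_cst; apply: (@vanishing_le _ 4) (vanishingD van_f (vanishingD van_k van_rg)) => // n.
have -> : fval t f0 g - (hdot l (H 0%N) g - conjc z) =
    - (fval t (f_ n) g - fval t f0 g) - (hdot l (k n) g - conjc z + lam%:C * hdot l (r n) g).
  by rewrite fval_f//; ring.
move: (fval t (f_ n) g - _) (hdot l (k n) g - _) (lam%:C * _) => a b b'.
have := nsqD (- a) (- (b + b')); have := nsqD b b'; rewrite !nsqN.
by have := nsq_ge0 a; lra.
Qed.

(** Multiples of the two peaks are subtracted until Gamma_1 is 0, where A_0 gives the identity, and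
    are added back by linearity. *)
Lemma max_form_green f F H X Y : max_elem l f F H -> trace f F X Y -> form_green f H Y.
Proof.
move=> fm tr.
have [ra [qa [Ha [Xa [am at_ ag]]]]] := peak_form_green Left.
have [rb [qb [Hb [Xb [bm bt bg]]]]] := peak_form_green Right.
have hm := max_elem_lin (- Y 0 0) am (max_elem_lin (- Y 1 0) bm fm).
have ht := trace_lin (- Y 0 0) at_ (trace_lin (- Y 1 0) bt tr).
have Y0 : - Y 0 0 *: unit2 Left + (- Y 1 0 *: unit2 Right + Y) = 0.
  by apply: vec2P; rewrite !mxE /=; ring.
rewrite Y0 in ht; have hg := form_green_A_0 hm ht.
have [_ _ ha] := am; have [_ _ hb] := bm; have [_ _ hh] := hm.
have := form_green_lin (Y 0 0) ha _ ag (form_green_lin (Y 1 0) hb hh bg hg).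
move=> /(_ (hilb_lin (Y 1 0) hb hh)); rewrite addr0.
congr form_green; last by apply: vec2P; rewrite !mxE /=; ring.
  by apply/funext => x; ring.
by apply/funext => x; ring.
Qed.

End FormGreen.

(** * The boundary relation of an extension *)

Section Perturbation.
Local Open Scope classical_set_scope.
Local Open Scope ring_scope.
Local Open Scope complex_scope.
Context {R : realType}.
Variable l : sturm_liouville R.
Notation I := (interval_of l).
Implicit Types (f g h F G H K : R -> R[i]) (k z A B : R[i]) (e : endpoint)
  (X Y : 'cV[R[i]]_2).

Lemma dot2M k X Y : dot2 (k *: X) Y = k * dot2 X Y.
Proof. by rewrite -[k *: X]addr0 dot2_lin dot20l addr0. Qed.

Lemma dot2_self_neq0 X : X != 0 -> dot2 X X != 0.
Proof. by apply: contra => /eqP /dot2_eq0 ->. Qed.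

(** [Y] and [Y'] are annihilated by the same non-zero vector, the conjugate of [X], so their
    determinant is 0. *)
Lemma orthogonal_line X Y Y' : X != 0 -> Y' != 0 -> dot2 Y X = 0 -> dot2 Y' X = 0 ->
  exists k, Y = k *: Y'.
Proof.
move=> X0 Y0; rewrite !dot2E.
set a := conjc (X 0 0); set b := conjc (X 1 0) => h h'.
have ab : (a != 0) || (b != 0).
  rewrite -negb_and; apply: contra X0 => /andP[/eqP a0 /eqP b0]; apply/eqP.
  by apply: vec2P; rewrite mxE -[LHS]conjK -/a -/b ?a0 ?b0 conj0.
have cross : Y 0 0 * Y' 1 0 = Y 1 0 * Y' 0 0.
  apply/eqP; rewrite -subr_eq0; case/orP: ab => n0.
    rewrite -(mulIr_eq0 _ (mulIf n0)).
    have -> : (Y 0 0 * Y' 1 0 - Y 1 0 * Y' 0 0) * a =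
      (Y 0 0 * a + Y 1 0 * b) * Y' 1 0 - (Y' 0 0 * a + Y' 1 0 * b) * Y 1 0 by ring.
    by rewrite h h' !mul0r subrr.
  rewrite -(mulIr_eq0 _ (mulIf n0)).
  have -> : (Y 0 0 * Y' 1 0 - Y 1 0 * Y' 0 0) * b =
    (Y' 0 0 * a + Y' 1 0 * b) * Y 0 0 - (Y 0 0 * a + Y 1 0 * b) * Y' 0 0 by ring.
  by rewrite h h' !mul0r subrr.
have [y0|y0] := eqVneq (Y' 0 0) 0.
  have y1 : Y' 1 0 != 0.
    by apply: contra Y0 => /eqP y1; apply/eqP; apply: vec2P; rewrite mxE.
  exists (Y 1 0 / Y' 1 0); apply: vec2P; rewrite mxE ?divfK//.
  rewrite y0 mulr0; apply/eqP; rewrite -(mulIr_eq0 _ (mulIf y1)) cross y0 mulr0.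
  by [].
exists (Y 0 0 / Y' 0 0); apply: vec2P; rewrite mxE ?divfK//.
by apply: (mulIf y0); rewrite -cross mulrAC divfK.
Qed.

(** Gram-Schmidt in dimension two: [M] is 0, or behaves for [Y] like the line of [a], or contains
    besides [a] a non-zero vector orthogonal to it. In the last case [Y] itself is in [M]. *)
Lemma orthogonal_projection (M : set 'cV[R[i]]_2) : M 0 ->
  (forall k X Y, M X -> M Y -> M (k *: X + Y)) ->
  forall Y, exists2 X, M X & forall Z, M Z -> dot2 (Y - X) Z = 0.
Proof.
move=> M0 Mlin Y.
have [M1|] := pselect (forall a, M a -> a = 0).
  by exists 0 => // Z /M1 ->; rewrite dot2C dot20l conj0.
move=> /existsNP[a /not_implyP[Ma /eqP a0]].
have aa := dot2_self_neq0 a0.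
have Ma' k : M (k *: a) by rewrite -[k *: a]addr0; exact: Mlin.
have perp Z : dot2 (Z - (dot2 Z a / dot2 a a) *: a) a = 0.
  by rewrite dot2B dot2M divfK// subrr.
set Y1 := Y - (dot2 Y a / dot2 a a) *: a; have Y1a : dot2 Y1 a = 0 by exact: perp.
have [M2|] := pselect (forall Z, M Z -> dot2 Y1 Z = 0); first by exists ((dot2 Y a / dot2 a a) *: a).
move=> /existsNP[b /not_implyP[Mb /eqP b0]].
pose b1 := b - (dot2 b a / dot2 a a) *: a.
have Mb1 : M b1 by rewrite /b1 addrC -scaleNr; exact: Mlin.
have b10 : b1 != 0.
  apply: contra b0 => /eqP; rewrite /b1 => /eqP; rewrite subr_eq0 => /eqP ->.
  by rewrite dot2C dot2M (dot2C Y1 a) Y1a conj0 mulr0 conj0.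
have [k Y1E] := orthogonal_line a0 b10 Y1a (perp b).
exists Y; last by move=> Z _; rewrite subrr dot20l.
rewrite -[Y](subrK ((dot2 Y a / dot2 a a) *: a)) -/Y1 Y1E.
exact: Mlin.
Qed.

(** * The operator part of a self-adjoint relation *)

Section OperatorPart.
Variable Theta : relation2 R.
Hypothesis Theta_sa : self_adjoint_relation Theta.

Let lin k X Y X' Y' : Theta (X, Y) -> Theta (X', Y') ->
  Theta (k *: X + X', k *: Y + Y').
Proof. by move=> h h'; have [[_ H] _] := Theta_sa; have := H k _ _ h h'. Qed.

Lemma relation_symmetric X Y X' Y' : Theta (X, Y) -> Theta (X', Y') ->
  dot2 Y X' = dot2 X Y'.
Proof. by have [_ <-] := Theta_sa => + h; rewrite [X in X _]Theta_sa.2 => /h. Qed.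

(** The projection of [Y] onto mul Theta is subtracted from [Y], which stays within the relation. *)
Lemma op_part_ex X Y : Theta (X, Y) -> exists Y', op_part Theta (X, Y').
Proof.
move=> XY; have [[z0 _] _] := Theta_sa.
have [||m Mm mP] := @orthogonal_projection (mul_rel Theta) _ _ Y.
- exact: z0.
- by move=> k Z Z' h h'; have := lin k h h'; rewrite scaler0 addr0.
exists (Y - m); split => //; rewrite /=.
by have := lin (-1) Mm XY; rewrite scaler0 add0r scaleN1r addrC.
Qed.

(** Two candidates differ by an element of mul Theta, to which both are orthogonal. *)
Lemma op_valE X Y : op_part Theta (X, Y) -> op_val Theta X = Y.
Proof.
move=> XY; have XY' : op_part Theta (X, op_val Theta X) by exact: (@xgetI _ 0 [set Z | op_part Theta (X, Z)] _ XY).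
have [h p] := XY; have [h' p'] := XY'.
have m : mul_rel Theta (op_val Theta X - Y).
  by have := lin (-1) h h'; rewrite !scaleN1r addNr addrC.
apply/eqP; rewrite -subr_eq0; apply/eqP/dot2_eq0.
by rewrite dot2B (p' _ m) (p _ m) subrr.
Qed.

(* [Theta] and its operator part differ by an element of [mul Theta], which is
   orthogonal to [dom Theta]. *)
Lemma dot2_op_val X Y X' Y' : Theta (X, Y) -> Theta (X', Y') ->
  dot2 (op_val Theta X) X' = dot2 Y X'.
Proof.
move=> h h'; have [Z hZ] := op_part_ex h; rewrite (op_valE hZ).
by have [hZ' _] := hZ; rewrite (relation_symmetric hZ' h') (relation_symmetric h h').
Qed.

End OperatorPart.

Variables (lam : R) (u v : endpoint -> R -> R).
Hypothesis pairs : forall e, non_principal_pair l e lam (u e) (v e).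
Variable t : sesq_form R.
Hypothesis t_closed : closed_semibounded_form l t.
Hypothesis t_AC : forall g, fdom t g -> AC_loc l g.
Hypothesis t_cvg : forall e g, fdom t g -> exists z, ccvg l e (fun x => g x / (v e x)%:C) z.
Hypothesis t_A0 : form_operator l t = A_0 l (v Left) (v Right).
Variable L : op_graph R.
Hypothesis L_ext : self_adjoint_extension l L.

Notation Lam := (Lambda l (v Left) (v Right)).
Notation trace := (trace l u v).

(** The graph [L] is saturated for almost everywhere equality; [max_elem] singles out the
    representatives that possess boundary values. *)
Definition boundary_relation : relation2 R := [set XY | exists f F H,
  [/\ max_elem l f F H, L (f, H) & trace f F XY.1 XY.2]].

Let L_adj : adjoint l L = L. Proof. by have [[]] := L_ext. Qed.

(** From L_min contained in L and L = L^* it follows that L is contained in L_min^*, whose elements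
    are described by [adjoint_L_min]. *)
Lemma extension_max f h : L (f, h) -> exists f' F K,
  [/\ max_elem l f' F K, L (f', K), eq_ae I f f' & eq_ae I h K].
Proof.
move=> Lfh; have [[[hil sat _ _ _] _ _] sub] := L_ext.
have : adjoint l (L_min l) (f, h).
  by have := Lfh; rewrite -{1}L_adj => -[? ? adj]; split => // f' h' /sub; exact: adj.
move=> /(adjoint_L_min (pair_fund (pairs Left))) [f' [F [K [m e1 e2]]]].
by exists f', F, K; split => //; have [_ h1 h2] := m; exact: sat e1 e2 Lfh.
Qed.

Lemma boundary_relation_self_adjoint : self_adjoint_relation boundary_relation.
Proof.
have [[[hil sat L0 Llin _] _ _] _] := L_ext.
have lin : forall k x y, boundary_relation x -> boundary_relation y ->
    boundary_relation (k *: x.1 + y.1, k *: x.2 + y.2).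
  move=> k x y [f [F [H [m Lf tr]]]] [f' [F' [H' [m' Lf' tr']]]].
  have M := max_elem_lin k m m'.
  eexists; eexists; eexists; split; first exact: M.
    exact: Llin.
  exact: trace_lin.
split; first split => //.
  have [f [F [K [m Lf _ _]]]] := extension_max L0.
  have [X [Y tr]] := trace_ex pairs m.
  have XY : boundary_relation (X, Y) by exists f, F, K.
  by have := lin (-1) _ _ XY XY; rewrite !scaleN1r !addNr.
apply/seteqP; split => [[X Y] adj|[X Y] [g [G [K [gm Lg tr]]]] [X' Y'] [f [F [H [fm Lf tr']]]]].
  (* Surjectivity gives an element with the boundary values [X] and [Y]. Green's identity turns the
     adjointness of these values into membership of the element in L^* = L. *)
  have [g [G [K [gm tr]]]] := trace_surj pairs X Y.
  exists g, G, K; split => //; rewrite -L_adj; have [_ hg hK] := gm; split => // f h Lf.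
  have [hf hh] := hil _ _ Lf.
  have [f' [F [H [fm Lf' e1 e2]]]] := extension_max Lf; have [_ hf' hH] := fm.
  rewrite (hdot_ae hh hH hg hg e2); last exact/aeW.
  rewrite (hdot_ae hf hf' hK hK e1); last exact/aeW.
  have [X' [Y' tr']] := trace_ex pairs fm.
  have XY : boundary_relation (X', Y') by exists f', F, H.
  apply/eqP; rewrite -subr_eq0 (trace_green pairs fm tr' gm tr) subr_eq0; apply/eqP.
  exact: adj _ XY.
move: Lg; rewrite -L_adj => -[_ _ adj].
apply/eqP; rewrite -subr_eq0 -(trace_green pairs fm tr' gm tr) subr_eq0; apply/eqP.
exact: adj Lf.
Qed.

Let sa := boundary_relation_self_adjoint.

Let Lambda_eq f f0 : fdom t f0 -> (forall x, I x -> f x = f0 x) -> Lam f = Lam f0.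
Proof.
move=> tf E; have lim_eq e : lim_at l e (fun x => f x / (v e x)%:C) =
    lim_at l e (fun x => f0 x / (v e x)%:C).
  have [z zc] := t_cvg e tf; rewrite (lim_atE zc); apply: lim_atE.
  by apply: ccvg_eq zc => x Ix; rewrite E.
by congr vec2; exact: lim_eq.
Qed.

Lemma extension_form f h : L (f, h) -> exists f0 X Y,
  [/\ fdom t f0, eq_ae I f f0, Lam f0 = X, boundary_relation (X, Y) &
  forall g, fdom t g -> fval t f0 g = hdot l h g - dot2 Y (Lam g)].
Proof.
move=> Lf; have [[[hil _ _ _ _] _ _] _] := L_ext; have [hf hh] := hil _ _ Lf.
have [f' [F [H [fm Lf' e1 e2]]]] := extension_max Lf; have [fs hf' hH] := fm.
have [X [Y tr]] := trace_ex pairs fm.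
have [f0 [tf0 E0 gr]] := max_form_green t_closed pairs t_AC t_cvg t_A0 fm tr.
exists f0, X, Y; split => //.
- by apply: aeS e1 => x h1 Ix; rewrite h1// E0.
- by rewrite -(Lambda_eq tf0 E0); have [] := trace_maps pairs fs tr.
- by exists f', F, H.
move=> g tg; rewrite gr//; congr (_ - _).
have [[[dom _] _ _ _ _] _ _] := t_closed.
apply: hdot_ae => //; do ?[exact: dom]; last exact/aeW.
by apply: aeS e2 => x h1 Ix; rewrite h1.
Qed.

Lemma extension_perturbation :
  L = A_pert l (v Left) (v Right) t boundary_relation.
Proof.
have [[[hil _ _ _ _] _ _] _] := L_ext.
have [[[dom _] _ _ _ herm] _ _] := t_closed.
apply/seteqP; split => -[f h].
  move=> Lf; have [hf hh] := hil _ _ Lf; split => //=.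
  have [f0 [X [Y [tf0 E0 LamX XY gr]]]] := extension_form Lf.
  exists f0; split => //=.
    by split=> //; rewrite LamX; exact: (op_part_ex sa XY).
  move=> g [tg [Z [ZP _]]].
  by rewrite gr// LamX (dot2_op_val sa XY ZP) subrK.
move=> [/= hf hh [f0 /= [[tf0 [Z ZP]] E0 gr]]].
rewrite -L_adj; split => //= g k Lg; have [hg hk] := hil _ _ Lg.
have [g0 [X [Y [tg0 E1 LamX XY gr']]]] := extension_form Lg.
have domg : exists Y', op_part boundary_relation (Lam g0, Y').
  by rewrite LamX; exact: (op_part_ex sa XY).
(* After conjugation the two boundary terms cancel by the symmetry of the relation, which leaves <k,
   f> = <g, h> for all (g, k) in L. *)
have := gr g0 (conj tg0 domg); rewrite (op_valE sa ZP) herm// gr'// LamX.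
have [ZP1 _] := ZP; rewrite (relation_symmetric sa ZP1 XY) => E.
have Ef : hdot l k f = hdot l k f0.
  by apply: hdot_ae => //; [exact: dom|exact/aeW].
have Eg : hdot l g h = hdot l g0 h.
  by apply: hdot_ae => //; [exact: dom|exact/aeW].
rewrite Ef Eg (hdotC hh (dom _ tg0)) -E.
by rewrite conjD conjK -dot2C subrK.
Qed.

End Perturbation.

(* [t] is the closed semi-bounded form associated with [A_0]. *)
Theorem theorem3p6 (R : realType) (l : sturm_liouville R)
    (lam0 : R) (va vb : R -> R) (c d : R) (t : sesq_form R)
    (Hlim_a : limit_circle l Left) (Hlim_b : limit_circle l Right)
    (Hosc_a : non_oscillatory l Left lam0)
    (Hosc_b : non_oscillatory l Right lam0)
    (Hbdd : bounded_below l (L_min l))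
    (Hva : normalized_non_principal l Left lam0 va)
    (Hvb : normalized_non_principal l Right lam0 vb)
    (Hac : (sl_a l < c%:E)%E) (Hcd : (c < d)%R) (Hdb : (d%:E < sl_b l)%E)
    (Hva0 : zero_free (piece l Left c) va)
    (Hvb0 : zero_free (piece l Right d) vb)
    (Ht_dom : fdom t = form_domain l va vb c d)
    (Ht_closed : closed_semibounded_form l t)
    (Ht_A0 : form_operator l t = A_0 l va vb)
    (L : op_graph R) (HL : self_adjoint_extension l L) :
  exists Theta : relation2 R,
    self_adjoint_relation Theta /\ L = A_pert l va vb t Theta.
Proof.
have [ua Pa] := normalized_pair Hlim_a Hlim_b Hva.
have [ub Pb] := normalized_pair Hlim_a Hlim_b Hvb.
pose u e := if e is Left then ua else ub.
pose v e := if e is Left then va else vb.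
have pairs e : non_principal_pair l e lam0 (u e) (v e) by case: e.
have Ic : interval_of l c by split=> //; apply: lt_trans Hdb; rewrite lte_fin.
have Id : interval_of l d by split=> //; apply: lt_trans Hac _; rewrite lte_fin.
have t_AC g : fdom t g -> AC_loc l g by rewrite Ht_dom => -[].
have t_cvg e g : fdom t g -> exists z, ccvg l e (fun x => (g x / (v e x)%:C%C)%R) z.
  rewrite Ht_dom => -[_ ag _ Na Nb].
  have [v1 _ _ _] := fund_v (pair_fund (pairs e)).
  have acv x y : interval_of l x -> interval_of l y -> abs_continuous x y (v e).
    by move=> Ix Iy; have [] := v1 x y Ix Iy.
  have [c' [Ic' _ iv]] := pair_free (pairs e).
  have iv' : exists2 c' : R, interval_of l c' & lebesgue_measure.-integrable (piece l e c')
      (EFin \o (fun x => ((sl_p l x * v e x ^+ 2)^-1)%R)) by exists c'.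
  case: e acv iv' {v1 iv Ic'} => acv iv'.
    exact: form_domain_cvg Ic Hva0 acv iv' ag Na.
  exact: form_domain_cvg Id Hvb0 acv iv' ag Nb.
exists (boundary_relation l u v L); split.
  exact: (boundary_relation_self_adjoint pairs HL).
exact: (extension_perturbation pairs Ht_closed t_AC t_cvg Ht_A0 HL).
Qed.
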